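(* Let $\theta_0\in\mathbb{R}^p$ and let $(\hat\theta_n)_{n\ge1}$ be a sequence of random vectors in $\mathbb{R}^p$ such that for every $n$ $$\hat\theta_n-\theta_0=\Sigma_0^{1/2}\,\frac1n\sum_{i=1}^n Z_i+R_n ,$$ where $Z_1,Z_2,\ldots$ are i.i.d. random vectors in $\mathbb{R}^p$ with mean zero and with the $p\times p$ identity matrix as covariance matrix, $\Sigma_0$ is a $p\times p$ covariance matrix, and the $R_n$ are random vectors. Suppose that $$D_m=\sqrt m\,\sup_{n\ge m}\|R_n\|\to 0\quad\text{in probability as } m\to\infty ;$$ in particular $\sqrt n(\hat\theta_n-\theta_0)$ converges in distribution to $N_p(0,\Sigma_0)$. For $\varepsilon>0$ let $$N_\varepsilon=\sup\{n\ge1:\|\hat\theta_n-\theta_0\|\ge\varepsilon\}.$$ Let $G_p(s)=\Sigma_0^{1/2}W(s)$, where $W(s)=(W_1(s),\ldots,W_p(s))'$ is a vector of $p$ independent standard Brownian motions, each evaluated at the same $s$. Then, as $\varepsilon\to0$, $$\varepsilon^2N_\varepsilon\to_d G_{p,\max}^2=\Bigl\{\sup_{0\le s\le1}\|G_p(s)\|\Bigr\}^2=\sup_{0\le s\le1}\|\Sigma_0^{1/2}W(s)\|^2 .$$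
   Context: $\to_d$ denotes convergence in distribution. The distance function $\|\cdot\|$ is a given function on $\mathbb{R}^p$ with the properties: $\|x+y\|\le\|x\|+\|y\|$; $\|x\|=0$ if and only if $x=0$; $\|x_n\|\to\|x\|$ when $x_n\to x$; $\|ax\|=|a|\,\|x\|$ for scalars $a$; and $\|(x_1,\ldots,x_p)'\|\le c\sum_{i=1}^p|x_i|$ for some constant $c$. $\Sigma_0^{1/2}$ is the symmetric nonnegative definite square root of $\Sigma_0$. The supremum of the empty set in the definition of $N_\varepsilon$ is taken to be $0$. *)

(* Defs.v *)
From HB Require Import structures.
From mathcomp Require Import all_boot all_order all_algebra.
From mathcomp Require Import all_classical all_reals all_analysis.

Set Implicit Arguments.
Unset Strict Implicit.
Unset Printing Implicit Defensive.

Import Order.TTheory GRing.Theory Num.Theory.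
Import numFieldNormedType.Exports.

Local Open Scope classical_set_scope.
Local Open Scope ring_scope.

(* The continuity requirement is with respect to the usual (entrywise)
   topology of 'cV[R]_p. *)
Definition distance_function (R : realType) (p : nat) (nrm : 'cV[R]_p -> R) :=
  [/\ forall x y, nrm (x + y) <= nrm x + nrm y,
      forall x, nrm x = 0 <-> x = 0,
      forall (u : nat -> 'cV[R]_p) x,
        u @ \oo --> x -> (fun n => nrm (u n)) @ \oo --> nrm x,
      forall (a : R) x, nrm (a *: x) = `|a| * nrm x
    & exists c : R, forall x, nrm x <= c * \sum_(i < p) `|x i ord0|].

Definition sym_psd (R : realType) (p : nat) (A : 'M[R]_p) :=
  A^T = A /\ forall x : 'cV[R]_p, 0 <= (x^T *m A *m x) ord0 ord0.

(* There is exactly one such S for each symmetric nonnegative definite A. *)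
Definition sym_psd_sqrt (R : realType) (p : nat) (A S : 'M[R]_p) :=
  sym_psd S /\ S *m S = A.

Definition random_vector d (T : measurableType d) (R : realType) (p : nat)
    (X : T -> 'cV[R]_p) :=
  forall i : 'I_p, measurable_fun setT (fun w => X w i ord0).

(* Borel sets of R^p, as the sigma-algebra generated by the coordinates. *)
Definition vborel (R : realType) (p : nat) : set (set 'cV[R]_p) :=
  g_sigma_preimage (fun (i : 'I_p) (x : 'cV[R]_p) => (x i ord0 : R)).

Definition mutually_independent d (T : measurableType d) (R : realType)
    (P : probability T R) (I : eqType) (F : I -> set (set T)) :=
  forall (s : seq I) (A : I -> set T), uniq s ->
    (forall i, i \in s -> F i (A i)) ->
    P (\bigcap_(i in [set` s]) A i) = (\prod_(i <- s) P (A i))%E.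

Definition iid_vectors d (T : measurableType d) (R : realType)
    (P : probability T R) (p : nat) (Z : nat -> T -> 'cV[R]_p) :=
  [/\ forall i, random_vector (Z i),
      mutually_independent P
        (fun i => preimage_set_system setT (Z i) (@vborel R p))
    & forall i j A, @vborel R p A -> P (Z i @^-1` A) = P (Z j @^-1` A)].

Definition mean_zero d (T : measurableType d) (R : realType)
    (P : probability T R) (p : nat) (X : T -> 'cV[R]_p) :=
  forall i : 'I_p,
    P.-integrable setT (EFin \o (fun w => X w i ord0)) /\
    'E_P[fun w => X w i ord0]%E = 0%E.

Definition identity_covariance d (T : measurableType d) (R : realType)
    (P : probability T R) (p : nat) (X : T -> 'cV[R]_p) :=
  forall i j : 'I_p,
    covariance P (fun w => X w i ord0) (fun w => X w j ord0)
      = ((1%:M : 'M[R]_p) i j)%:E.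

(* B is only constrained at times t >= 0.  The second parameter of normal_prob
   is the standard deviation; it has to be positive.  All paths are continuous,
   so that suprema over time intervals are random variables. *)
Definition standard_brownian_motion d (T : measurableType d) (R : realType)
    (P : probability T R) (B : R -> T -> R) :=
  [/\ forall t, 0 <= t -> measurable_fun setT (B t),
      \forall w \ae P, B 0 w = 0,
      forall t : nat -> R, 0 <= t 0%N -> nondecreasing_seq t ->
        mutually_independent P (fun k : nat =>
          preimage_set_system setT (B (t k.+1) \- B (t k)) measurable),
      forall s t, 0 <= s -> s < t -> forall A : set R, measurable A ->
        P ((B t \- B s) @^-1` A) = normal_prob 0 (Num.sqrt (t - s)) A
    & forall w, {within `[0, +oo[, continuous (B ^~ w)}].

Definition brownian_vector d (T : measurableType d) (R : realType)
    (P : probability T R) (p : nat) (W : R -> T -> 'cV[R]_p) :=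
  (forall j : 'I_p, standard_brownian_motion P (fun t w => W t w j ord0)) /\
  mutually_independent P (fun j : 'I_p =>
    <<s \bigcup_(t in [set t : R | 0 <= t])
          preimage_set_system setT (fun w => W t w j ord0) measurable >>).

Definition cvg_in_probability0 d (T : measurableType d) (R : realType)
    (P : probability T R) (X : nat -> T -> \bar R) :=
  forall e : R, 0 < e ->
    P [set w | (e%:E <= `|X m w|)%E] @[m --> \oo] --> 0%E.

(* Extended real random variables; X and Y may live on different spaces.
   Pointwise convergence of the distribution functions at the real continuity
   points of the limit determines the limiting masses at -oo and +oo. *)
Definition cvg_in_distribution (R : realType) (I : Type) (F : set_system I)
    d (T : measurableType d) (P : probability T R) (X : I -> T -> \bar R)
    d' (T' : measurableType d') (P' : probability T' R) (Y : T' -> \bar R) :=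
  forall x : R,
    {for x, continuous (fun y : R => P' [set w | (Y w <= y%:E)%E])} ->
    P [set w | (X i w <= x%:E)%E] @[i --> F] --> P' [set w | (Y w <= x%:E)%E].

(* sqrt m * sup_{n >= m} ||R_n||, possibly +oo *)
Definition tail_sup (R : realType) (p : nat) (nrm : 'cV[R]_p -> R)
    (T : Type) (Rn : nat -> T -> 'cV[R]_p) (m : nat) (w : T) : \bar R :=
  ((Num.sqrt m%:R)%:E *
     ereal_sup [set (nrm (Rn n w))%:E | n in [set n | (m <= n)%N]])%E.

(* Possibly +oo.  The element 0 is added to the set only so that the supremum
   of the empty set of indices is 0 rather than -oo. *)
Definition last_exit (R : realType) (p : nat) (nrm : 'cV[R]_p -> R)
    (T : Type) (theta : nat -> T -> 'cV[R]_p) (theta0 : 'cV[R]_p)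
    (eps : R) (w : T) : \bar R :=
  ereal_sup (0%E |`
    [set (n%:R)%:E | n in [set n : nat |
       (1 <= n)%N /\ eps <= nrm (theta n w - theta0)]]).

(* Main.v *)
Require Import Defs.
From HB Require Import structures.
From mathcomp Require Import all_boot all_order all_algebra.
From mathcomp Require Import all_classical all_reals all_analysis.
From mathcomp Require Import measurable_realfun ring lra.

(* Put q(x) = ||Sigma0^{1/2} x|| and S_n = Z_1 + ... + Z_n.  For x > 0 the event
   eps^2 N_eps > x says that ||theta_n - theta_0|| >= eps for some n >= m, where
   m is the least integer above x / eps^2, so that sqrt m * eps is close to
   sqrt x.  By the hypothesis on D_m this is, up to small probability and a
   small shift of the level, the event that sqrt m * q(S_n) / n exceeds sqrt x
   for some n >= m.

   Take finitely many indices n_k >= m with m / n_k -> s_k.  By a Lindeberg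
   argument on characteristic functions the vectors sqrt m * S_{n_k} / n_k
   converge jointly to W(s_k), because the covariance m / max(n_k, n_l) tends to
   min(s_k, s_l).  Between grid points the sums are controlled by Ottaviani's
   inequality, a one-block central limit theorem and a fourth moment bound for
   Brownian increments; for n >= A m Ottaviani and Chebyshev give a bound of
   order 1 / A.  Hence the probability of crossing a level a after time m is
   asymptotically between P(sup q(W) > a + delta) and P(sup q(W) > a - delta),
   which yields convergence at the continuity points of the limit law.

   Weak convergence is tested on bounded Lipschitz functions, which are
   approximated by trigonometric polynomials.  The characteristic function of a
   Brownian increment is obtained by cutting it into many independent pieces,
   so only low moments of the Gaussian law are needed. *)

(** Only second moments of the [Z i] are available, and this shapes the two main estimates. The
    indices from m to A m are cut into A H blocks of length about m / H. Chebyshev bounds the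
    probability of a large oscillation in one block by a multiple of 1 / H, so the sum over the
    blocks would not become small. Each block is therefore first compared with a Brownian increment,
    whose fourth moment gives 1 / H^2. The order of choice is A, then H, then m. A trigonometric
    polynomial cannot in general be uniformly close to a given Lipschitz function. The error allowed
    is e (1 + sum of x_i^2), whose mean is small because the second moments are bounded uniformly in
    m; this bound stands in for tightness. Laws are always compared at two levels a < b, with a
    Lipschitz ramp in between, so strict and weak inequalities can be exchanged freely. Continuity
    of the limiting distribution function enters once, at the very end, to close these gaps. *)

Set Implicit Arguments.
Unset Strict Implicit.
Unset Printing Implicit Defensive.

Import Order.TTheory GRing.Theory Num.Theory.
Import numFieldNormedType.Exports.

Local Open Scope classical_set_scope.
Local Open Scope ring_scope.

(** * Elementary inequalities *)


Section elementary_inequalities.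
Context {R : realType}.
Implicit Types x y a b c : R.

Lemma le_of_derive_le (f f' : R -> R) x :
  (forall y, is_derive y 1 f (f' y)) -> (forall y, 0 <= y -> 0 <= f' y) ->
  f 0 = 0 -> 0 <= x -> 0 <= f x.
Proof.
move=> df f'0 f0; rewrite le_eqVlt => /predU1P[<-|x0]; first by rewrite f0.
rewrite -f0; apply: (@ger0_derive1_le_cc _ f 0 x) => //.
- move=> y; rewrite in_itv/= => /andP[y0 _].
  by rewrite derive1E; have [_ ->] := df y; exact: f'0 (ltW y0).
- apply: derivable_within_continuous => y _.
  by have := df y; case.
- by rewrite in_itv/= lexx ltW.
- by rewrite in_itv/= lexx andbT ltW.
- exact: ltW.
Qed.

Lemma sin_le_id x : 0 <= x -> sin x <= x.
Proof.
move=> x0; rewrite -subr_ge0.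
apply: (@le_of_derive_le (fun x => x - sin x) (fun x => 1 - cos x)) => //.
by rewrite sin0 subr0.
Qed.

Lemma norm_sin_le x : `|sin x| <= `|x|.
Proof.
wlog x0 : x / 0 <= x.
  move=> H; have [/H//|/ltW x0] := leP 0 x.
  by rewrite -normrN -sinN -(normrN x); apply: H; rewrite oppr_ge0.
rewrite (ger0_norm x0) ler_norml; apply/andP; split; last exact: sin_le_id.
have [x1|x1] := leP x 1.
  apply: (@le_trans _ _ 0); first by rewrite oppr_le0.
  apply: sin_ge0_pi; rewrite x0/= (le_trans x1)//.
  by rewrite (le_trans _ (pi_ge2 _))// ler1n.
by rewrite (le_trans _ (sin_geN1 x))// lerN2 ltW.
Qed.

Lemma cos_sin_half x : 1 - cos x = 2 * sin (x / 2) ^+ 2.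
Proof.
rewrite {1}(splitr x) cosD -!expr2 -[X in X - _](cos2Dsin2 (x / 2)).
by ring.
Qed.

Lemma one_sub_cos_le x : 1 - cos x <= x ^+ 2 / 2.
Proof.
rewrite cos_sin_half; have := norm_sin_le (x / 2).
rewrite -ler_sqr ?nnegrE// !real_normK ?num_real// => h.
have -> : x ^+ 2 / 2 = 2 * (x / 2) ^+ 2 by field.
by lra.

Qed.

(** A Taylor remainder in Lindeberg's form: at most [x ^+ 2], hence integrable under finite second
    moments, and cubic near 0, hence negligible for small summands. *)
Definition trunc_sqr x := x ^+ 2 * Num.min 1 `|x|.

Lemma trunc_sqr_le_sqr x : trunc_sqr x <= x ^+ 2.
Proof. by rewrite ler_piMr ?sqr_ge0// ge_min lexx. Qed.

Lemma trunc_sqr_le_cube x : trunc_sqr x <= `|x| ^+ 3.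
Proof.
rewrite /trunc_sqr -[x ^+ 2]real_normK ?num_real// (exprSr _ 2).
by rewrite ler_wpM2l ?exprn_ge0// ge_min lexx orbT.
Qed.

Lemma sin_ge_cubic x : 0 <= x -> x - sin x <= x ^+ 3 / 6.
Proof.
move=> x0; rewrite -subr_ge0.
apply: (@le_of_derive_le (fun x => x ^+ 3 / 6 - (x - sin x))
  (fun x => x ^+ 2 / 2 - (1 - cos x))) => //.
- move=> y; apply: is_derive_eq.
  by rewrite /GRing.scale/=; field.
- by move=> y _; rewrite subr_ge0 one_sub_cos_le.
- by rewrite sin0; lra.
Qed.

Lemma norm_sub_sin_le x : `|x - sin x| <= `|x| ^+ 3 / 6.
Proof.
wlog x0 : x / 0 <= x.
  move=> H; have [/H//|/ltW x0] := leP 0 x.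
  rewrite -normrN -(normrN x) opprB.
  have -> : sin x - x = - x - sin (- x) by rewrite sinN; ring.
  by apply: H; rewrite oppr_ge0.
rewrite (ger0_norm x0) ger0_norm; first exact: sin_ge_cubic.
by rewrite subr_ge0 sin_le_id.
Qed.

Lemma sin_taylor x : `|x - sin x| <= trunc_sqr x.
Proof.
rewrite /trunc_sqr; have [x1|x1] := leP 1 `|x|; last first.
  have := norm_sub_sin_le x; rewrite -[x ^+ 2]real_normK ?num_real//.
  have : 0 <= `|x| ^+ 3 by rewrite exprn_ge0.
  by rewrite -exprSr; lra.
rewrite mulr1 -[x ^+ 2]real_normK ?num_real//.
(* The cubic bound with constant 1/6 stays below the square up to 6; beyond 6, |x - sin x| <= 2 |x|
   <= x^2. *)
have [x6|x6] := leP `|x| 6.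
  have := norm_sub_sin_le x.
  have : 0 <= `|x| ^+ 2 by rewrite exprn_ge0.
  by nra.
have := norm_sin_le x; have := ler_normB x (sin x).
by nra.
Qed.

Lemma sub_sin_le_sqr x : `|x - sin x| <= x ^+ 2.
Proof. exact: le_trans (sin_taylor x) (trunc_sqr_le_sqr x). Qed.

Lemma cos_taylor x : `|cos x - (1 - x ^+ 2 / 2)| <= trunc_sqr x.
Proof.
rewrite ger0_norm; last by have := one_sub_cos_le x; lra.
have -> : cos x - (1 - x ^+ 2 / 2) = x ^+ 2 / 2 - (1 - cos x) by ring.
rewrite /trunc_sqr; have [x1|x1] := leP 1 `|x|.
  have := cos_le1 x; have : 0 <= x ^+ 2 by rewrite sqr_ge0.
  by lra.
rewrite cos_sin_half.
(* Difference of squares: for y = x / 2 one factor is at most y^2 and the other at most |x|, which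
   produces the cube. *)
have -> : x ^+ 2 / 2 - 2 * sin (x / 2) ^+ 2 =
  2 * ((x / 2 - sin (x / 2)) * (x / 2 + sin (x / 2))) by field.
apply: (le_trans (ler_norm _)); rewrite normrM normrM (ger0_norm (ler0n _ 2)).
have h1 := sub_sin_le_sqr (x / 2).
have h2 : `|x / 2 + sin (x / 2)| <= `|x|.
  rewrite (le_trans (ler_normD _ _))//.
  have := norm_sin_le (x / 2).
  by rewrite !normrM normfV (ger0_norm (ler0n _ 2)); lra.
apply: (@le_trans _ _ (2 * ((x / 2) ^+ 2 * `|x|))).
  by rewrite ler_wpM2l// ler_pM.
have : 0 <= x ^+ 2 * `|x| by rewrite mulr_ge0// sqr_ge0.
have -> : 2 * ((x / 2) ^+ 2 * `|x|) = 2^-1 * (x ^+ 2 * `|x|) by field.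
by lra.
Qed.

Lemma expRN_taylor x : 0 <= x -> `|expR (- x) - (1 - x)| <= x ^+ 2.
Proof.
move=> x0; rewrite ger0_norm; last first.
  by have := expR_ge1Dx (- x); lra.
rewrite expRN.
have h := expR_ge1Dx x; have x1 : 0 < 1 + x by lra.
have e0 : 0 < expR x by apply: expR_gt0.
apply: (@le_trans _ _ ((1 + x)^-1 - (1 - x))).
  by rewrite lerD2r lef_pV2 ?posrE.
have -> : (1 + x)^-1 - (1 - x) = x ^+ 2 * (1 + x)^-1 by (field; lra).
by rewrite ler_piMr ?sqr_ge0// invf_le1//; lra.
Qed.

(* The estimates for sinh follow from [1 + 2 y <= expR (2 y)]. *)
Lemma sinh_bounds y : 0 <= y ->
  2 * y * expR (- y) <= expR y - expR (- y) <= 2 * y * expR y.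
Proof.
move=> y0; have p : expR y * expR (- y) = 1 by apply: expRxMexpNx_1.
have e1 : 0 < expR y by apply: expR_gt0.
have e2 : 0 < expR (- y) by apply: expR_gt0.
have h1 := expR_ge1Dx (y + y); rewrite expRD in h1.
have h2 := expR_ge1Dx (- y + - y); rewrite expRD in h2.
by apply/andP; split; nra.
Qed.

End elementary_inequalities.

(** * Means and probabilities as real numbers *)


Section mean_and_probability.
Context d (T : measurableType d) (R : realType) (P : probability T R).
Implicit Types (f g : T -> R) (A B : set T).

(** Means and probabilities are kept in [R], so that [lra], [nra] and [field] apply to the
    estimates; [pr_fin] leads back to the measure. *)
Definition intg f := P.-integrable setT (EFin \o f).
Definition mean f : R := \int[P]_w f w.
Definition pr A : R := fine (P A).

Lemma intg_measurable f : intg f -> measurable_fun setT f.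
Proof. by move=> /integrableP[/measurable_EFinP]. Qed.

Lemma intg_bounded f M : measurable_fun setT f -> (forall w, `|f w| <= M) ->
  intg f.
Proof.
move=> mf fM; apply: measurable_bounded_integrable => //.
  by rewrite (le_lt_trans (probability_le1 P measurableT))// ltry.
by exists M; split; [exact: num_real|move=> x Mx w _; exact: le_trans (ltW Mx)].
Qed.

Lemma intg_cst a : intg (cst a).
Proof. exact: (@intg_bounded _ `|a|). Qed.

Lemma intgD f g : intg f -> intg g -> intg (fun w => f w + g w).
Proof. by move=> intf ig; exact: integrableD intf ig. Qed.

Lemma intgB f g : intg f -> intg g -> intg (fun w => f w - g w).
Proof. by move=> intf ig; exact: integrableB intf ig. Qed.

Lemma intgZ a f : intg f -> intg (fun w => a * f w).
Proof. by move=> intf; exact: integrableZl intf. Qed.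

Lemma intg_norm f : intg f -> intg (fun w => `|f w|).
Proof. by move=> intf; exact: integrable_norm intf. Qed.

Lemma intg_sum (I : Type) (s : seq I) (f : I -> T -> R) :
  (forall i, intg (f i)) -> intg (fun w => \sum_(i <- s) f i w).
Proof.
move=> fi; elim: s => [|i s ih].
  by under eq_fun do rewrite big_nil; exact: intg_cst.
by under eq_fun do rewrite big_cons; exact: intgD.
Qed.

Lemma intg_le f g : measurable_fun setT f -> (forall w, `|f w| <= g w) ->
  intg g -> intg f.
Proof.
move=> mf fg ig; apply: le_integrable ig => //; first exact/measurable_EFinP.
by move=> w _ /=; rewrite lee_fin (le_trans (fg w))// ler_norm.
Qed.

Lemma mean_cst a : mean (cst a) = a.
Proof. by rewrite /mean Rintegral_cst//= probability_setT mulr1. Qed.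

Lemma meanD f g : intg f -> intg g ->
  mean (fun w => f w + g w) = mean f + mean g.
Proof. by move=> intf ig; exact: RintegralD. Qed.

Lemma meanB f g : intg f -> intg g ->
  mean (fun w => f w - g w) = mean f - mean g.
Proof. by move=> intf ig; exact: RintegralB. Qed.

Lemma meanZ a f : intg f -> mean (fun w => a * f w) = a * mean f.
Proof. by move=> intf; exact: RintegralZl. Qed.

Lemma mean_sum (I : Type) (s : seq I) (f : I -> T -> R) :
  (forall i, intg (f i)) ->
  mean (fun w => \sum_(i <- s) f i w) = \sum_(i <- s) mean (f i).
Proof.
move=> fi; elim: s => [|i s ih].
  rewrite big_nil -[RHS](mean_cst 0); congr mean.
  by apply/funext => w; rewrite big_nil.
rewrite big_cons -ih -meanD//; last exact: intg_sum.
by congr mean; apply/funext => w; rewrite big_cons.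
Qed.

Lemma mean_le f g : intg f -> intg g -> (forall w, f w <= g w) ->
  mean f <= mean g.
Proof. by move=> intf ig fg; exact: le_Rintegral. Qed.

Lemma mean_ge0 f : (forall w, 0 <= f w) -> 0 <= mean f.
Proof. by move=> f0; exact: Rintegral_ge0. Qed.

Lemma norm_mean_le f g : intg f -> intg g -> (forall w, `|f w| <= g w) ->
  `|mean f| <= mean g.
Proof.
move=> intf ig fg; apply: (le_trans (le_normr_Rintegral _ intf)) => //.
by apply: mean_le => //; exact: intg_norm.
Qed.

Lemma norm_meanB_le f g h : intg f -> intg g -> intg h ->
  (forall w, `|f w - g w| <= h w) -> `|mean f - mean g| <= mean h.
Proof.
by move=> *; rewrite -meanB//; apply: norm_mean_le => //; exact: intgB.
Qed.

Lemma norm_mean_le_cst f M : measurable_fun setT f ->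
  (forall w, `|f w| <= M) -> `|mean f| <= M.
Proof.
move=> mf fM; rewrite -[leRHS](mean_cst M).
by apply: norm_mean_le => //; [exact: intg_bounded fM|exact: intg_cst].
Qed.

Lemma intg_indic A : measurable A -> intg (\1_A).
Proof.
move=> mA; apply: (@intg_bounded _ 1); first exact: measurable_indic.
by move=> w; rewrite indicE ger0_norm// lern1 leq_b1.
Qed.

Lemma mean_indic A : measurable A -> mean (\1_A) = pr A.
Proof. by move=> mA; rewrite /mean /Rintegral integral_indic// setIT. Qed.

Lemma pr_fin A : measurable A -> (pr A)%:E = P A.
Proof. by move=> mA; rewrite fineK// fin_num_measure. Qed.

Lemma pr_ge0 A : 0 <= pr A.
Proof. exact: fine_ge0. Qed.

Lemma pr_le A B : measurable A -> measurable B -> A `<=` B -> pr A <= pr B.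
Proof.
by move=> mA mB AB; rewrite -lee_fin !pr_fin// le_measure ?inE.
Qed.

Lemma pr_le1 A : measurable A -> pr A <= 1.
Proof. by move=> mA; rewrite -lee_fin pr_fin// probability_le1. Qed.

Lemma pr_setC A : measurable A -> pr (~` A) = 1 - pr A.
Proof.
move=> mA; apply: EFin_inj; rewrite pr_fin; last exact: measurableC.
by rewrite probability_setC// EFinB pr_fin.
Qed.

Lemma pr_setU A B : measurable A -> measurable B ->
  pr (A `|` B) <= pr A + pr B.
Proof.
move=> mA mB; rewrite -lee_fin EFinD !pr_fin//; last exact: measurableU.
exact: measureU2.
Qed.

Lemma pr0 : pr set0 = 0.
Proof. by rewrite /pr measure0. Qed.

Lemma pr_bigcup_lt (A : nat -> set T) n : (forall i, measurable (A i)) ->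
  pr (\bigcup_(i in [set i | (i < n)%N]) A i) <= \sum_(i < n) pr (A i).
Proof.
move=> mA; elim: n => [|n ih].
  rewrite big_ord0 (_ : \bigcup_(_ in _) _ = set0) ?pr0//.
  by rewrite -subset0 => w [].
rewrite big_ord_recr/= (_ : \bigcup_(i in _) A i =
  (\bigcup_(i in [set i | (i < n)%N]) A i) `|` A n).
  apply: (le_trans (pr_setU _ _)) => //; first exact: bigcup_measurable.
  by rewrite lerD2r.
apply/seteqP; split => w.
  move=> [i /=]; rewrite ltnS leq_eqVlt => /orP[/eqP->|ltin] Aw; first by right.
  by left; exists i.
by move=> [[i /= ltin]|] Aw; [exists i => //=; exact: ltnW|exists n => /=].
Qed.

Lemma pr_bigcup_cvg (A : nat -> set T) : (forall i, measurable (A i)) ->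
  nondecreasing_seq A -> pr (A n) @[n --> \oo] --> pr (\bigcup_n A n).
Proof.
move=> mA ndA; apply: fine_cvg; rewrite pr_fin; last exact: bigcupT_measurable.
by apply: nondecreasing_cvg_mu => //; exact: bigcupT_measurable.
Qed.

Lemma pr_bigcup_le (A : nat -> set T) b : (forall i, measurable (A i)) ->
  (forall n, pr (\bigcup_(i in [set i | (i < n)%N]) A i) <= b) ->
  pr (\bigcup_n A n) <= b.
Proof.
move=> mA Ab.
have -> : \bigcup_n A n =
    \bigcup_n (\bigcup_(i in [set i | (i < n)%N]) A i).
  apply/seteqP; split => w; first by move=> [n _ Aw]; exists n.+1 => //; exists n => /=.
  by move=> [n _ [i _ Aw]]; exists i.
set B := fun n => \bigcup_(i in [set i | (i < n)%N]) A i.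
have cB : pr (B n) @[n --> \oo] --> pr (\bigcup_n B n).
  apply: pr_bigcup_cvg => [i|m n mn]; first exact: bigcup_measurable.
  by apply/subsetPset => w [i /= im Aw]; exists i => //=; exact: leq_trans mn.
rewrite -(cvg_lim _ cB)//; apply: limr_le; first exact: cvgP cB.
by near=> n; exact: Ab.
Unshelve. all: by end_near. Qed.

Lemma pr_markov f a : intg f -> (forall w, 0 <= f w) -> 0 < a ->
  pr [set w | a <= f w] <= mean f / a.
Proof.
move=> intf f0 a0; rewrite ler_pdivlMr// mulrC.
have mA : measurable [set w | a <= f w].
  have := intg_measurable intf => mf.
  rewrite (_ : [set w | _] = f @^-1` `[a, +oo[); last first.
    by apply/seteqP; split => w /=; rewrite in_itv/= andbT.
  by rewrite -[X in measurable X]setTI; exact: mf.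
rewrite -mean_indic// -meanZ; last exact: intg_indic.
apply: mean_le => //; first by apply: intgZ; exact: intg_indic.
move=> w; rewrite indicE; case: (boolP (w \in _)) => [|_]; last by rewrite mulr0.
by rewrite inE/= mulr1.
Qed.

Lemma mean_dominated (f_ : nat -> T -> R) f g :
  (forall n, measurable_fun setT (f_ n)) -> measurable_fun setT f ->
  (forall w, f_ ^~ w @ \oo --> f w) -> intg g ->
  (forall w n, `|f_ n w| <= g w) ->
  intg f /\ mean (f_ n) @[n --> \oo] --> mean f.
Proof.
move=> mf_ mf ff ig fg.
have [] := @dominated_convergence _ _ _ P setT measurableT
  (fun n => EFin \o f_ n) (EFin \o f) (EFin \o g).
- by move=> n; exact/measurable_EFinP.
- exact/measurable_EFinP.
- by apply: aeW => w _; apply/fine_cvgP; split; [exact: nearW|exact: ff].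
- exact: ig.
- by apply: aeW => w n _ /=; rewrite lee_fin.
move=> intf _ cv; split => //.
apply: fine_cvg; rewrite fineK//.
exact: integrable_fin_num intf.
Qed.

End mean_and_probability.

(** * Independence *)


Section independence.
Context d (T : measurableType d) (R : realType) (P : probability T R).
Implicit Types (A B : set T) (G H : set (set T)).

Definition indep_systems G H :=
  forall A B, G A -> H B -> pr P (A `&` B) = pr P A * pr P B.

Lemma indep_systemsC G H : indep_systems G H -> indep_systems H G.
Proof. by move=> GH A B HA GB; rewrite setIC mulrC; exact: GH. Qed.

Lemma g_sigma_measurable G : G `<=` @measurable d T -> <<s G >> `<=` @measurable d T.
Proof. exact: (smallest_sub (@sigma_algebra_measurable _ T)). Qed.

Lemma pr_setD A B : measurable A -> measurable B -> B `<=` A ->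
  pr P (A `\` B) = pr P A - pr P B.
Proof.
move=> mA mB BA; apply: EFin_inj.
rewrite EFinB !pr_fin//; last exact: measurableD.
rewrite measureD//; first by rewrite setIidr.
by rewrite (le_lt_trans (probability_le1 P mA))// ltry.
Qed.

(** For fixed B in [H], the sets A whose intersection with B has probability pr A * pr B form a
    lambda-system that contains the pi-system [G]. *)
Lemma indep_dynkin G H : setI_closed G -> G `<=` @measurable d T ->
  H `<=` @measurable d T -> indep_systems G H -> indep_systems <<s G >> H.
Proof.
move=> GI Gm Hm GH A B GA HB; have mB := Hm _ HB.
pose L := [set A | measurable A /\ pr P (A `&` B) = pr P A * pr P B].
suff /(_ _ GA)[] : <<s G >> `<=` L by [].
apply: lambda_system_subset => //; last first.
  by move=> X GX; split; [exact: Gm|exact: GH].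
split => //.
- split => //; rewrite setTI.
  by rewrite [X in X * _](_ : _ = 1) ?mul1r// /pr probability_setT.
- move=> X Y YX [mX eX] [mY eY]; split; first exact: measurableD.
  rewrite setIDAC (@pr_setD X Y)// mulrBl -eX -eY -pr_setD//.
  + by congr pr; apply/seteqP; split => w /=; tauto.
  + exact: measurableI.
  + exact: measurableI.
  + exact: setSI.
- move=> F ndF LF; have mF n : measurable (F n) by have [] := LF n.
  split; first exact: bigcupT_measurable.
  have c1 := pr_bigcup_cvg mF ndF.
  have c2 : pr P (F n `&` B) @[n --> \oo] --> pr P (\bigcup_n (F n `&` B)).
    apply: pr_bigcup_cvg => [n|m n mn]; first exact: measurableI.
    by apply/subsetPset; apply: setSI; exact/subsetPset/ndF.
  rewrite setI_bigcupl; apply: (cvg_unique _ c2) => //.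
  rewrite (_ : (fun n => pr P (F n `&` B)) = (fun n => pr P (F n) * pr P B)).
    by apply: cvgM; [exact: c1|exact: cvg_cst].
  by apply/funext => n; have [] := LF n.
Qed.

Lemma indep_dynkin2 G H : setI_closed G -> setI_closed H ->
  G `<=` @measurable d T -> H `<=` @measurable d T ->
  indep_systems G H -> indep_systems <<s G >> <<s H >>.
Proof.
move=> GI HI Gm Hm GH; apply: indep_systemsC; apply: indep_dynkin => //.
  exact: g_sigma_measurable.
by apply: indep_systemsC; exact: indep_dynkin.
Qed.

(** Intersections of one set per index form pi-systems that generate the two sigma-algebras. On
    these the factorisation is the product rule for [s1 ++ s2], and Dynkin's lemma extends it on
    both sides. *)
Lemma mutually_independent_grouping (I : eqType) (F : I -> set (set T))
    (s1 s2 : seq I) :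
  mutually_independent P F -> (forall i, F i `<=` @measurable d T) ->
  (forall i, setI_closed (F i)) -> (forall i, F i setT) -> uniq (s1 ++ s2) ->
  indep_systems <<s \bigcup_(i in [set` s1]) F i >>
                <<s \bigcup_(i in [set` s2]) F i >>.
Proof.
move=> indF Fm FI FT us.
pose C (s : seq I) := [set A | exists G : I -> set T,
  (forall i, F i (G i)) /\ A = \bigcap_(i in [set` s]) G i].
have Cm s : C s `<=` @measurable d T.
  move=> A [G [FG ->]]; apply: fin_bigcap_measurable => //.
  by move=> i _; exact: Fm.
have CI s : setI_closed (C s).
  move=> A B [G1 [FG1 ->]] [G2 [FG2 ->]]; exists (fun i => G1 i `&` G2 i).
  by split; [move=> i; exact: FI|rewrite bigcapI].
have FC s : <<s \bigcup_(i in [set` s]) F i >> `<=` <<s C s >>.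
  apply: smallest_sub; first exact: smallest_sigma_algebra.
  move=> A [i /= si FA]; apply: sub_sigma_algebra.
  exists (fun j => if j == i then A else setT); split.
    by move=> j; case: eqP => [->|].
  apply/seteqP; split => w.
    by move=> Aw j _ /=; case: eqP.
  by move=> /(_ i si); rewrite eqxx.
suff ind : indep_systems (C s1) (C s2).
  have ind2 := indep_dynkin2 (CI s1) (CI s2) (Cm s1) (Cm s2) ind.
  by move=> A B /FC A1 /FC B2; exact: ind2.
have prC s (G : I -> set T) : uniq s -> (forall i, F i (G i)) ->
    pr P (\bigcap_(i in [set` s]) G i) = \prod_(i <- s) pr P (G i).
  move=> uS FG; rewrite /pr indF//.
  elim: s {uS} => [|i s ih]; first by rewrite !big_nil.
  rewrite !big_cons fineM ?ih//; first by rewrite fin_num_measure//; exact: Fm.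
  rewrite prode_fin_num// => j _.
  by rewrite fin_num_measure//; exact: Fm.
move=> A B [G1 [FG1 ->]] [G2 [FG2 ->]].
move: (us); rewrite cat_uniq => /and3P[us1 dis us2].
pose G i := if i \in s1 then G1 i else G2 i.
have FG i : F i (G i) by rewrite /G; case: ifP.
have -> : \bigcap_(i in [set` s1]) G1 i `&` \bigcap_(i in [set` s2]) G2 i =
          \bigcap_(i in [set` s1 ++ s2]) G i.
  apply/seteqP; split => w.
    move=> [w1 w2] i /=; rewrite mem_cat /G; case: ifPn => /= [s1i _|_ s2i].
      exact: w1.
    exact: w2.
  move=> wG; split => i /= si; have := wG i; rewrite /= mem_cat si ?orbT /G.
    by rewrite si; exact.
  case: ifPn => [s1i|_]; last exact.
  by move/hasPn : dis => /(_ i si); rewrite /= s1i.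
rewrite !prC// big_cat/=; congr (_ * _).
  by rewrite big_seq [RHS]big_seq; apply: eq_bigr => i si; rewrite /G si.
rewrite big_seq [RHS]big_seq; apply: eq_bigr => i si; rewrite /G ifN//.
by move/hasPn : dis; exact.
Qed.

(** The sum is the integer part of x, written with indicators so that its mean becomes a sum of
    probabilities. *)
Lemma layer_count (x : R) n : 0 <= x <= n%:R ->
  `|\sum_(k < n) (k.+1%:R <= x)%R%:R - x| <= 1.
Proof.
move=> /andP[x0 xn].
(* The induction needs the exact count once x has passed n, in addition to the two-sided bound below
   n. *)
suff [_] : (n%:R <= x -> \sum_(k < n) (k.+1%:R <= x)%R%:R = n%:R :> R) /\
    (x <= n%:R -> x - 1 <= \sum_(k < n) (k.+1%:R <= x)%R%:R <= x).
  by move=> /(_ xn) /andP[? ?]; rewrite ler_norml; apply/andP; split; lra.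
elim: n {xn} => [|n [ih1 ih2]].
  by rewrite big_ord0; split => // ?; apply/andP; split; lra.
rewrite big_ord_recr/= -natr1; split=> h.
  by rewrite ih1 ?h//; lra.
have [e|xlt] := leP (n%:R + 1) x => /=.
  by rewrite ih1 ?mulr1n; [apply/andP; split; lra|lra].
rewrite addr0; have [nx|xn] := leP n%:R x; last by apply: ih2; exact: ltW.
by rewrite ih1//; apply/andP; split; lra.
Qed.

Lemma eq_of_norm_le_inv (x y c : R) : (forall n, `|x - y| <= c / n.+1%:R) -> x = y.
Proof.
move=> h; apply/eqP; rewrite -subr_eq0 -normr_le0.
have cv : c / n.+1%:R @[n --> \oo] --> (0 : R).
  rewrite -(mulr0 c); apply: cvgM; first exact: cvg_cst.
  exact: cvg_harmonic.
rewrite -(cvg_lim _ cv)//; apply: limr_ge; first exact: cvgP cv.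
by near=> n; exact: h.
Unshelve. all: by end_near. Qed.

Lemma measurable_superlevel (f : T -> R) c : measurable_fun setT f ->
  measurable [set w | c <= f w].
Proof.
move=> mf; rewrite (_ : [set w | _] = f @^-1` `[c, +oo[); last first.
  by apply/seteqP; split => w /=; rewrite in_itv/= andbT.
by rewrite -[X in measurable X]setTI; exact: mf.
Qed.

(* [f] is within [1/n] of [-1 + 1/n \sum_k \1_(f >= k/n - 1)]. *)
Lemma mean_prod_layers (f h : T -> R) :
  measurable_fun setT f -> measurable_fun setT h ->
  (forall w, `|f w| <= 1) -> (forall w, `|h w| <= 1) ->
  (forall c, mean P (fun w => \1_[set w | c <= f w] w * h w) =
             pr P [set w | c <= f w] * mean P h) ->
  mean P (fun w => f w * h w) = mean P f * mean P h.
Proof.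
move=> mf mh f1 h1 fh; apply: (@eq_of_norm_le_inv _ _ 2) => n.
pose N : R := n.+1%:R; have N0 : 0 < N by [].
pose A k := [set w | k.+1%:R / N - 1 <= f w].
have mA k : measurable (A k) by exact: measurable_superlevel.
pose F w := -1 + N^-1 * \sum_(k < (2 * n.+1)%N) \1_(A k) w.
have iA k : intg P (\1_(A k)) by exact: intg_indic.
have iS : intg P (fun w => \sum_(k < (2 * n.+1)%N) \1_(A k) w).
  by apply: (@intg_sum _ _ _ _ _ _ (fun k : 'I__ => \1_(A k))).
have iF : intg P F by apply: intgD; [exact: intg_cst|exact: intgZ].
have fF w : `|f w - F w| <= N^-1.
  have := @layer_count (N * (f w + 1)) (2 * n.+1).
  have := f1 w; rewrite ler_norml => /andP[f1l f1u].
  move=> /(_ _)/wrap[].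
    rewrite natrM -/N; apply/andP; split; nra.
  have -> : \sum_(k < 2 * n.+1) (k.+1%:R <= N * (f w + 1))%R%:R =
      \sum_(k < 2 * n.+1) \1_(A k) w :> R.
    apply: eq_bigr => k _; rewrite indicE; congr ((_ : bool)%:R).
    apply/idP/idP; rewrite inE /A/= lerBlDr ler_pdivrMr// mulrC//.
  set S := \sum_(_ < _) _ => hS.
  have -> : f w - F w = - (N^-1 * (S - N * (f w + 1))).
    by rewrite /F -/S; field; rewrite gt_eqF.
  by rewrite normrN normrM gtr0_norm ?invr_gt0// ler_piMr// invr_ge0 ltW.
have ih : intg P h by exact: intg_bounded h1.
have iFh : intg P (fun w => F w * h w).
  apply: (@intg_bounded _ _ _ _ _ (1 + N^-1)).
    by apply: measurable_funM => //; exact: intg_measurable iF.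
  move=> w; rewrite normrM -[leRHS]mulr1 ler_pM//.
  have -> : F w = f w - (f w - F w) by ring.
  by rewrite (le_trans (ler_normB _ _))// lerD.
have ifh : intg P (fun w => f w * h w).
  apply: (@intg_bounded _ _ _ _ _ 1); first exact: measurable_funM.
  by move=> w; rewrite normrM mulr_ile1.
have iff : intg P f by exact: intg_bounded f1.
have eqF : mean P (fun w => F w * h w) = mean P F * mean P h.
  have iAh k : intg P (fun w => \1_(A k) w * h w).
    apply: (@intg_bounded _ _ _ _ _ 1).
      by apply: measurable_funM => //; exact: measurable_indic.
    by move=> w; rewrite normrM mulr_ile1// indicE ger0_norm// lern1 leq_b1.
  have -> : mean P F = -1 + N^-1 * \sum_(k < (2 * n.+1)%N) pr P (A k).
    rewrite /F meanD; [|exact: intg_cst|exact: intgZ].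
    rewrite mean_cst meanZ// (@mean_sum _ _ _ _ _ _ (fun k : 'I__ => \1_(A k)))//.
    by congr (_ + _ * _); apply: eq_bigr => k _; rewrite mean_indic.
  rewrite (_ : (fun w => F w * h w) = fun w => -1 * h w +
     N^-1 * \sum_(k < (2 * n.+1)%N) (\1_(A k) w * h w)); last first.
    by apply/funext => w; rewrite /F mulrDl -mulrA mulr_suml.
  have iSh : intg P (fun w => \sum_(k < (2 * n.+1)%N) (\1_(A k) w * h w)).
    by apply: (@intg_sum _ _ _ _ _ _ (fun (k : 'I__) w => \1_(A k) w * h w)).
  rewrite meanD; [|exact: intgZ|exact: intgZ].
  rewrite !meanZ// (@mean_sum _ _ _ _ _ _ (fun (k : 'I__) w => \1_(A k) w * h w))//.
  under eq_bigr do rewrite fh.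
  by rewrite -mulr_suml mulrDl mulrA.
have -> : mean P (fun w => f w * h w) - mean P f * mean P h =
  (mean P (fun w => f w * h w) - mean P (fun w => F w * h w)) -
  (mean P f - mean P F) * mean P h by rewrite eqF; ring.
have e1 : `|mean P (fun w => f w * h w) - mean P (fun w => F w * h w)| <= N^-1.
  rewrite -[leRHS](mean_cst P); apply: norm_meanB_le => //; first exact: intg_cst.
  by move=> w; rewrite -mulrBl normrM -[leRHS]mulr1 ler_pM.
have e2 : `|mean P f - mean P F| <= N^-1.
  by rewrite -[leRHS](mean_cst P); apply: norm_meanB_le => //; exact: intg_cst.
have e3 : `|mean P h| <= 1 by exact: norm_mean_le_cst.
apply: (le_trans (ler_normB _ _)); rewrite normrM (_ : 2 / n.+1%:R = N^-1 + N^-1 * 1).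
  by apply: lerD => //; rewrite ler_pM.
by rewrite mulr1 -/N; field; rewrite gt_eqF.
Qed.

(** Two passes of [mean_prod_layers], one per factor, reduce both functions to indicators of
    superlevel sets, which lie in the independent sigma-algebras. *)
Lemma mean_prod_indep (C1 C2 : set (set T)) (f g : T -> R) :
  C1 `<=` @measurable d T -> C2 `<=` @measurable d T ->
  indep_systems <<s C1 >> <<s C2 >> ->
  measurable_fun setT (f : g_sigma_algebraType C1 -> R) ->
  measurable_fun setT (g : g_sigma_algebraType C2 -> R) ->
  (forall w, `|f w| <= 1) -> (forall w, `|g w| <= 1) ->
  mean P (fun w => f w * g w) = mean P f * mean P g.
Proof.
move=> C1m C2m ind mf mg f1 g1.
have lift (C : set (set T)) (h : T -> R) : C `<=` @measurable d T ->
    measurable_fun setT (h : g_sigma_algebraType C -> R) ->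
    measurable_fun setT h.
  by move=> Cm mh mD B mB; apply: (g_sigma_measurable Cm); exact: mh.
have lev (C : set (set T)) (h : T -> R) c :
    measurable_fun setT (h : g_sigma_algebraType C -> R) ->
    <<s C >> [set w | c <= h w].
  move=> mh; rewrite (_ : [set w | _] = setT `&` h @^-1` `[c, +oo[).
    by apply: mh.
  by rewrite setTI; apply/seteqP; split => w /=; rewrite in_itv/= andbT.
have mf' := lift _ _ C1m mf; have mg' := lift _ _ C2m mg.
apply: mean_prod_layers => // c.
have mA : measurable [set w | c <= f w] by exact: measurable_superlevel.
under eq_fun do rewrite mulrC.
rewrite mulrC -mean_indic//; apply: mean_prod_layers => //.
  by move=> w; rewrite indicE ger0_norm// lern1 leq_b1.
move=> c'; rewrite mean_indic// mulrC -ind; [|exact: lev|exact: lev].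
rewrite setIC -mean_indic; last by apply: measurableI => //; exact: measurable_superlevel.
by rewrite indicI.
Qed.

End independence.

(** * Characteristic functions of independent sums *)


Section characteristic_function_of_sums.
Context d (T : measurableType d) (R : realType) (P : probability T R).

Lemma measurable_g_sigma_sub (G1 G2 : set (set T)) (f : T -> R) :
  G1 `<=` <<s G2 >> ->
  measurable_fun setT (f : g_sigma_algebraType G1 -> R) ->
  measurable_fun setT (f : g_sigma_algebraType G2 -> R).
Proof.
move=> G12 mf mD B mB.
have : <<s G1 >> `<=` <<s G2 >> by apply: smallest_sub => //; exact: smallest_sigma_algebra.
by apply; exact: mf.
Qed.

Lemma measurable_g_sigma (G : set (set T)) (f : T -> R) :
  G `<=` @measurable d T ->
  measurable_fun setT (f : g_sigma_algebraType G -> R) ->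
  measurable_fun setT f.
Proof.
by move=> Gm mf mD B mB; apply: (g_sigma_measurable Gm); exact: mf.
Qed.

Lemma measurable_cosR d' (U : measurableType d') (f : U -> R) :
  measurable_fun setT f -> measurable_fun setT (fun w => cos (f w)).
Proof.
move=> mf; apply: (measurableT_comp _ mf).
by apply: continuous_measurable_fun; exact: continuous_cos.
Qed.

Lemma measurable_sinR d' (U : measurableType d') (f : U -> R) :
  measurable_fun setT f -> measurable_fun setT (fun w => sin (f w)).
Proof.
move=> mf; apply: (measurableT_comp _ mf).
by apply: continuous_measurable_fun; exact: continuous_sin.
Qed.

Lemma intg_cos (f : T -> R) : measurable_fun setT f -> intg P (fun w => cos (f w)).
Proof.
by move=> mf; apply: (@intg_bounded _ _ _ _ _ 1);
  [exact: measurable_cosR|move=> w; exact: cos_max].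
Qed.

Lemma intg_sin (f : T -> R) : measurable_fun setT f -> intg P (fun w => sin (f w)).
Proof.
by move=> mf; apply: (@intg_bounded _ _ _ _ _ 1);
  [exact: measurable_sinR|move=> w; exact: sin_max].
Qed.

Lemma mean_cos_le1 (f : T -> R) : measurable_fun setT f ->
  `|mean P (fun w => cos (f w))| <= 1.
Proof.
by move=> mf; apply: norm_mean_le_cst => [|w]; [exact: measurable_cosR|exact: cos_max].
Qed.

Lemma mean_sin_le1 (f : T -> R) : measurable_fun setT f ->
  `|mean P (fun w => sin (f w))| <= 1.
Proof.
by move=> mf; apply: norm_mean_le_cst => [|w]; [exact: measurable_sinR|exact: sin_max].
Qed.

(** In complex terms (c + i s)(C + i S) is compared with b B. The factor 2 falls only on the error
    of the new factor, so it does not compound when the step is iterated. *)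
Lemma perturbed_product_step (b c s B C S : R) : 0 <= b <= 1 ->
  `|C| <= 1 -> `|S| <= 1 ->
  `|c * C - s * S - b * B| + `|s * C + c * S| <=
  2 * (`|c - b| + `|s|) + (`|C - B| + `|S|).
Proof.
move=> /andP[b0 b1] C1 S1.
have -> : c * C - s * S - b * B = (c - b) * C - s * S + b * (C - B) by ring.
have -> : s * C + c * S = s * C + (c - b) * S + b * S by ring.
have t1 := ler_normD ((c - b) * C - s * S) (b * (C - B)).
have t2 := ler_normB ((c - b) * C) (s * S).
have t3 := ler_normD (s * C + (c - b) * S) (b * S).
have t4 := ler_normD (s * C) ((c - b) * S).
rewrite !normrM in t1 t2 t3 t4; rewrite (ger0_norm b0) in t1 t3.
have p1 : `|c - b| * `|C| <= `|c - b| by rewrite ler_piMr.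
have p2 : `|c - b| * `|S| <= `|c - b| by rewrite ler_piMr.
have p3 : `|s| * `|C| <= `|s| by rewrite ler_piMr.
have p4 : `|s| * `|S| <= `|s| by rewrite ler_piMr.
have p5 : b * `|C - B| <= `|C - B| by rewrite ler_piMl.
have p6 : b * `|S| <= `|S| by rewrite ler_piMl.
by lra.
Qed.

(** Independence multiplies the characteristic functions, and replacing each factor by [b i] adds
    its error. The cosine and sine means carry the real and imaginary parts; the comparison values
    are real because they come from symmetric laws. *)
Lemma cf_sum (I : eqType) (F : I -> set (set T)) (X : I -> T -> R) (b : I -> R)
    (s : seq I) :
  mutually_independent P F -> (forall i, F i `<=` @measurable d T) ->
  (forall i, setI_closed (F i)) -> (forall i, F i setT) -> uniq s ->
  (forall i, measurable_fun setT (X i : g_sigma_algebraType (F i) -> R)) ->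
  (forall i, 0 <= b i <= 1) ->
  `|mean P (fun w => cos (\sum_(i <- s) X i w)) - \prod_(i <- s) b i| +
  `|mean P (fun w => sin (\sum_(i <- s) X i w))| <=
  2 * \sum_(i <- s) (`|mean P (fun w => cos (X i w)) - b i| +
                     `|mean P (fun w => sin (X i w))|).
Proof.
move=> indF Fm FI FT us mX b01; elim: s us => [|i s ih] us.
  rewrite !big_nil mulr0; under eq_fun do rewrite big_nil cos0.
  under [X in _ + `|mean _ X|]eq_fun do rewrite big_nil sin0.
  by rewrite !mean_cst subrr normr0 addr0.
have us' : uniq s by move: us => /= /andP[].
have grp := @mutually_independent_grouping _ _ _ _ _ _ [:: i] s indF Fm FI FT us.
pose C1 := \bigcup_(j in [set` [:: i]]) F j; pose C2 := \bigcup_(j in [set` s]) F j.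
have C1m : C1 `<=` @measurable d T by move=> A [j _ Fj]; exact: Fm Fj.
have C2m : C2 `<=` @measurable d T by move=> A [j _ Fj]; exact: Fm Fj.
pose Y w := \sum_(j <- s) X j w.
have mXi : measurable_fun setT (X i : g_sigma_algebraType C1 -> R).
  apply: (@measurable_g_sigma_sub (F i)) => // A FA; apply: sub_sigma_algebra.
  by exists i => //=; rewrite inE.
have mY : measurable_fun setT (Y : g_sigma_algebraType C2 -> R).
  (* The sum is taken over positions in [s], so that each index is visibly a member of [s], as
     measurability for [C2] requires. *)
  rewrite /Y; under eq_fun do rewrite big_seq_cond.
  under eq_fun do rewrite -big_seq_cond big_tnth.
  apply: measurable_sum => k.
  apply: (@measurable_g_sigma_sub (F (tnth (in_tuple s) k))) => // A FA.
  apply: sub_sigma_algebra; exists (tnth (in_tuple s) k) => //=.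
  exact: mem_tnth.
have mXi' := measurable_g_sigma C1m mXi; have mY' := measurable_g_sigma C2m mY.
have pm (f g : R -> R) : measurable_fun setT f -> measurable_fun setT g ->
    (forall x, `|f x| <= 1) -> (forall x, `|g x| <= 1) ->
    mean P (fun w => f (X i w) * g (Y w)) =
    mean P (fun w => f (X i w)) * mean P (fun w => g (Y w)).
  move=> mf mg f1 g1; apply: (mean_prod_indep C1m C2m grp) => //.
    exact: (measurableT_comp mf mXi).
  exact: (measurableT_comp mg mY).
have mcos : measurable_fun setT (@cos R).
  by apply: continuous_measurable_fun; exact: continuous_cos.
have msin : measurable_fun setT (@sin R).
  by apply: continuous_measurable_fun; exact: continuous_sin.
have ib (f g : R -> R) : measurable_fun setT f -> measurable_fun setT g ->
    (forall x, `|f x| <= 1) -> (forall x, `|g x| <= 1) ->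
    intg P (fun w => f (X i w) * g (Y w)).
  move=> mf mg f1 g1; apply: (@intg_bounded _ _ _ _ _ 1).
    by apply: measurable_funM; exact: measurableT_comp.
  by move=> w; rewrite normrM mulr_ile1.
rewrite !big_cons mulrDr.
have -> : (fun w => cos (\sum_(j <- (i :: s)) X j w)) =
    (fun w => cos (X i w) * cos (Y w) - sin (X i w) * sin (Y w)).
  by apply/funext => w; rewrite big_cons cosD.
have -> : (fun w => sin (\sum_(j <- (i :: s)) X j w)) =
    (fun w => sin (X i w) * cos (Y w) + cos (X i w) * sin (Y w)).
  by apply/funext => w; rewrite big_cons sinD.
have c1 := @cos_max R; have s1 := @sin_max R.
rewrite meanB; [|exact: ib|exact: ib]; rewrite meanD; [|exact: ib|exact: ib].
rewrite !pm//; apply: (le_trans (perturbed_product_step _ _ _ _ _ _)) => //.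
- exact: mean_cos_le1.
- exact: mean_sin_le1.
- by rewrite lerD2l; exact: ih.
Qed.

End characteristic_function_of_sums.

(** * Second moments *)


Section second_moments.
Context d (T : measurableType d) (R : realType) (P : probability T R).

Lemma intg_of_sqr (f : T -> R) : measurable_fun setT f ->
  intg P (fun w => f w ^+ 2) -> intg P f.
Proof.
move=> mf if2; apply: (@intg_le _ _ _ _ _ (fun w => 1 + f w ^+ 2)) => //.
  move=> w; rewrite -[f w ^+ 2]real_normK ?num_real//.
  by have := sqr_ge0 (`|f w| - 1); nra.
by apply: intgD => //; exact: intg_cst.
Qed.

Lemma intgM_of_sqr (f g : T -> R) : measurable_fun setT f -> measurable_fun setT g ->
  intg P (fun w => f w ^+ 2) -> intg P (fun w => g w ^+ 2) ->
  intg P (fun w => f w * g w).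
Proof.
move=> mf mg if2 ig2.
apply: (@intg_le _ _ _ _ _ (fun w => f w ^+ 2 + g w ^+ 2)).
- exact: measurable_funM.
- move=> w; rewrite normrM -[f w ^+ 2]real_normK ?num_real//.
  rewrite -[g w ^+ 2]real_normK ?num_real//.
  by have := sqr_ge0 (`|f w| - `|g w|); have := sqr_ge0 (`|f w| + `|g w|); nra.
- exact: intgD.
Qed.

Definition clip (x : R) : R := Num.max (-1) (Num.min 1 x).

Lemma measurable_clip : measurable_fun setT clip.
Proof.
apply: measurable_maxr => //; apply: measurable_minr => //.
Qed.

Lemma norm_clip_le1 x : `|clip x| <= 1.
Proof.
rewrite ler_norml /clip le_max lexx/= ge_max ge_min lexx/= andbT; lra.
Qed.

Lemma clip_id x : `|x| <= 1 -> clip x = x.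
Proof.
rewrite ler_norml => /andP[x1 x2]; rewrite /clip.
by rewrite (min_idPr x2) (max_idPr x1).
Qed.

Lemma norm_clip_le x : `|clip x| <= `|x|.
Proof.
have [/clip_id->//|/ltW x1] := leP `|x| 1.
exact: le_trans (norm_clip_le1 x) x1.
Qed.

Lemma norm_scaled_clip_le n (x : R) : `|n.+1%:R * clip (x / n.+1%:R)| <= `|x|.
Proof.
rewrite normrM ger0_norm// -ler_pdivlMl// -[_ * `|x|]ger0_norm; last by rewrite mulr_ge0// invr_ge0.
apply: (le_trans (norm_clip_le _)).
by rewrite !normrM !normfV normr_id mulrC.
Qed.

Lemma cvg_clip (x : R) : n.+1%:R * clip (x / n.+1%:R) @[n --> \oo] --> x.
Proof.
apply: cvg_near_cst; exists (Num.bound `|x|) => // n /= bn.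
rewrite clip_id; first by field; rewrite addrC natr1 pnatr_eq0.
rewrite normrM normfV (ger0_norm (ler0n _ _)) ler_pdivrMr ?ltr0n// mul1r.
rewrite (le_trans (ltW (archi_boundP (normr_ge0 x))))// ler_nat.
exact: leqW.
Qed.

Lemma cvg_mean (f_ : nat -> T -> R) (f g : T -> R) :
  (forall n, measurable_fun setT (f_ n)) -> measurable_fun setT f ->
  (forall w, f_ ^~ w @ \oo --> f w) -> intg P g ->
  (forall w n, `|f_ n w| <= g w) -> mean P (f_ n) @[n --> \oo] --> mean P f.
Proof. by move=> *; have [] := @mean_dominated _ _ _ P f_ f g. Qed.

(** Truncation and dominated convergence, with dominating functions |f|, |g| and |f g|, extend the
    bounded case to square-integrable factors. *)
Lemma mean_indepM (C1 C2 : set (set T)) (f g : T -> R) :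
  C1 `<=` @measurable d T -> C2 `<=` @measurable d T ->
  indep_systems P <<s C1 >> <<s C2 >> ->
  measurable_fun setT (f : g_sigma_algebraType C1 -> R) ->
  measurable_fun setT (g : g_sigma_algebraType C2 -> R) ->
  intg P (fun w => f w ^+ 2) -> intg P (fun w => g w ^+ 2) ->
  mean P (fun w => f w * g w) = mean P f * mean P g.
Proof.
move=> C1m C2m ind mf mg if2 ig2.
have mf' := measurable_g_sigma C1m mf; have mg' := measurable_g_sigma C2m mg.
(* Truncation at level n + 1, written as a multiple of a function bounded by 1 because
   [mean_prod_indep] is normalised to that bound. *)
pose tr (h : T -> R) n w := n.+1%:R * clip (h w / n.+1%:R).
have mtr d' (U : measurableType d') (h : U -> R) n : measurable_fun setT h ->
    measurable_fun setT (fun w => clip (h w / n.+1%:R)).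
  move=> mh; apply: (measurableT_comp measurable_clip).
  by apply: measurable_funM.
have mtr' (h : T -> R) n : measurable_fun setT h -> measurable_fun setT (tr h n).
  by move=> mh; apply: measurable_funM => //; exact: mtr.
have cf : mean P (tr f n) @[n --> \oo] --> mean P f.
  apply: (@cvg_mean (tr f) f (fun w => `|f w|)) => //.
  - by move=> n; exact: mtr'.
  - by move=> w; exact: cvg_clip.
  - by apply: intg_norm; exact: intg_of_sqr.
  - by move=> w n; exact: norm_scaled_clip_le.
have cg : mean P (tr g n) @[n --> \oo] --> mean P g.
  apply: (@cvg_mean (tr g) g (fun w => `|g w|)) => //.
  - by move=> n; exact: mtr'.
  - by move=> w; exact: cvg_clip.
  - by apply: intg_norm; exact: intg_of_sqr.
  - by move=> w n; exact: norm_scaled_clip_le.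
have cfg : mean P (fun w => tr f n w * tr g n w) @[n --> \oo] -->
    mean P (fun w => f w * g w).
  apply: (@cvg_mean (fun n w => tr f n w * tr g n w) _
    (fun w => `|f w * g w|)).
  - by move=> n; apply: measurable_funM; exact: mtr'.
  - exact: measurable_funM.
  - by move=> w; apply: cvgM; exact: cvg_clip.
  - by apply: intg_norm; exact: intgM_of_sqr.
  - by move=> w n; rewrite !normrM ler_pM// -normrM; exact: norm_scaled_clip_le.
apply: (cvg_unique _ cfg) => //.
rewrite (_ : (fun n => _) = (fun n => mean P (tr f n) * mean P (tr g n))).
  exact: cvgM.
apply/funext => n; rewrite /tr.
have ic (h : T -> R) : measurable_fun setT h ->
    intg P (fun w => clip (h w / n.+1%:R)).
  by move=> mh; apply: (@intg_bounded _ _ _ _ _ 1) => [|w];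
    [exact: mtr|exact: norm_clip_le1].
rewrite !meanZ; [|exact: ic|exact: ic].
rewrite (_ : (fun w => _) = fun w => (n.+1%:R * n.+1%:R) *
   (clip (f w / n.+1%:R) * clip (g w / n.+1%:R))); last first.
  by apply/funext => w; ring.
rewrite meanZ; last first.
  apply: (@intg_bounded _ _ _ _ _ 1) => [|w].
    by apply: measurable_funM; exact: mtr.
  by rewrite normrM mulr_ile1// norm_clip_le1.
rewrite (mean_prod_indep C1m C2m ind); first by ring.
- exact: mtr.
- exact: mtr.
- by move=> w; exact: norm_clip_le1.
- by move=> w; exact: norm_clip_le1.
Qed.

Lemma mean_sqr_sum (I : eqType) (F : I -> set (set T)) (X : I -> T -> R)
    (s : seq I) :
  mutually_independent P F -> (forall i, F i `<=` @measurable d T) ->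
  (forall i, setI_closed (F i)) -> (forall i, F i setT) -> uniq s ->
  (forall i, measurable_fun setT (X i : g_sigma_algebraType (F i) -> R)) ->
  (forall i, intg P (fun w => X i w ^+ 2)) -> (forall i, mean P (X i) = 0) ->
  intg P (fun w => (\sum_(i <- s) X i w) ^+ 2) /\
  mean P (fun w => (\sum_(i <- s) X i w) ^+ 2) =
    \sum_(i <- s) mean P (fun w => X i w ^+ 2).
Proof.
move=> indF Fm FI FT us mX iX2 X0; elim: s us => [|i s ih] us.
  under eq_fun do rewrite big_nil expr0n/=; rewrite big_nil; split.
    exact: intg_cst.
  exact: mean_cst.
have us' : uniq s by move: us => /= /andP[].
have {ih us'}[iY2 eY2] := ih us'.
have grp := @mutually_independent_grouping _ _ _ _ _ _ [:: i] s indF Fm FI FT us.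
pose C1 := \bigcup_(j in [set` [:: i]]) F j; pose C2 := \bigcup_(j in [set` s]) F j.
have C1m : C1 `<=` @measurable d T by move=> A [j _ Fj]; exact: Fm Fj.
have C2m : C2 `<=` @measurable d T by move=> A [j _ Fj]; exact: Fm Fj.
pose Y w := \sum_(j <- s) X j w.
have mXi : measurable_fun setT (X i : g_sigma_algebraType C1 -> R).
  apply: (@measurable_g_sigma_sub _ _ _ (F i)) => // A FA; apply: sub_sigma_algebra.
  by exists i => //=; rewrite inE.
have mY : measurable_fun setT (Y : g_sigma_algebraType C2 -> R).
  rewrite /Y; under eq_fun do rewrite big_tnth.
  apply: measurable_sum => k.
  apply: (@measurable_g_sigma_sub _ _ _ (F (tnth (in_tuple s) k))) => // A FA.
  apply: sub_sigma_algebra; exists (tnth (in_tuple s) k) => //=.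
  exact: mem_tnth.
have mXi' := measurable_g_sigma C1m mXi; have mY' := measurable_g_sigma C2m mY.
have iXY : intg P (fun w => X i w * Y w) by exact: intgM_of_sqr.
have XY0 : mean P (fun w => X i w * Y w) = 0.
  by rewrite (mean_indepM C1m C2m grp)// X0 mul0r.
rewrite big_cons (_ : (fun w => (\sum_(j <- i :: s) X j w) ^+ 2) =
  fun w => X i w ^+ 2 + (2 * (X i w * Y w) + Y w ^+ 2)); last first.
  by apply/funext => w; rewrite big_cons /Y; ring.
have i2XY : intg P (fun w => 2 * (X i w * Y w)) by exact: intgZ.
split; first by apply: intgD => //; exact: intgD.
rewrite meanD//; last exact: intgD.
by rewrite meanD// meanZ// XY0 mulr0 add0r eY2.
Qed.

End second_moments.

(** * Approximation by trigonometric polynomials *)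


Section bernstein.
Context {R : realType}.
Implicit Types (t : R) (f : nat -> R).

(** The binomial weight C(n, k) t^k (1 - t)^(n - k), given by Pascal's recursion; this form lets the
    moments and [trigpoly_bern] go by induction on n. *)
Fixpoint bern t n k : R :=
  if n is n'.+1 then
    (1 - t) * bern t n' k + (if k is k'.+1 then t * bern t n' k' else 0)
  else (k == 0%N)%:R.

Lemma bern_ge0 t n k : 0 <= t <= 1 -> 0 <= bern t n k.
Proof.
move=> /andP[t0 t1]; elim: n k => [|n ih] k /=; first by case: (k == 0%N).
rewrite addr_ge0// ?mulr_ge0// ?subr_ge0//.
by case: k => // k; rewrite mulr_ge0.
Qed.

Lemma bern_gt t n k : (n < k)%N -> bern t n k = 0.
Proof.
elim: n k => [|n ih] [|k] //=; rewrite ltnS => nk.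
by rewrite !ih ?mulr0 ?addr0// ltnW.
Qed.

(** Conditioning a binomial variable on its last trial; total mass, mean and variance all follow
    from this by induction. *)
Lemma bern_sumS t f n : \sum_(k < n.+2) f k * bern t n.+1 k =
  (1 - t) * (\sum_(k < n.+1) f k * bern t n k) +
  t * (\sum_(k < n.+1) f k.+1 * bern t n k).
Proof.
under eq_bigr do rewrite /= mulrDr.
rewrite big_split/= big_ord_recr/= bern_gt// !mulr0 addr0.
congr (_ + _); first by rewrite mulr_sumr; apply: eq_bigr => k _; ring.
rewrite big_ord_recl/= mulr0 add0r mulr_sumr.
by apply: eq_bigr => k _; rewrite /bump/=; ring.
Qed.

Lemma bern_sum1 t n : \sum_(k < n.+1) bern t n k = 1.
Proof.
have E n' : \sum_(k < n'.+1) bern t n' k = \sum_(k < n'.+1) 1 * bern t n' k.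
  by apply: eq_bigr => k _; rewrite mul1r.
elim: n => [|n ih]; first by rewrite big_ord_recr big_ord0/= add0r.
by rewrite E (bern_sumS t (fun=> 1)) -E ih; ring.
Qed.

Lemma bern_mean t n : \sum_(k < n.+1) (k%:R - n%:R * t) * bern t n k = 0.
Proof.
elim: n => [|n ih]; first by rewrite big_ord_recr big_ord0/= mul0r subrr mul0r add0r.
rewrite (bern_sumS t (fun k => k%:R - n.+1%:R * t)).
have -> : \sum_(k < n.+1) (k%:R - n.+1%:R * t) * bern t n k = - t.
  transitivity (\sum_(k < n.+1) (k%:R - n%:R * t) * bern t n k
                - t * \sum_(k < n.+1) bern t n k).
    by rewrite mulr_sumr -sumrB; apply: eq_bigr => k _; rewrite -natr1; ring.
  by rewrite ih bern_sum1; ring.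
have -> : \sum_(k < n.+1) (k.+1%:R - n.+1%:R * t) * bern t n k = 1 - t.
  transitivity (\sum_(k < n.+1) (k%:R - n%:R * t) * bern t n k
                + (1 - t) * \sum_(k < n.+1) bern t n k).
    by rewrite mulr_sumr -big_split; apply: eq_bigr => k _ /=; rewrite -!natr1; ring.
  by rewrite ih bern_sum1; ring.
by ring.
Qed.

Lemma bern_variance t n :
  \sum_(k < n.+1) (k%:R - n%:R * t) ^+ 2 * bern t n k = n%:R * (t * (1 - t)).
Proof.
elim: n => [|n ih].
  by rewrite big_ord_recr big_ord0/= mul0r subrr expr0n/= mul0r add0r mul0r.
rewrite (bern_sumS t (fun k => (k%:R - n.+1%:R * t) ^+ 2)).
have aux c : \sum_(k < n.+1) (k%:R - n%:R * t + c) ^+ 2 * bern t n k =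
    n%:R * (t * (1 - t)) + c ^+ 2.
  transitivity (\sum_(k < n.+1) (k%:R - n%:R * t) ^+ 2 * bern t n k
    + 2 * c * (\sum_(k < n.+1) (k%:R - n%:R * t) * bern t n k)
    + c ^+ 2 * \sum_(k < n.+1) bern t n k).
    by rewrite !mulr_sumr -!big_split; apply: eq_bigr => k _ /=; ring.
  by rewrite ih bern_mean bern_sum1; ring.
have -> : \sum_(k < n.+1) (k%:R - n.+1%:R * t) ^+ 2 * bern t n k =
    n%:R * (t * (1 - t)) + (- t) ^+ 2.
  by rewrite -aux; apply: eq_bigr => k _; rewrite -natr1; congr (_ ^+ 2 * _); ring.
have -> : \sum_(k < n.+1) (k.+1%:R - n.+1%:R * t) ^+ 2 * bern t n k =
    n%:R * (t * (1 - t)) + (1 - t) ^+ 2.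
  by rewrite -aux; apply: eq_bigr => k _; rewrite -!natr1; congr (_ ^+ 2 * _); ring.
by rewrite -natr1; ring.
Qed.

Lemma bern_abs t n (e : R) : 0 <= t <= 1 -> 0 < e ->
  \sum_(k < n.+2) `|k%:R / n.+1%:R - t| * bern t n.+1 k <= e + (e * n.+1%:R)^-1.
Proof.
move=> t01 e0; have N0 : 0 < n.+1%:R :> R by [].
have ptw (k : 'I_n.+2) : `|k%:R / n.+1%:R - t| * bern t n.+1 k <=
    e * bern t n.+1 k +
    (e * n.+1%:R ^+ 2)^-1 * ((k%:R - n.+1%:R * t) ^+ 2 * bern t n.+1 k).
  rewrite mulrA -mulrDl ler_wpM2r ?bern_ge0//.
  have -> : (e * n.+1%:R ^+ 2)^-1 * (k%:R - n.+1%:R * t) ^+ 2 =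
      e^-1 * `|k%:R / n.+1%:R - t| ^+ 2.
    by rewrite real_normK ?num_real//; field; rewrite !gt_eqF.
  (* Expanding (z - e)^2 >= 0 gives 2 z <= e + z^2 / e, which trades the first absolute moment for
     the variance. *)
  set z := `|_|; have z0 : 0 <= z by exact: normr_ge0.
  have h : 0 <= e^-1 * (z - e) ^+ 2 by rewrite mulr_ge0 ?sqr_ge0// invr_ge0 ltW.
  have : e^-1 * (z - e) ^+ 2 = e^-1 * z ^+ 2 - 2 * z + e by field; rewrite gt_eqF.
  by lra.
apply: (le_trans (ler_sum _ (fun k _ => ptw k))).
rewrite big_split/= -!mulr_sumr bern_sum1 bern_variance mulr1 lerD2l.
have /andP[t0 t1] := t01.
have -> : (e * n.+1%:R ^+ 2)^-1 * (n.+1%:R * (t * (1 - t))) =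
    (e * n.+1%:R)^-1 * (t * (1 - t)) by field; rewrite !gt_eqF.
rewrite ler_piMr// ?invr_ge0 ?mulr_ge0// ?ltW//.
by nra.
Qed.

End bernstein.

(** * Trigonometric polynomials in finitely many variables *)

Section trigonometric_polynomials.
Context {R : realType} {I : finType}.
Implicit Types (g : (I -> R) -> R) (u : I -> R).

Definition trig_term (t : R * R * (I -> R)) (x : I -> R) : R :=
  t.1.1 * cos (\sum_i t.2 i * x i) + t.1.2 * sin (\sum_i t.2 i * x i).

Definition trigpoly g := exists s : seq (R * R * (I -> R)),
  forall x, g x = \sum_(t <- s) trig_term t x.

Lemma trigpolyD g1 g2 : trigpoly g1 -> trigpoly g2 ->
  trigpoly (fun x => g1 x + g2 x).
Proof.
move=> [s1 e1] [s2 e2]; exists (s1 ++ s2) => x.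
by rewrite big_cat e1 e2.
Qed.

Lemma trigpoly_cst c : trigpoly (fun=> c).
Proof.
exists [:: (c, 0, fun=> 0)] => x; rewrite big_seq1 /trig_term/=.
rewrite (_ : \sum_i _ = 0); first by rewrite cos0 mulr1 mul0r addr0.
by apply: big1 => i _; rewrite mul0r.
Qed.

Lemma trigpoly_sin c i : trigpoly (fun x => sin (c * x i)).
Proof.
exists [:: (0, 1, fun j => if j == i then c else 0)] => x.
rewrite big_seq1 /trig_term/= mul0r add0r mul1r (bigD1 i)//= eqxx.
by rewrite [X in _ + X]big1 ?addr0// => j /negbTE->; rewrite mul0r.
Qed.

Lemma trigpoly_sum (J : Type) (r : seq J) (F : J -> (I -> R) -> R) :
  (forall j, trigpoly (F j)) -> trigpoly (fun x => \sum_(j <- r) F j x).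
Proof.
move=> tF; elim: r => [|j r ih].
  by under eq_fun do rewrite big_nil; exact: trigpoly_cst.
by under eq_fun do rewrite big_cons; exact: trigpolyD.
Qed.

Lemma trigpoly_ext g1 g2 : g1 =1 g2 -> trigpoly g1 -> trigpoly g2.
Proof. by move=> /funext->. Qed.

Lemma trigpoly_mul_term t1 t2 : trigpoly (fun x => trig_term t1 x * trig_term t2 x).
Proof.
case: t1 => -[a b] u; case: t2 => -[c e] v.
exists [:: ((a * c - b * e) / 2, (b * c + a * e) / 2, fun i => u i + v i);
           ((a * c + b * e) / 2, (b * c - a * e) / 2, fun i => u i - v i)] => x.
rewrite big_cons big_seq1 /trig_term/=.
have -> : \sum_i (u i + v i) * x i = \sum_i u i * x i + \sum_i v i * x i.
  by rewrite -big_split; apply: eq_bigr => i _; rewrite mulrDl.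
have -> : \sum_i (u i - v i) * x i = \sum_i u i * x i - \sum_i v i * x i.
  by rewrite -sumrB; apply: eq_bigr => i _; rewrite mulrBl.
by rewrite cosD sinD cosB sinB; field.
Qed.

Lemma trigpolyM g1 g2 : trigpoly g1 -> trigpoly g2 ->
  trigpoly (fun x => g1 x * g2 x).
Proof.
move=> [s1 e1] [s2 e2].
apply: (@trigpoly_ext (fun x => \sum_(t1 <- s1) \sum_(t2 <- s2)
    trig_term t1 x * trig_term t2 x)).
  by move=> x; rewrite e1 e2 mulr_suml; apply: eq_bigr => t1 _; rewrite mulr_sumr.
apply: trigpoly_sum => t1; apply: trigpoly_sum => t2; exact: trigpoly_mul_term.
Qed.

Lemma trigpoly_prod (J : Type) (r : seq J) (F : J -> (I -> R) -> R) :
  (forall j, trigpoly (F j)) -> trigpoly (fun x => \prod_(j <- r) F j x).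
Proof.
move=> tF; elim: r => [|j r ih].
  by under eq_fun do rewrite big_nil; exact: trigpoly_cst.
by under eq_fun do rewrite big_cons; exact: trigpolyM.
Qed.

Lemma trigpoly_bern (h : (I -> R) -> R) n k : trigpoly h ->
  trigpoly (fun x => bern (h x) n k).
Proof.
move=> th; elim: n k => [|n ih] k /=; first exact: trigpoly_cst.
apply: trigpolyD.
  apply: trigpolyM => //; apply: trigpolyD; first exact: trigpoly_cst.
  apply: (@trigpoly_ext (fun x => -1 * h x)); first by move=> x; rewrite mulN1r.
  by apply: trigpolyM => //; exact: trigpoly_cst.
by case: k => [|k]; [exact: trigpoly_cst|exact: trigpolyM].
Qed.

(* A Lipschitz [f] is approximated by [f (lam sin (x / lam))], and the latter by its Bernstein polynomials in the [sin (x_i / lam)]. *)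
Lemma trigpoly_approx (f : (I -> R) -> R) (L e : R) : 0 <= L -> 0 < e ->
  (forall x y, `|f x - f y| <= L * \sum_i `|x i - y i|) ->
  exists2 G, trigpoly G & forall x, `|G x - f x| <= e * (1 + \sum_i x i ^+ 2).
Proof.
move=> L0 e0 Lf.
(* With L / lam <= e, replacing x by lam sin(x / lam) costs at most e x_i^2 per coordinate. [D] and
   [h] are set so that the Bernstein error, (D - 1) * 2 h, is at most e. *)
pose lam := L / e + 1; have lam0 : 0 < lam by rewrite ltr_wpDl// divr_ge0// ltW.
pose D := 2 * L * lam * #|I|%:R + 1.
have D0 : 0 < D by rewrite ltr_wpDl// !mulr_ge0// ltW.
pose h := e / (2 * D); have h0 : 0 < h by rewrite divr_gt0// mulr_gt0.
have [n hn] : exists n, (h * n.+1%:R)^-1 <= h.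
  exists (Num.bound (h ^- 2)); set n := Num.bound _.
  have hN : 0 < h * n.+1%:R by rewrite mulr_gt0 ?ltr0n.
  rewrite -div1r (ler_pdivrMr _ _ hN) mulrA -expr2 -ler_pdivrMl ?exprn_gt0//.
  rewrite mulr1; apply: (@le_trans _ _ n%:R).
    by rewrite ltW//; apply: archi_boundP; rewrite invr_ge0 exprn_ge0// ltW.
  by rewrite ler_nat.
pose t (x : I -> R) i : R := (1 + sin (lam^-1 * x i)) / 2.
have t01 x i : 0 <= t x i <= 1.
  rewrite /t; have := sin_le1 (lam^-1 * x i); have := sin_geN1 (lam^-1 * x i).
  by move=> ? ?; apply/andP; split; lra.
pose w x (k : {ffun I -> 'I_n.+2}) := \prod_i bern (t x i) n.+1 (k i).
pose node (k : {ffun I -> 'I_n.+2}) (i : I) : R := lam * (2 * ((k i)%:R / n.+1%:R) - 1).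
pose G x := \sum_(k : {ffun I -> 'I_n.+2}) f (node k) * w x k.
have w0 x k : 0 <= w x k by apply: prodr_ge0 => i _; exact: bern_ge0.
have w1 x : \sum_k w x k = 1.
  rewrite /w -(bigA_distr_bigA (fun i (k : 'I_n.+2) => bern (t x i) n.+1 k)).
  by rewrite big1// => i _; rewrite bern_sum1.
exists G.
  apply: trigpoly_sum => k; apply: trigpolyM; first exact: trigpoly_cst.
  apply: trigpoly_prod => i; apply: trigpoly_bern.
  apply: (@trigpoly_ext (fun x => 2^-1 + 2^-1 * sin (lam^-1 * x i))).
    by move=> x; rewrite /t; field.
  apply: trigpolyD; first exact: trigpoly_cst.
  by apply: trigpolyM; [exact: trigpoly_cst|exact: trigpoly_sin].
move=> x; pose y i := lam * sin (lam^-1 * x i).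
have fy : `|f y - f x| <= e * \sum_i x i ^+ 2.
  apply: (le_trans (Lf _ _)); rewrite mulr_sumr mulr_sumr; apply: ler_sum => i _.
  rewrite /y; have := sub_sin_le_sqr (lam^-1 * x i).
  have -> : lam * sin (lam^-1 * x i) - x i =
      - (lam * (lam^-1 * x i - sin (lam^-1 * x i))) by field; rewrite gt_eqF.
  rewrite normrN normrM (gtr0_norm lam0) => hs.
  apply: (@le_trans _ _ (L * (lam * (lam^-1 * x i) ^+ 2))).
    by rewrite ler_wpM2l// ler_wpM2l// ltW.
  have -> : L * (lam * (lam^-1 * x i) ^+ 2) = (L / lam) * x i ^+ 2.
    by field; rewrite gt_eqF.
  rewrite ler_wpM2r ?sqr_ge0// ler_pdivrMr// /lam mulrDr mulr1 mulrCA divff ?gt_eqF//.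
  by rewrite mulr1 lerDl ltW.
(* The weights form a product measure: the other coordinates sum out to 1, and [bern_abs] bounds
   what remains. *)
have marg i : \sum_(k : {ffun I -> 'I_n.+2}) `|(k i)%:R / n.+1%:R - t x i| * w x k <= 2 * h.
  have -> : \sum_(k : {ffun I -> 'I_n.+2}) `|(k i)%:R / n.+1%:R - t x i| * w x k =
     \sum_(k : {ffun I -> 'I_n.+2}) \prod_j
       ((if j == i then `|(k j)%:R / n.+1%:R - t x j| else 1) *
        bern (t x j) n.+1 (k j)).
    apply: eq_bigr => k _; rewrite big_split/=; congr (_ * _).
    by rewrite (bigD1 i)//= eqxx big1 ?mulr1// => j /negbTE->.
  rewrite -(bigA_distr_bigA (fun j (k : 'I_n.+2) =>
    (if j == i then `|k%:R / n.+1%:R - t x j| else 1) * bern (t x j) n.+1 k)).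
  pose B j := \sum_(k < n.+2) (if j == i then `|k%:R / n.+1%:R - t x j| else 1) *
    bern (t x j) n.+1 k.
  have B1 j : j != i -> B j = 1.
    move=> /negbTE ji; rewrite -(bern_sum1 (t x j) n.+1).
    by apply: eq_bigr => k _; rewrite ji mul1r.
  suff hB : \prod_j B j <= 2 * h by exact: hB.
  have -> : \prod_j B j = B i.
    rewrite (bigD1 i)//= -[RHS]mulr1; congr (_ * _); exact: big1.
  rewrite /B eqxx.
  apply: (le_trans (bern_abs _ (t01 x i) h0)).
  by rewrite -[2]/(1 + 1) mulrDl mul1r lerD2l.
have Gy : `|G x - f y| <= e.
  have -> : G x - f y = \sum_k (f (node k) - f y) * w x k.
    under eq_bigr do rewrite mulrBl.
    by rewrite sumrB -mulr_sumr w1 mulr1.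
  apply: (le_trans (ler_norm_sum _ _ _)).
  apply: (@le_trans _ _ (\sum_(k : {ffun I -> 'I_n.+2}) \sum_(i : I)
     (2 * L * lam) * (`|(k i)%:R / n.+1%:R - t x i| * w x k))).
    apply: ler_sum => k _; rewrite normrM (ger0_norm (w0 _ _)).
    under eq_bigr do rewrite mulrA; rewrite -mulr_suml ler_wpM2r//.
    apply: (le_trans (Lf _ _)); rewrite mulr_sumr; apply: ler_sum => i _.
    have -> : node k i - y i = 2 * lam * ((k i)%:R / n.+1%:R - t x i).
      by rewrite /node /y /t; field; rewrite gt_eqF// addrC natr1.
    by rewrite normrM ger0_norm ?mulr_ge0 ?(ltW lam0)//; lra.
  rewrite exchange_big/=.
  apply: (@le_trans _ _ (\sum_(i : I) (2 * L * lam) * (2 * h))).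
    apply: ler_sum => i _; rewrite -mulr_sumr ler_wpM2l// !mulr_ge0//; exact: ltW.
  have -> : \sum_(i : I) (2 * L * lam) * (2 * h) = (D - 1) * (2 * h).
    rewrite sumr_const -[LHS]mulr_natr (_ : #|xpredT : pred I| = #|I|)//.
    by rewrite /D; ring.
  have -> : e = D * (2 * h) by rewrite /h; field; rewrite gt_eqF.
  by rewrite mulrBl mul1r gerBl mulr_ge0// ltW.
have -> : G x - f x = (G x - f y) + (f y - f x) by ring.
by rewrite (le_trans (ler_normD _ _))// mulrDr mulr1 lerD.
Qed.

End trigonometric_polynomials.

(** * Weak convergence *)


Lemma cvg_of_dist_le (R : realType) (u v : nat -> R) (l : R) :
  (forall n, `|u n - l| <= v n) -> v n @[n --> \oo] --> 0 -> u n @[n --> \oo] --> l.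
Proof.
move=> uv /cvgrPdist_le v0; apply/cvgrPdist_le => e /v0; apply: filterS => n.
rewrite sub0r normrN distrC => vn.
exact: le_trans (uv n) (le_trans (ler_norm _) vn).
Qed.

Lemma cvg_sum_seq (R : realType) (J : Type) (s : seq J) (u : J -> nat -> R)
    (l : J -> R) : (forall j, u j n @[n --> \oo] --> l j) ->
  \sum_(j <- s) u j n @[n --> \oo] --> \sum_(j <- s) l j.
Proof.
move=> ul; elim: s => [|j s ih].
  rewrite big_nil (_ : (fun n => _) = fun=> 0); first exact: cvg_cst.
  by apply/funext => n; rewrite big_nil.
rewrite big_cons (_ : (fun n => _) = fun n => u j n + \sum_(i <- s) u i n).
  exact: cvgD.
by apply/funext => n; rewrite big_cons.
Qed.

Section trigpoly_expectations.
Context d (T : measurableType d) (R : realType) (P : probability T R).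
Context (I : finType).
Implicit Types (X : T -> I -> R) (f g : (I -> R) -> R).

Lemma measurable_lincomb X (u : I -> R) :
  (forall i, measurable_fun setT (X ^~ i)) ->
  measurable_fun setT (fun w => \sum_i u i * X w i).
Proof. by move=> mX; apply: measurable_sum => i; apply: measurable_funM. Qed.

Lemma measurable_trig_term X t : (forall i, measurable_fun setT (X ^~ i)) ->
  measurable_fun setT (fun w => trig_term t (X w)).
Proof.
move=> mX; apply: measurable_funD; apply: measurable_funM => //.
  by apply: measurable_cosR; exact: measurable_lincomb.
by apply: measurable_sinR; exact: measurable_lincomb.
Qed.

Lemma measurable_trigpoly X g : (forall i, measurable_fun setT (X ^~ i)) ->
  trigpoly g -> measurable_fun setT (fun w => g (X w)).
Proof.
move=> mX [s es]; under eq_fun do rewrite es.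
by apply: measurable_sum => t; exact: measurable_trig_term.
Qed.

Lemma intg_trig_term X t : (forall i, measurable_fun setT (X ^~ i)) ->
  intg P (fun w => trig_term t (X w)).
Proof.
move=> mX; apply: intgD; apply: intgZ.
  by apply: intg_cos; exact: measurable_lincomb.
by apply: intg_sin; exact: measurable_lincomb.
Qed.

Lemma intg_trigpoly X g : (forall i, measurable_fun setT (X ^~ i)) ->
  trigpoly g -> intg P (fun w => g (X w)).
Proof.
move=> mX [s es]; under eq_fun do rewrite es.
by apply: intg_sum => t; exact: intg_trig_term.
Qed.

(** By [trigpoly_approx], f is a pointwise limit of trigonometric polynomials, and these are
    measurable in [X] coordinate by coordinate. *)
Lemma measurable_lipschitz X f (L : R) : 0 <= L ->
  (forall x y, `|f x - f y| <= L * \sum_i `|x i - y i|) ->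
  (forall i, measurable_fun setT (X ^~ i)) ->
  measurable_fun setT (fun w => f (X w)).
Proof.
move=> L0 Lf mX.
have ex n : { G | trigpoly G /\
    forall x, `|G x - f x| <= n.+1%:R^-1 * (1 + \sum_i x i ^+ 2)}.
  apply: cid; have [|G tG Gf] := @trigpoly_approx _ _ f L n.+1%:R^-1 L0 _ Lf.
    by rewrite invr_gt0.
  by exists G.
apply: (@measurable_fun_cvg _ _ _ _ (fun n w => sval (ex n) (X w))).
  by move=> n; apply: measurable_trigpoly => //; have [] := svalP (ex n).
move=> w _; apply: (@cvg_of_dist_le _ _
    (fun n => n.+1%:R^-1 * (1 + \sum_i X w i ^+ 2))).
  by move=> n; have [_] := svalP (ex n); exact.
set c := 1 + _; rewrite -(mul0r c).
by apply: cvgM; [exact: cvg_harmonic|exact: cvg_cst].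
Qed.

Lemma norm_mean_trigpoly_approx X f g (M L e B : R) : 0 <= L -> 0 <= e ->
  (forall x y, `|f x - f y| <= L * \sum_i `|x i - y i|) ->
  (forall x, `|f x| <= M) -> trigpoly g ->
  (forall x, `|g x - f x| <= e * (1 + \sum_i x i ^+ 2)) ->
  (forall i, measurable_fun setT (X ^~ i)) ->
  (forall i, intg P (fun w => X w i ^+ 2)) ->
  \sum_i mean P (fun w => X w i ^+ 2) <= B ->
  `|mean P (fun w => g (X w)) - mean P (fun w => f (X w))| <= e * (1 + B).
Proof.
move=> L0 e0 Lf fM tg gf mX iX2 XB.
have iS : intg P (fun w => \sum_i X w i ^+ 2) by exact: intg_sum.
have i1S : intg P (fun w => 1 + \sum_i X w i ^+ 2).
  by apply: intgD => //; exact: intg_cst.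
apply: (@le_trans _ _ (mean P (fun w => e * (1 + \sum_i X w i ^+ 2)))).
  apply: norm_meanB_le => //; first exact: intg_trigpoly.
    apply: (@intg_bounded _ _ _ _ _ M); last by move=> w.
    exact: measurable_lipschitz Lf mX.
  exact: intgZ.
rewrite meanZ// meanD//; last exact: intg_cst.
by rewrite mean_cst mean_sum// ler_wpM2l// lerD2l.
Qed.

End trigpoly_expectations.

Lemma weak_cvg_of_cf d (T : measurableType d) (R : realType) (P : probability T R)
    d' (T' : measurableType d') (P' : probability T' R) (I : finType)
    (X : nat -> T -> I -> R) (Y : T' -> I -> R) (B M L : R) (f : (I -> R) -> R) :
  (forall m i, measurable_fun setT (X m ^~ i)) ->
  (forall i, measurable_fun setT (Y ^~ i)) ->
  (forall m i, intg P (fun w => X m w i ^+ 2)) ->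
  (forall i, intg P' (fun w => Y w i ^+ 2)) ->
  (forall m, \sum_i mean P (fun w => X m w i ^+ 2) <= B) ->
  \sum_i mean P' (fun w => Y w i ^+ 2) <= B ->
  (forall u, mean P (fun w => cos (\sum_i u i * X m w i)) @[m --> \oo] -->
             mean P' (fun w => cos (\sum_i u i * Y w i))) ->
  (forall u, mean P (fun w => sin (\sum_i u i * X m w i)) @[m --> \oo] -->
             mean P' (fun w => sin (\sum_i u i * Y w i))) ->
  0 <= L -> (forall x y, `|f x - f y| <= L * \sum_i `|x i - y i|) ->
  (forall x, `|f x| <= M) ->
  mean P (fun w => f (X m w)) @[m --> \oo] --> mean P' (fun w => f (Y w)).
Proof.
move=> mX mY iX iY XB YB cc cs L0 Lf fM.
have B0 : 0 <= B.
  by apply: le_trans YB; apply: sumr_ge0 => i _; apply: mean_ge0 => w; rewrite sqr_ge0.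
apply/cvgrPdist_le => e e0.
(* Each of the two approximations costs e' (1 + B) = e / 4, with the same B for all m; convergence
   of the trigonometric polynomial takes the other e / 2. *)
pose e' := e / (4 * (1 + B)).
have e'0 : 0 < e' by rewrite divr_gt0// mulr_gt0// ltr_pwDl.
have [G tG Gf] := trigpoly_approx L0 e'0 Lf.
have hX m := norm_mean_trigpoly_approx L0 (ltW e'0) Lf fM tG Gf (mX m) (iX m) (XB m).
have hY := norm_mean_trigpoly_approx L0 (ltW e'0) Lf fM tG Gf mY iY YB.
have cG : mean P (fun w => G (X m w)) @[m --> \oo] --> mean P' (fun w => G (Y w)).
  have [s es] := tG.
  have meanG d0 (T0 : measurableType d0) (P0 : probability T0 R) (Z : T0 -> I -> R) :
      (forall i, measurable_fun setT (Z ^~ i)) ->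
      mean P0 (fun w => G (Z w)) = \sum_(t <- s)
        (t.1.1 * mean P0 (fun w => cos (\sum_i t.2 i * Z w i)) +
         t.1.2 * mean P0 (fun w => sin (\sum_i t.2 i * Z w i))).
    move=> mZ; under eq_fun do rewrite es.
    rewrite mean_sum; last by move=> t; exact: intg_trig_term.
    have ml t := @measurable_lincomb _ _ _ _ Z t mZ.
    apply: eq_bigr => t _; rewrite /trig_term meanD.
    - by rewrite !meanZ//; [exact: intg_sin|exact: intg_cos].
    - by apply: intgZ; exact: intg_cos.
    - by apply: intgZ; exact: intg_sin.
  rewrite meanG//; under eq_fun do rewrite meanG//.
  apply: cvg_sum_seq => t; apply: cvgD; apply: cvgM; try exact: cvg_cst.
    exact: cc.
  exact: cs.
have e2 : 0 < e / 2 by rewrite divr_gt0.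
move/cvgrPdist_le : cG => /(_ _ e2); apply: filterS => m hm.
have -> : mean P' (fun w => f (Y w)) - mean P (fun w => f (X m w)) =
  (mean P' (fun w => G (Y w)) - mean P (fun w => G (X m w))) -
  (mean P' (fun w => G (Y w)) - mean P' (fun w => f (Y w))) +
  (mean P (fun w => G (X m w)) - mean P (fun w => f (X m w))) by ring.
have e4 : e' * (1 + B) = e / 4 by rewrite /e'; field; lra.
rewrite e4 in hY; have := hX m; rewrite e4 => {}hX.
apply: (le_trans (ler_normD _ _)).
by have := ler_normB (mean P' (fun w => G (Y w)) - mean P (fun w => G (X m w)))
  (mean P' (fun w => G (Y w)) - mean P' (fun w => f (Y w))); lra.
Qed.

(** * Probabilities of level events under weak convergence *)

Section lipschitz_events.
Context {R : realType}.

Definition ramp (a b x : R) : R := Num.max 0 (Num.min 1 ((x - a) / (b - a))).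

Lemma ramp_ge0 a b x : 0 <= ramp a b x.
Proof. by rewrite le_max lexx. Qed.

Lemma ramp_le1 a b x : ramp a b x <= 1.
Proof. by rewrite ge_max ler01 ge_min lexx. Qed.

Lemma ramp1 a b x : a < b -> b <= x -> ramp a b x = 1.
Proof.
move=> ab bx; rewrite /ramp (min_idPl _) ?(max_idPr _)//.
by rewrite ler_pdivlMr ?subr_gt0// mul1r lerB.
Qed.

Lemma ramp0 a b x : a < b -> x <= a -> ramp a b x = 0.
Proof.
move=> ab xa; rewrite /ramp; apply/max_idPl; rewrite ge_min; apply/orP; right.
by rewrite ler_pdivrMr ?subr_gt0// mul0r subr_le0.
Qed.

Lemma norm_max0_le (u v : R) : `|Num.max 0 u - Num.max 0 v| <= `|u - v|.
Proof.
case: (leP 0 u) => u0; case: (leP 0 v) => v0.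
- by [].
- by rewrite subr0 !ger0_norm; lra.
- by rewrite sub0r normrN ger0_norm// ltr0_norm; lra.
- by rewrite subr0 normr0.
Qed.

Lemma norm_min1_le (u v : R) : `|Num.min 1 u - Num.min 1 v| <= `|u - v|.
Proof.
case: (leP 1 u) => u0; case: (leP 1 v) => v0.
- by rewrite subrr normr0.
- by rewrite !ger0_norm; lra.
- by rewrite !ler0_norm; lra.
- by [].
Qed.

Lemma ramp_lipschitz a b x y : a < b -> `|ramp a b x - ramp a b y| <= (b - a)^-1 * `|x - y|.
Proof.
move=> ab; apply: (le_trans (norm_max0_le _ _)); apply: (le_trans (norm_min1_le _ _)).
have -> : (x - a) / (b - a) - (y - a) / (b - a) = (b - a)^-1 * (x - y).
  by field; rewrite subr_eq0 gt_eqF.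
by rewrite normrM gtr0_norm// invr_gt0 subr_gt0.
Qed.

Definition lipschitz_cvg d (T : measurableType d) (P : probability T R)
    d' (T' : measurableType d') (P' : probability T' R) (I : finType)
    (X : nat -> T -> I -> R) (Y : T' -> I -> R) :=
  forall (f : (I -> R) -> R) (L M : R), 0 <= L ->
    (forall x y, `|f x - f y| <= L * \sum_i `|x i - y i|) ->
    (forall x, `|f x| <= M) ->
    mean P (fun w => f (X m w)) @[m --> \oo] --> mean P' (fun w => f (Y w)).

Section events.
Context d (T : measurableType d) (P : probability T R).
Context d' (T' : measurableType d') (P' : probability T' R) (I : finType).
Variables (X : nat -> T -> I -> R) (Y : T' -> I -> R).
Hypotheses (mX : forall m i, measurable_fun setT (X m ^~ i))
  (mY : forall i, measurable_fun setT (Y ^~ i)) (XY : lipschitz_cvg P P' X Y).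
Variables (g : (I -> R) -> R) (L : R).
Hypotheses (L0 : 0 <= L) (gL : forall x y, `|g x - g y| <= L * \sum_i `|x i - y i|).

Lemma measurable_lipschitz_event d0 (T0 : measurableType d0) (V : T0 -> I -> R) c :
  (forall i, measurable_fun setT (V ^~ i)) -> measurable [set w | c <= g (V w)].
Proof.
move=> mV; apply: measurable_superlevel; exact: measurable_lipschitz gL mV.
Qed.

Let ramp_bounds d0 (T0 : measurableType d0) (P0 : probability T0 R) (V : T0 -> I -> R) a b :
  (forall i, measurable_fun setT (V ^~ i)) -> a < b ->
  pr P0 [set w | b <= g (V w)] <= mean P0 (fun w => ramp a b (g (V w))) <=
  pr P0 [set w | a <= g (V w)].
Proof.
move=> mV ab; have mE c := @measurable_lipschitz_event _ _ V c mV.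
have mr : measurable_fun setT (fun w => ramp a b (g (V w))).
  apply: (measurable_lipschitz (f := fun x => ramp a b (g x)) (L := (b - a)^-1 * L)) => //.
    by rewrite mulr_ge0// invr_ge0 subr_ge0 ltW.
  move=> x y; apply: (le_trans (ramp_lipschitz _ _ ab)).
  by rewrite -mulrA ler_wpM2l// invr_ge0 subr_ge0 ltW.
have ir : intg P0 (fun w => ramp a b (g (V w))).
  by apply: (@intg_bounded _ _ _ _ _ 1) => // w; rewrite ger0_norm ?ramp_ge0 ?ramp_le1.
rewrite -!mean_indic//; apply/andP; split; apply: mean_le => //; try exact: intg_indic.
  move=> w; rewrite indicE; case: (boolP (w \in _)) => [|_]; last exact: ramp_ge0.
  by rewrite inE/= => h; rewrite ramp1.
move=> w; rewrite indicE; case: (boolP (w \in _)) => [_|]; first exact: ramp_le1.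
by rewrite notin_setE/= => /negP; rewrite -ltNge => /ltW h; rewrite ramp0.
Qed.

(** A form of the portmanteau theorem: [ramp a b] lies between the indicators of the two half-lines
    starting at b and at a, and the gap between the levels replaces any condition on the
    boundary. *)
Lemma lipschitz_cvg_events a b eta : a < b -> 0 < eta ->
  \forall m \near \oo,
    pr P [set w | b <= g (X m w)] <= pr P' [set w | a <= g (Y w)] + eta /\
    pr P' [set w | b <= g (Y w)] <= pr P [set w | a <= g (X m w)] + eta.
Proof.
move=> ab eta0.
have c : mean P (fun w => ramp a b (g (X m w))) @[m --> \oo] -->
    mean P' (fun w => ramp a b (g (Y w))).
  apply: (XY (f := fun x => ramp a b (g x)) (L := (b - a)^-1 * L) (M := 1)).
  - by rewrite mulr_ge0// invr_ge0 subr_ge0 ltW.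
  - move=> x y; apply: (le_trans (ramp_lipschitz _ _ ab)).
    by rewrite -mulrA ler_wpM2l// invr_ge0 subr_ge0 ltW.
  - by move=> x; rewrite ger0_norm ?ramp_ge0 ?ramp_le1.
move/cvgrPdist_le : c => /(_ _ eta0); apply: filterS => m.
have /andP[x1 x2] := ramp_bounds P (mX m) ab.
have /andP[y1 y2] := ramp_bounds P' mY ab.
by rewrite ler_norml => /andP[h1 h2]; split; lra.
Qed.

End events.

End lipschitz_events.

(** * Gaussian moments *)


Section density.
Context d (T : measurableType d) d' (U : measurableType d') (R : realType).
Variables (P : {measure set T -> \bar R}) (mu : {measure set U -> \bar R}).
Variables (X : T -> U) (g : U -> R).
Hypotheses (mX : measurable_fun setT X) (mg : measurable_fun setT g).
Hypothesis g0 : forall x, 0 <= g x.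
Hypothesis density : forall A, measurable A ->
  P (X @^-1` A) = (\int[mu]_(x in A) (g x)%:E)%E.
Local Open Scope ereal_scope.
Import HBNNSimple.

(** Both sides are monotone limits along simple functions below f, and for the indicator of a level
    set the equality is the hypothesis [density]. *)
Lemma ge0_integral_density (f : U -> R) : measurable_fun setT f ->
  (forall x, 0 <= f x)%R ->
  \int[P]_w (f (X w))%:E = \int[mu]_x (f x * g x)%:E.
Proof.
move=> mf f0; have mf' : measurable_fun setT (EFin \o f) by exact/measurable_EFinP.
have f0' x : 0 <= (EFin \o f) x by rewrite lee_fin.
pose h := nnsfun_approx measurableT mf'.
have ch x : (EFin \o h n) x @[n --> \oo] --> (f x)%:E.
  by apply: (@cvg_nnsfun_approx _ _ _ _ measurableT _ mf').
have -> : \int[P]_w (f (X w))%:E = lim (\int[P]_w (h n (X w))%:E @[n --> \oo]).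
  rewrite -monotone_convergence//.
  - by apply: eq_integral => w _; apply/esym/cvg_lim => //; exact: ch.
  - by move=> n; apply/measurable_EFinP; exact: measurableT_comp.
  - by move=> n w _; rewrite lee_fin.
  - by move=> w _ m n mn; rewrite lee_fin; exact/lefP/nd_nnsfun_approx.
have -> : \int[mu]_x (f x * g x)%:E = lim (\int[mu]_x (h n x * g x)%:E @[n --> \oo]).
  rewrite -monotone_convergence//.
  - apply: eq_integral => x _; apply/esym/cvg_lim => //.
    under eq_fun do rewrite EFinM; rewrite EFinM.
    by apply: cvgeZr => //; exact: ch.
  - by move=> n; apply/measurable_EFinP; exact: measurable_funM.
  - by move=> n x _; rewrite lee_fin mulr_ge0.
  - move=> x _ m n mn; rewrite lee_fin ler_wpM2r//.
    exact/lefP/nd_nnsfun_approx.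
suff E n : \int[P]_w (h n (X w))%:E = \int[mu]_x (h n x * g x)%:E.
  by under eq_fun do rewrite E.
have mI r : measurable (h n @^-1` [set r]) by [].
transitivity (\sum_(r \in range (h n)) (\int[P]_w (r * \1_(h n @^-1` [set r]) (X w))%:E)).
  under eq_integral do rewrite fimfunE -fsumEFin//.
  rewrite ge0_integral_fsum//.
  - move=> r; apply/measurable_EFinP; apply: measurable_funM => //.
    exact: measurableT_comp.
  - by move=> r w _; exact: nnfun_muleindic_ge0.
transitivity (\sum_(r \in range (h n)) (\int[mu]_x (r * \1_(h n @^-1` [set r]) x * g x)%:E)); last first.
  rewrite -ge0_integral_fsum//.
  - apply: eq_integral => x _; rewrite [RHS]EFinM.
    rewrite [X in _ = X%:E * _](fimfunE (h n) x) -fsumEFin// ge0_mule_fsuml//.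
      by move=> r; exact: nnfun_muleindic_ge0.
  - move=> r; apply/measurable_EFinP; apply: measurable_funM => //.
    by apply: measurable_funM.
  - move=> r x _; rewrite EFinM mule_ge0 ?lee_fin//; exact: nnfun_muleindic_ge0.
apply: eq_fsbigr => r /[!inE] -[x _ <-].
under eq_integral do rewrite EFinM.
rewrite ge0_integralZl//; last 2 first.
- by apply/measurable_EFinP; exact: measurableT_comp.
- by rewrite lee_fin.
under [RHS]eq_integral do rewrite -mulrA EFinM.
rewrite ge0_integralZl//; last 3 first.
- by apply/measurable_EFinP; apply: measurable_funM.
- by move=> w _; rewrite lee_fin mulr_ge0.
- by rewrite lee_fin.
congr (_ * _).
rewrite (_ : (fun w => _) = EFin \o \1_(X @^-1` (h n @^-1` [set h n x])))//.
rewrite integral_indic//; last first.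
  by rewrite -[X in measurable X]setTI; exact: mX.
rewrite setIT density// [LHS]integral_mkcond/=.
apply: eq_integral => y _; rewrite patchE indicE.
by case: ifPn => _; rewrite ?mul1r ?mul0r.
Qed.

End density.

Section gaussian_moments.
Context d (T : measurableType d) (R : realType) (P : probability T R).
Variables (X : T -> R) (s : R).
Hypotheses (mX : measurable_fun setT X) (s0 : 0 < s).
Hypothesis lawX : forall A : set R, measurable A ->
  P (X @^-1` A) = normal_prob 0 s A.

(* Completing the square turns [expR (t x)] times the density of N(0,s^2) into a multiple of the density of N(t s^2, s^2). *)
Lemma gaussian_mgf t : intg P (fun w => expR (t * X w)) /\
  mean P (fun w => expR (t * X w)) = expR (t ^+ 2 * s ^+ 2 / 2).
Proof.
have me : measurable_fun setT (fun x : R => expR (t * x)).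
  by apply: (measurableT_comp (@measurable_expR R)); exact: measurable_funM.
have E : (\int[P]_w (expR (t * X w))%:E)%E = (expR (t ^+ 2 * s ^+ 2 / 2))%:E.
  rewrite (@ge0_integral_density _ _ _ _ _ _ lebesgue_measure X (normal_pdf 0 s)
     mX (measurable_normal_pdf 0 s) (normal_pdf_ge0 0 s) lawX (fun x => expR (t * x)))//.
  transitivity (\int[lebesgue_measure]_x ((expR (t ^+ 2 * s ^+ 2 / 2))%:E *
      (normal_pdf (t * s ^+ 2) s x)%:E))%E.
    apply: eq_integral => x _; rewrite -EFinM; congr EFin.
    rewrite !normal_pdfE ?gt_eqF// /normal_fun.
    rewrite mulrCA [RHS]mulrCA -!expRD; congr (_ * expR _).
    by rewrite subr0; field; rewrite gt_eqF.
  rewrite ge0_integralZl//.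
  - by rewrite integral_normal_pdf mule1.
  - by apply/measurable_EFinP; exact: measurable_normal_pdf.
  - by move=> x _; rewrite lee_fin normal_pdf_ge0.
have mf : measurable_fun setT (fun w => expR (t * X w)) by exact: (measurableT_comp me).
split; last by rewrite /mean /Rintegral E.
apply/integrableP; split; first exact/measurable_EFinP.
under eq_integral do rewrite /= ger0_norm ?expR_ge0//.
by rewrite E ltry.
Qed.

Let Y w := X w / s.
(** One dominating function for all the moments: [D] is above exp(2 |Y|), half of that exponent
    absorbs powers of |Y|, and its mean [K] comes from the moment generating function at 2 and
    -2. *)
Let D w := expR (2 * Y w) + expR (- 2 * Y w).
Let K : R := 2 * expR 2.

Let mY : measurable_fun setT Y.
Proof. exact: measurable_funM. Qed.

Let mgfY t : intg P (fun w => expR (t * Y w)) /\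
  mean P (fun w => expR (t * Y w)) = expR (t ^+ 2 / 2).
Proof.
have [i e] := gaussian_mgf (t / s).
have E : (fun w => expR (t * Y w)) = fun w => expR (t / s * X w).
  by apply/funext => w; congr expR; rewrite /Y; field; rewrite gt_eqF.
rewrite E; split => //; rewrite e; congr expR; field; rewrite gt_eqF//.
Qed.

Let iD : intg P D.
Proof. by apply: intgD; have [] := mgfY 2; have [] := mgfY (-2). Qed.

Let KE : mean P D = K.
Proof.
have [i1 e1] := mgfY 2; have [i2 e2] := mgfY (-2).
rewrite /D meanD// e1 e2 /K.
rewrite (_ : 2 ^+ 2 / 2 = 2 :> R); last by field.
by rewrite (_ : (-2) ^+ 2 / 2 = 2 :> R); [ring|field].
Qed.

Let D_ge w : expR (2 * `|Y w|) <= D w.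
Proof.
rewrite /D; have := expR_ge0 (2 * Y w); have := expR_ge0 (- 2 * Y w).
have [y0|y0] := leP 0 (Y w); first by rewrite ger0_norm//; lra.
by rewrite ltr0_norm// mulrN -mulNr; lra.
Qed.

Let D_ge' w : expR `|Y w| <= D w.
Proof.
by apply: le_trans (D_ge w); rewrite ler_expR; have := normr_ge0 (Y w); lra.
Qed.

Let Dpos w : 0 <= D w.
Proof. exact: le_trans (expR_ge0 _) (D_ge w). Qed.

(** The (k + 1)-st power of z <= exp z at z = y / (k + 1). The constants 4, 27 and 256 below are its
    values for k = 1, 2, 3. *)
Let pow_le_exp (k : nat) (y : R) : 0 <= y -> y ^+ k.+1 <= k.+1%:R ^+ k.+1 * expR y.
Proof.
move=> y0; have k0 : 0 < k.+1%:R :> R by rewrite ltr0n.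
have -> : expR y = expR (y / k.+1%:R) ^+ k.+1.
  by rewrite -expRM_natl; congr expR; field; rewrite addrC natr1 gt_eqF.
rewrite -exprMn lerXn2r ?nnegrE// ?mulr_ge0 ?expR_ge0//.
rewrite -ler_pdivrMl// mulrC.
by apply: le_trans (expR_ge1Dx _); rewrite lerDr.
Qed.

Let Ycube w : `|Y w| ^+ 3 * expR `|Y w| <= 27 * D w.
Proof.
apply: (@le_trans _ _ (27 * expR `|Y w| * expR `|Y w|)).
  rewrite ler_wpM2r ?expR_ge0//.
  by apply: (le_trans (@pow_le_exp 2 _ (normr_ge0 _))); rewrite ler_wpM2r ?expR_ge0//; lra.
rewrite -mulrA -expRD ler_wpM2l//.
by apply: le_trans (D_ge w); rewrite ler_expR; lra.
Qed.

Let Ysqr w : `|Y w| ^+ 2 * expR `|Y w| <= 4 * D w.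
Proof.
apply: (@le_trans _ _ (4 * expR `|Y w| * expR `|Y w|)).
  rewrite ler_wpM2r ?expR_ge0//.
  by apply: (le_trans (@pow_le_exp 1 _ (normr_ge0 _))); rewrite ler_wpM2r ?expR_ge0//; lra.
rewrite -mulrA -expRD ler_wpM2l//.
by apply: le_trans (D_ge w); rewrite ler_expR; lra.
Qed.

Let Yfour w : `|Y w| ^+ 4 <= 256 * D w.
Proof.
apply: (le_trans (@pow_le_exp 3 _ (normr_ge0 _))).
by apply: ler_pM; rewrite ?expR_ge0//; lra.
Qed.

Let one_le_expR (y : R) : 0 <= y -> 1 <= expR y.
Proof. by move=> y0; have := expR_ge1Dx y; lra. Qed.

Let iYk (k : nat) (c : R) : (forall w, `|Y w| ^+ k <= c * D w) ->
  intg P (fun w => `|Y w| ^+ k).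
Proof.
move=> h; apply: (@intg_le _ _ _ _ _ (fun w => c * D w)).
- apply: measurable_funX; exact: measurableT_comp.
- by move=> w; rewrite ger0_norm ?exprn_ge0.
- exact: intgZ.
Qed.

Let Ysqr' w : `|Y w| ^+ 2 <= 4 * D w.
Proof.
apply: le_trans (Ysqr w); rewrite ler_peMr ?exprn_ge0//.
exact: one_le_expR.
Qed.

Let Ycube' w : `|Y w| ^+ 3 <= 27 * D w.
Proof.
apply: le_trans (Ycube w); rewrite ler_peMr ?exprn_ge0//.
exact: one_le_expR.
Qed.

Let iY2 : intg P (fun w => Y w ^+ 2).
Proof.
have := iYk Ysqr'; congr intg; apply/funext => w.
by rewrite real_normK ?num_real.
Qed.

Let iY : intg P Y.
Proof. exact: intg_of_sqr. Qed.

Let exp_le1Dxexp (z : R) : expR z <= 1 + z * expR z.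
Proof.
have h := expR_ge1Dx (- z); have e := expRxMexpNx_1 z.
by have := expR_gt0 z; nra.
Qed.

Let K0 : 0 < K.
Proof. by rewrite mulr_gt0// expR_gt0. Qed.

(** The symmetric difference of the moment generating function at t and -t is 2 t E Y up to order
    t^2, and it vanishes because the function is even. *)
Let meanY : mean P Y = 0.
Proof.
apply: (@eq_of_norm_le_inv _ _ _ (4 * K)) => n; rewrite subr0.
pose t : R := n.+1%:R^-1.
have t0 : 0 < t by rewrite invr_gt0.
have t1 : t <= 1 by rewrite invf_le1// ler1n.
have [i1 e1] := mgfY t; have [i2 e2] := mgfY (- t).
have bd w : `|(expR (t * Y w) - expR (- t * Y w)) - 2 * t * Y w| <= 8 * t ^+ 2 * D w.
  have [a [a0 aE ->]] : exists a, [/\ 0 <= a, a = t * `|Y w| &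
      `|(expR (t * Y w) - expR (- t * Y w)) - 2 * t * Y w| =
      `|expR a - expR (- a) - 2 * a|].
    exists (t * `|Y w|); split => //; first by rewrite mulr_ge0// ltW.
    have [y0|y0] := leP 0 (Y w); first by congr `|_|; rewrite (ger0_norm y0) mulNr; ring.
    rewrite (ltr0_norm y0) -normrN; congr `|_|.
    by rewrite !mulrN !mulNr opprK; ring.
  have /andP[h1 h2] := sinh_bounds a0.
  have ae : a ^+ 2 * expR a <= 4 * t ^+ 2 * D w.
    have -> : a ^+ 2 * expR a = t ^+ 2 * (`|Y w| ^+ 2 * expR a) by rewrite {1}aE; ring.
    have -> : 4 * t ^+ 2 * D w = t ^+ 2 * (4 * D w) by ring.
    rewrite ler_wpM2l ?exprn_ge0 ?(ltW t0)//.
    apply: le_trans (Ysqr w); rewrite ler_wpM2l ?exprn_ge0// ler_expR aE.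
    by rewrite ler_piMl.
  have g1 := exp_le1Dxexp a; have g2 := expR_ge1Dx (- a); have g3 := one_le_expR a0.
  rewrite ler_norml; apply/andP; split; nra.
have i12 : intg P (fun w => expR (t * Y w) - expR (- t * Y w)) by exact: intgB.
have := norm_meanB_le i12 (intgZ (2 * t) iY) (intgZ (8 * t ^+ 2) iD) bd.
rewrite meanB// e1 e2 sqrrN subrr sub0r normrN !meanZ// KE normrM.
rewrite gtr0_norm ?mulr_gt0// -/t => h.
have : 2 * t * `|mean P Y| <= 2 * t * (4 * K * t) by apply: le_trans h _; lra.
by rewrite ler_pM2l// mulr_gt0.
Qed.

(** The second difference of the moment generating function at 0 is t^2 E Y^2 up to order t^3 by
    domination, and t^2 up to order t^4 by its explicit form. *)
Let meanY2 : mean P (fun w => Y w ^+ 2) = 1.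
Proof.
apply: (@eq_of_norm_le_inv _ _ _ (27 * K + 1)) => n.
pose t : R := n.+1%:R^-1.
have t0 : 0 < t by rewrite invr_gt0.
have t1 : t <= 1 by rewrite invf_le1// ler1n.
have [i1 e1] := mgfY t; have [i2 e2] := mgfY (- t).
pose S w := expR (t * Y w) + expR (- t * Y w).
have iS : intg P S by exact: intgD.
have iS2 : intg P (fun w => S w - 2) by apply: intgB => //; exact: intg_cst.
have bd w : `|(S w - 2) - t ^+ 2 * Y w ^+ 2| <= 27 * t ^+ 3 * D w.
  pose z := t * `|Y w|; have z0 : 0 <= z by rewrite mulr_ge0// ltW.
  pose a := z / 2; have a0 : 0 <= a by rewrite divr_ge0.
  (* Halving the argument makes the second difference a square, to which [sinh_bounds] applies. *)
  have -> : S w - 2 = (expR a - expR (- a)) ^+ 2.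
    have -> : (expR a - expR (- a)) ^+ 2 = expR a * expR a +
       expR (- a) * expR (- a) - 2 * (expR a * expR (- a)) by ring.
    rewrite expRxMexpNx_1 -!expRD mulr1 -splitr -opprD -splitr /S /z.
    have [y0|y0] := leP 0 (Y w); first by rewrite (ger0_norm y0) mulNr.
    by rewrite (ltr0_norm y0) mulrN opprK mulNr; ring.
  have -> : t ^+ 2 * Y w ^+ 2 = (2 * a) ^+ 2.
    rewrite -[Y w ^+ 2]real_normK ?num_real// -exprMn; congr (_ ^+ 2).
    by rewrite /a /z; field.
  have /andP[h1 h2] := sinh_bounds a0.
  have za : expR z = expR a * expR a by rewrite -expRD -splitr.
  have nza : expR (- z) = expR (- a) * expR (- a) by rewrite -expRD -opprD -splitr.
  have ze : z ^+ 3 * expR z <= 27 * t ^+ 3 * D w.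
    have -> : z ^+ 3 * expR z = t ^+ 3 * (`|Y w| ^+ 3 * expR z) by rewrite {1}/z; ring.
    have -> : 27 * t ^+ 3 * D w = t ^+ 3 * (27 * D w) by ring.
    rewrite ler_wpM2l ?exprn_ge0 ?(ltW t0)//.
    apply: le_trans (Ycube w); rewrite ler_wpM2l ?exprn_ge0// ler_expR.
    by rewrite ler_piMl.
  have g1 := exp_le1Dxexp z; have g2 := expR_ge1Dx (- z); have g3 := one_le_expR z0.
  have ea := expR_ge0 a; have ena := expR_ge0 (- a).
  have sq1 : (expR a - expR (- a)) ^+ 2 <= z ^+ 2 * expR z.
    have -> : z ^+ 2 * expR z = (2 * a * expR a) ^+ 2 by rewrite za /a; field.
    rewrite lerXn2r ?nnegrE//.
    - by rewrite subr_ge0 ler_expR; lra.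
    - by rewrite mulr_ge0// mulr_ge0.
  have sq2 : z ^+ 2 * expR (- z) <= (expR a - expR (- a)) ^+ 2.
    have -> : z ^+ 2 * expR (- z) = (2 * a * expR (- a)) ^+ 2 by rewrite nza /a; field.
    rewrite lerXn2r ?nnegrE//.
    - by rewrite mulr_ge0// mulr_ge0.
    - by rewrite subr_ge0 ler_expR; lra.
  have -> : (2 * a) ^+ 2 = z ^+ 2 by rewrite /a; field.
  have zz : 0 <= z ^+ 2 by rewrite exprn_ge0.
  have p1 : z ^+ 2 * expR z <= z ^+ 2 + z ^+ 3 * expR z.
    have -> : z ^+ 2 + z ^+ 3 * expR z = z ^+ 2 * (1 + z * expR z) by ring.
    exact: ler_wpM2l.
  have p2 : z ^+ 2 - z ^+ 3 * expR z <= z ^+ 2 * expR (- z).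
    apply: (@le_trans _ _ (z ^+ 2 * (1 + - z))); last exact: ler_wpM2l.
    have -> : z ^+ 2 * (1 + - z) = z ^+ 2 - z ^+ 3 * 1 by ring.
    by rewrite lerD2l lerN2 ler_wpM2l// exprn_ge0.
  by rewrite ler_norml; apply/andP; split; lra.
have := norm_meanB_le iS2 (intgZ (t ^+ 2) iY2) (intgZ (27 * t ^+ 3) iD) bd.
rewrite meanB//; last exact: intg_cst.
rewrite mean_cst /S meanD// e1 e2 sqrrN !meanZ// KE => h.
have u0 : 0 <= t ^+ 2 / 2 by rewrite divr_ge0// exprn_ge0// ltW.
have h2 : `|expR (t ^+ 2 / 2) + expR (t ^+ 2 / 2) - 2 - t ^+ 2| <= t ^+ 4.
  have g1 := expR_ge1Dx (t ^+ 2 / 2).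
  have g2 := expR_ge1Dx (- (t ^+ 2 / 2)); have g3 := expRxMexpNx_1 (t ^+ 2 / 2).
  have t2 : t ^+ 2 <= 1 by rewrite exprn_ile1// ltW.
  have g4 : expR (t ^+ 2 / 2) <= 1 + t ^+ 2 / 2 + t ^+ 4 / 2.
    have -> : t ^+ 4 = t ^+ 2 * t ^+ 2 by ring.
    move: g2 g3 (expR_gt0 (t ^+ 2 / 2)) u0 t2.
    set E := expR (t ^+ 2 / 2); set F := expR (- _); set u := t ^+ 2 => g2 g3 E0 u0 t2.
    have : E * (1 - u / 2) <= E * F by rewrite ler_wpM2l// ltW.
    rewrite g3.
    have : 0 < 1 - u / 2 by lra.
    have : 1 <= (1 + u / 2 + u * u / 2) * (1 - u / 2) by nra.
    by nra.
  rewrite ler_norml; apply/andP; split; last lra.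
  have : 0 <= t ^+ 4 by rewrite exprn_ge0// ltW.
  lra.
have E1 : t ^+ 2 * (mean P (fun w => Y w ^+ 2) - 1) =
  (expR (t ^+ 2 / 2) + expR (t ^+ 2 / 2) - 2 - t ^+ 2) -
  (expR (t ^+ 2 / 2) + expR (t ^+ 2 / 2) - 2 - t ^+ 2 * mean P (fun w => Y w ^+ 2)).
  by ring.
have : t ^+ 2 * `|mean P (fun w => Y w ^+ 2) - 1| <= t ^+ 2 * ((27 * K + 1) * t).
  rewrite -[X in X * _ <= _](ger0_norm (ltW (exprn_gt0 2 t0))) -normrM E1.
  apply: (le_trans (ler_normB _ _)); apply: (le_trans (lerD h2 h)).
  have : t ^+ 4 <= t ^+ 3 by rewrite ler_wiXn2l// ltW.
  have -> : t ^+ 2 * ((27 * K + 1) * t) = 27 * t ^+ 3 * K + t ^+ 3 by ring.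
  by lra.
by rewrite ler_pM2l// exprn_gt0.
Qed.

Let XY w : X w = s * Y w.
Proof. by rewrite /Y mulrC divfK ?gt_eqF. Qed.

Lemma gaussian_intg : intg P X.
Proof. by rewrite (_ : X = fun w => s * Y w); [exact: intgZ|exact/funext]. Qed.

Lemma gaussian_mean : mean P X = 0.
Proof.
rewrite (_ : X = fun w => s * Y w); last exact/funext.
by rewrite meanZ// meanY mulr0.
Qed.

Lemma gaussian_sqr : intg P (fun w => X w ^+ 2) /\ mean P (fun w => X w ^+ 2) = s ^+ 2.
Proof.
rewrite (_ : (fun w => X w ^+ 2) = fun w => s ^+ 2 * Y w ^+ 2); last first.
  by apply/funext => w; rewrite XY exprMn.
by split; [exact: intgZ|rewrite meanZ// meanY2 mulr1].
Qed.

Lemma gaussian_cube : intg P (fun w => `|X w| ^+ 3) /\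
  mean P (fun w => `|X w| ^+ 3) <= 54 * expR 2 * s ^+ 3.
Proof.
rewrite (_ : (fun w => `|X w| ^+ 3) = fun w => s ^+ 3 * `|Y w| ^+ 3); last first.
  by apply/funext => w; rewrite XY normrM exprMn (gtr0_norm s0).
have i3 := iYk Ycube'; split; first exact: intgZ.
have s30 : 0 <= s ^+ 3 by rewrite exprn_ge0// ltW.
rewrite meanZ// mulrC ler_wpM2r//.
have -> : 54 * expR 2 = mean P (fun w => 27 * D w) by rewrite meanZ// KE /K; ring.
by apply: mean_le => //; exact: intgZ.
Qed.

(** Markov's inequality for the fourth power; [512 * expR 2] is 256 times the mean [K]. *)
Lemma gaussian_tail (c : R) : 0 < c ->
  pr P [set w | c <= `|X w|] <= 512 * expR 2 * s ^+ 4 / c ^+ 4.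
Proof.
move=> c0; have i4 := iYk Yfour.
have cs : 0 < (c / s) ^+ 4 by rewrite exprn_gt0// divr_gt0.
have -> : [set w | c <= `|X w|] = [set w | (c / s) ^+ 4 <= `|Y w| ^+ 4].
  apply/seteqP; split => w /=; rewrite ler_pXn2r ?nnegrE ?divr_ge0 ?(ltW c0) ?(ltW s0)//;
  by rewrite ler_pdivrMr// XY (normrM s) (gtr0_norm s0) (mulrC s).
apply: (le_trans (pr_markov i4 _ cs)); first by move=> w; rewrite exprn_ge0.
have -> : 512 * expR 2 * s ^+ 4 / c ^+ 4 = 512 * expR 2 / (c / s) ^+ 4.
  by field; rewrite !gt_eqF.
rewrite ler_pM2r ?invr_gt0//.
have -> : 512 * expR 2 = mean P (fun w => 256 * D w) by rewrite meanZ// KE /K; ring.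
by apply: mean_le => //; exact: intgZ.
Qed.

End gaussian_moments.

(** * I.i.d. random vectors *)


Lemma sqr_sum_norm_le (R : realType) (p : nat) (x : 'I_p -> R) :
  (\sum_i `|x i|) ^+ 2 <= p%:R * \sum_i x i ^+ 2.
Proof.
rewrite expr2.
apply: (@le_trans _ _ (\sum_i \sum_j (x i ^+ 2 + x j ^+ 2) / 2)).
  rewrite mulr_suml; apply: ler_sum => i _.
  rewrite mulr_sumr; apply: ler_sum => j _.
  rewrite -[x i ^+ 2]real_normK ?num_real// -[x j ^+ 2]real_normK ?num_real//.
  by have := sqr_ge0 (`|x i| - `|x j|); nra.
rewrite le_eqVlt; apply/orP; left; apply/eqP.
under eq_bigr do rewrite -mulr_suml big_split/= sumr_const card_ord.
set S := \sum_i x i ^+ 2; have SE : S *+ p = p%:R * S by rewrite mulr_natl.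
by rewrite -mulr_suml big_split/= sumr_const card_ord sumrMnl SE; field.
Qed.

Section equality_in_law.
Context d (T : measurableType d) (R : realType) (P : probability T R).

Lemma mean_eq_law (X Y : T -> R) (f : R -> R) :
  measurable_fun setT X -> measurable_fun setT Y ->
  (forall A, measurable A -> P (X @^-1` A) = P (Y @^-1` A)) ->
  measurable_fun setT f -> (forall x, 0 <= f x) ->
  mean P (fun w => f (X w)) = mean P (fun w => f (Y w)).
Proof.
move=> mX mY XY mf f0; congr fine.
pose X' : {mfun T >-> R} := mfun_Sub (mem_set mX).
pose Y' : {mfun T >-> R} := mfun_Sub (mem_set mY).
have mf' : measurable_fun setT (EFin \o f) by exact/measurable_EFinP.
have f0' y : (0 <= (EFin \o f) y)%E by rewrite lee_fin.
have := @ge0_integral_distribution _ _ _ _ _ P X' (EFin \o f) mf' f0'.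
have := @ge0_integral_distribution _ _ _ _ _ P Y' (EFin \o f) mf' f0'.
move=> <- <-; apply: eq_measure_integral => A mA _.
exact: XY.
Qed.

End equality_in_law.

Section vector_sigma_algebras.
Context d (T : measurableType d) (R : realType) (p : nat).
Implicit Types Z : T -> 'cV[R]_p.

(** The family that generates [vborel]. Naming it allows [g_sigma_algebraType vgen] to serve as the
    measurable space of vectors. *)
Definition vgen : set (set 'cV[R]_p) :=
  \big[setU/set0]_(i < p) preimage_set_system setT
    (fun x : 'cV[R]_p => (x i ord0 : R)) measurable.

Definition vec_sigma Z := preimage_set_system setT Z (@vborel R p).

Lemma measurable_coord (i : 'I_p) :
  measurable_fun setT ((fun x => x i ord0) : g_sigma_algebraType vgen -> R).
Proof.
move=> mD A mA; apply: sub_sigma_algebra; rewrite /vgen -bigcup_seq.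
by exists i; [exact: mem_index_enum|exists A].
Qed.

Lemma measurable_preimage_vborel Z A : random_vector Z -> @vborel R p A ->
  measurable (Z @^-1` A).
Proof.
move=> mZ; rewrite -[Z @^-1` A]setTI.
suff : @vborel R p `<=` image_set_system setT Z (@measurable d T) by exact.
apply: smallest_sub.
  by apply: sigma_algebra_image; exact: sigma_algebra_measurable.
move=> B; rewrite -bigcup_seq => -[i _ [C mC <-]].
rewrite /image_set_system/= !setTI.
by have := mZ i measurableT C mC; rewrite setTI.
Qed.

Lemma vec_sigma_measurable Z : random_vector Z -> vec_sigma Z `<=` @measurable d T.
Proof.
by move=> mZ _ [A vA <-]; rewrite setTI; exact: measurable_preimage_vborel.
Qed.

Lemma vec_sigma_algebra Z : sigma_algebra setT (vec_sigma Z).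
Proof. by apply: sigma_algebra_preimage; exact: smallest_sigma_algebra. Qed.

Lemma sigma_algebra_setI (G : set (set T)) : sigma_algebra setT G -> setI_closed G.
Proof.
move=> sG A B GA GB; rewrite -(setCK A) -(setCK B) -setCU.
have [G0 GC GU] := sG.
have gC X : G X -> G (~` X) by rewrite -setTD; exact: GC.
apply: (gC); rewrite -bigcup2E; apply: GU => -[|[|n]] /=; [exact: gC|exact: gC|exact: G0].
Qed.

Lemma sigma_algebra_setT (G : set (set T)) : sigma_algebra setT G -> G setT.
Proof. by case=> G0 GC _; rewrite -(setD0 setT); exact: GC. Qed.

Lemma vec_sigma_setI Z : setI_closed (vec_sigma Z).
Proof. by apply: sigma_algebra_setI; exact: vec_sigma_algebra. Qed.

Lemma vec_sigmaT Z : vec_sigma Z setT.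
Proof. by apply: sigma_algebra_setT; exact: vec_sigma_algebra. Qed.

Lemma measurable_vec_sigma Z (h : 'cV[R]_p -> R) :
  measurable_fun setT (h : g_sigma_algebraType vgen -> R) ->
  measurable_fun setT ((h \o Z) : g_sigma_algebraType (vec_sigma Z) -> R).
Proof.
move=> mh mD A mA; apply: sub_sigma_algebra; exists (h @^-1` A).
  by have := mh measurableT A mA; rewrite setTI.
by rewrite !setTI.
Qed.

End vector_sigma_algebras.

Section standardized_iid_vectors.
Context d (T : measurableType d) (R : realType) (P : probability T R) (p : nat).
Variable Z : nat -> T -> 'cV[R]_p.
Hypotheses (iidZ : iid_vectors P Z) (Z0 : forall i, mean_zero P (Z i)).
Hypothesis covZ : forall i, identity_covariance P (Z i).

Lemma iid_random_vector l : random_vector (Z l).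
Proof. by case: iidZ. Qed.

Lemma iid_mutually_independent : mutually_independent P (fun l => vec_sigma (Z l)).
Proof. by case: iidZ. Qed.

Lemma coord_mean l i : mean P (fun w => Z l w i ord0) = 0.
Proof. by have [_] := Z0 l i; rewrite unlock /mean /Rintegral => ->. Qed.

Let cov_integral l i j :
  (\int[P]_w (Z l w i ord0 * Z l w j ord0)%:E)%E = ((i == j)%:R)%:E.
Proof.
have := covZ l i j; rewrite unlock.
have [_ ->] := Z0 l i; have [_ ->] := Z0 l j.
rewrite unlock mxE => <-; apply: eq_integral => w _ /=.
transitivity (((Z l w i ord0 - 0) * (Z l w j ord0 - 0))%:E) => //.
by rewrite !subr0.
Qed.

Lemma coord_sqr_intg l i : intg P (fun w => Z l w i ord0 ^+ 2).
Proof.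
apply/integrableP; split.
  apply/measurable_EFinP; apply: measurable_funX; exact: iid_random_vector.
under eq_integral => w _ do rewrite /= ger0_norm ?sqr_ge0// expr2.
by rewrite cov_integral ltry.
Qed.

Lemma coord_mean_prod l i j :
  mean P (fun w => Z l w i ord0 * Z l w j ord0) = (i == j)%:R.
Proof. by rewrite /mean /Rintegral cov_integral. Qed.

Lemma coord_intgM l i j : intg P (fun w => Z l w i ord0 * Z l w j ord0).
Proof.
by apply: intgM_of_sqr; [exact: iid_random_vector|exact: iid_random_vector|
  exact: coord_sqr_intg|exact: coord_sqr_intg].
Qed.

Definition l1norm (x : 'cV[R]_p) : R := \sum_i `|x i ord0|.

Lemma measurable_l1norm :
  measurable_fun setT (l1norm : g_sigma_algebraType (@vgen R p) -> R).
Proof.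
apply: measurable_sum => i; apply: measurableT_comp => //.
exact: measurable_coord.
Qed.

Lemma measurable_l1normZ l : measurable_fun setT (fun w => l1norm (Z l w)).
Proof.
apply: measurable_sum => i; apply: measurableT_comp => //.
exact: iid_random_vector.
Qed.

Lemma l1norm_ge0 x : 0 <= l1norm x.
Proof. by apply: sumr_ge0. Qed.

(** The one place where equality of the laws enters: it makes the Lindeberg term of every summand
    equal to that of [Z 0]. *)
Lemma mean_l1norm_law l (f : R -> R) : measurable_fun setT f -> (forall x, 0 <= f x) ->
  mean P (fun w => f (l1norm (Z l w))) = mean P (fun w => f (l1norm (Z 0%N w))).
Proof.
move=> mf f0; apply: (@mean_eq_law _ _ _ _ (fun w => l1norm (Z l w)) (fun w => l1norm (Z 0%N w))) => //.
- exact: measurable_l1normZ.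
- exact: measurable_l1normZ.
- move=> A mA; have [_ _ eqlaw] := iidZ.
  change (P (Z l @^-1` (l1norm @^-1` A)) = P (Z 0%N @^-1` (l1norm @^-1` A))).
  apply: eqlaw.
  by have := measurable_l1norm measurableT mA; rewrite setTI.
Qed.

Lemma l1norm_sqr_intg l : intg P (fun w => l1norm (Z l w) ^+ 2).
Proof.
apply: (@intg_le _ _ _ _ _ (fun w => p%:R * \sum_i Z l w i ord0 ^+ 2)).
- by apply: measurable_funX; exact: measurable_l1normZ.
- by move=> w; rewrite ger0_norm ?sqr_ge0//; exact: sqr_sum_norm_le.
- by apply: intgZ; apply: intg_sum => i; exact: coord_sqr_intg.
Qed.

End standardized_iid_vectors.

(** * Lindeberg's theorem *)


Section cf_taylor_expansion.
Context d (T : measurableType d) (R : realType) (P : probability T R).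
Implicit Types Y g : T -> R.

(** Both cos Y and the Gaussian value exp(- v / 2), with v the second moment, are compared with 1 -
    v / 2, at costs g and v^2. The sine is compared with Y, which has mean 0. *)
Lemma cf_taylor Y g : measurable_fun setT Y -> intg P (fun w => Y w ^+ 2) ->
  mean P Y = 0 -> intg P g -> (forall w, trunc_sqr (Y w) <= g w) ->
  `|mean P (fun w => cos (Y w)) - expR (- (mean P (fun w => Y w ^+ 2) / 2))| +
  `|mean P (fun w => sin (Y w))| <= 2 * mean P g + mean P (fun w => Y w ^+ 2) ^+ 2.
Proof.
move=> mY iY2 Y0 ig Yg; set v := mean P (fun w => Y w ^+ 2).
have iY := intg_of_sqr mY iY2.
have v0 : 0 <= v by apply: mean_ge0 => w; rewrite sqr_ge0.
have h1 : `|mean P (fun w => cos (Y w)) - (1 - v / 2)| <= mean P g.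
  have -> : 1 - v / 2 = mean P (fun w => 1 - 2^-1 * Y w ^+ 2).
    rewrite meanB ?mean_cst ?meanZ//; [by rewrite mulrC|exact: intg_cst|exact: intgZ].
  apply: norm_meanB_le => //; first exact: intg_cos.
    by apply: intgB; [exact: intg_cst|exact: intgZ].
  by move=> w; apply: le_trans (Yg w); rewrite (mulrC 2^-1); exact: cos_taylor.
have h2 : `|mean P (fun w => sin (Y w))| <= mean P g.
  have -> : mean P (fun w => sin (Y w)) = - (mean P Y - mean P (fun w => sin (Y w))).
    by rewrite Y0; ring.
  rewrite normrN; apply: norm_meanB_le => //; first exact: intg_sin.
  by move=> w; apply: le_trans (Yg w); exact: sin_taylor.
have h3 : `|expR (- (v / 2)) - (1 - v / 2)| <= v ^+ 2.
  apply: (le_trans (expRN_taylor _)); first by rewrite divr_ge0.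
  have -> : (v / 2) ^+ 2 = v ^+ 2 / 4 by field.
  by have := sqr_ge0 v; lra.
have -> : mean P (fun w => cos (Y w)) - expR (- (v / 2)) =
  (mean P (fun w => cos (Y w)) - (1 - v / 2)) - (expR (- (v / 2)) - (1 - v / 2)) by ring.
have := ler_normB (mean P (fun w => cos (Y w)) - (1 - v / 2)) (expR (- (v / 2)) - (1 - v / 2)).
by lra.
Qed.

End cf_taylor_expansion.

Section lindeberg.
Context d (T : measurableType d) (R : realType) (P : probability T R) (p : nat).
Variable Z : nat -> T -> 'cV[R]_p.
Hypotheses (iidZ : iid_vectors P Z) (Z0 : forall i, mean_zero P (Z i)).
Hypothesis covZ : forall i, identity_covariance P (Z i).

Definition dotc (a : 'I_p -> R) (x : 'cV[R]_p) : R := \sum_i a i * x i ord0.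

Lemma measurable_dotc a :
  measurable_fun setT (dotc a : g_sigma_algebraType (@vgen R p) -> R).
Proof.
by apply: measurable_sum => i; apply: measurable_funM => //; exact: measurable_coord.
Qed.

Lemma measurable_dotcZ a l : measurable_fun setT (fun w => dotc a (Z l w)).
Proof.
apply: measurable_sum => i; apply: measurable_funM => //.
exact: (iid_random_vector iidZ).
Qed.

Lemma dotc_sqr a l : intg P (fun w => dotc a (Z l w) ^+ 2) /\
  mean P (fun w => dotc a (Z l w) ^+ 2) = \sum_i a i ^+ 2.
Proof.
have E : (fun w => dotc a (Z l w) ^+ 2) =
    fun w => \sum_i \sum_j a i * a j * (Z l w i ord0 * Z l w j ord0).
  apply/funext => w; rewrite /dotc expr2 mulr_suml; apply: eq_bigr => i _.
  by rewrite mulr_sumr; apply: eq_bigr => j _; ring.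
have iij i j : intg P (fun w => a i * a j * (Z l w i ord0 * Z l w j ord0)).
  by apply: intgZ; exact: (coord_intgM iidZ Z0 covZ).
rewrite E; split.
  by apply: intg_sum => i; apply: intg_sum => j.
rewrite mean_sum; last by move=> i; apply: intg_sum => j.
apply: eq_bigr => i _; rewrite mean_sum//.
rewrite (bigD1 i)//= meanZ; last exact: (coord_intgM iidZ Z0 covZ).
rewrite (coord_mean_prod Z0 covZ) eqxx mulr1 big1 ?addr0// => j ji.
rewrite meanZ; last exact: (coord_intgM iidZ Z0 covZ).
by rewrite (coord_mean_prod Z0 covZ) eq_sym (negbTE ji) mulr0.
Qed.

Lemma coord_intg l i : intg P (fun w => Z l w i ord0).
Proof.
apply: intg_of_sqr; first exact: (iid_random_vector iidZ).
exact: (coord_sqr_intg iidZ Z0 covZ).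
Qed.

Lemma dotc_mean a l : mean P (fun w => dotc a (Z l w)) = 0.
Proof.
rewrite /dotc mean_sum; last by move=> i; apply: intgZ; exact: coord_intg.
rewrite big1// => i _; rewrite meanZ; last exact: coord_intg.
by rewrite (coord_mean Z0) mulr0.
Qed.

(** Lindeberg's truncated second moment; it tends to 0 with rho by dominated convergence, whatever
    the law. *)
Definition lind (rho : R) : R :=
  mean P (fun w => l1norm (Z 0%N w) ^+ 2 * Num.min 1 (rho * l1norm (Z 0%N w))).

Let lind_fun rho (x : R) := x ^+ 2 * Num.min 1 (rho * `|x|).

Let lind_fun_ge0 rho x : 0 <= rho -> 0 <= lind_fun rho x.
Proof. by move=> r0; rewrite mulr_ge0 ?sqr_ge0// le_min ler01 mulr_ge0. Qed.

Let lind_fun_le rho x : lind_fun rho x <= x ^+ 2.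
Proof. by rewrite ler_piMr ?sqr_ge0// ge_min lexx. Qed.

Let measurable_lind_fun rho : measurable_fun setT (lind_fun rho).
Proof.
apply: measurable_funM; first exact: measurable_funX.
by apply: measurable_minr => //; apply: measurable_funM.
Qed.

Let intg_lind_fun rho l : 0 <= rho -> intg P (fun w => lind_fun rho (l1norm (Z l w))).
Proof.
move=> r0; apply: intg_le (l1norm_sqr_intg iidZ Z0 covZ l).
  by apply: (measurableT_comp (measurable_lind_fun rho)); exact: (measurable_l1normZ iidZ).
by move=> w; rewrite ger0_norm ?lind_fun_ge0.
Qed.

Let lindE rho l : 0 <= rho -> mean P (fun w => lind_fun rho (l1norm (Z l w))) = lind rho.
Proof.
move=> r0; rewrite (mean_l1norm_law iidZ l (measurable_lind_fun rho)); last first.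
  by move=> x; exact: lind_fun_ge0.
congr mean; apply/funext => w; rewrite /lind_fun ger0_norm//.
exact: l1norm_ge0.
Qed.

Lemma lind_ge0 rho : 0 <= rho -> 0 <= lind rho.
Proof.
move=> r0; rewrite -(lindE 0 r0); apply: mean_ge0 => w.
exact: lind_fun_ge0.
Qed.

Lemma lind_cvg0 (rho : nat -> R) : (forall m, 0 <= rho m) ->
  rho m @[m --> \oo] --> 0 -> lind (rho m) @[m --> \oo] --> 0.
Proof.
move=> r0 cr; under eq_fun do rewrite -(lindE 0 (r0 _)).
suff : mean P (fun w => lind_fun (rho m) (l1norm (Z 0%N w))) @[m --> \oo] -->
  mean P (cst (0 : R)) by rewrite mean_cst.
apply: (@cvg_mean _ _ _ _ _ _ (fun w => l1norm (Z 0%N w) ^+ 2)).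
- by move=> m; exact: intg_measurable (intg_lind_fun 0 (r0 m)).
- exact: measurable_cst.
- move=> w; set x := l1norm _.
  apply: (@cvg_of_dist_le _ _ (fun m => x ^+ 2 * (rho m * `|x|))).
    move=> m; rewrite subr0 ger0_norm ?lind_fun_ge0// ler_wpM2l ?sqr_ge0//.
    by rewrite ge_min lexx orbT.
  rewrite -(mulr0 (x ^+ 2)) -(mul0r `|x|).
  by apply: cvgM; [exact: cvg_cst|apply: cvgM; [exact: cr|exact: cvg_cst]].
- exact: (l1norm_sqr_intg iidZ Z0 covZ).
- by move=> w m; rewrite ger0_norm ?lind_fun_ge0.
Qed.

(** Each summand is at most rho times the l1 norm of [Z l], so its Taylor remainder has mean at most
    rho^2 times [lind rho]. The factor size * rho^2 is what stays bounded along the arrays used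
    later. *)
Lemma lindeberg_cf (a : nat -> 'I_p -> R) (rho : R) (s : seq nat) : uniq s -> 0 <= rho ->
  (forall l i, `|a l i| <= rho) ->
  `|mean P (fun w => cos (\sum_(l <- s) dotc (a l) (Z l w))) -
    expR (- ((\sum_(l <- s) \sum_i a l i ^+ 2) / 2))| +
  `|mean P (fun w => sin (\sum_(l <- s) dotc (a l) (Z l w)))| <=
  2 * ((size s)%:R * rho ^+ 2) * (2 * lind rho + p%:R ^+ 2 * rho ^+ 2).
Proof.
move=> us r0 ar.
pose v l := \sum_i a l i ^+ 2.
have v0 l : 0 <= v l by apply: sumr_ge0 => i _; rewrite sqr_ge0.
have v1 l : v l <= p%:R * rho ^+ 2.
  rewrite mulr_natl -[X in _ *+ X]card_ord -sumr_const; apply: ler_sum => i _.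
  by rewrite -[a l i ^+ 2]real_normK ?num_real// lerXn2r ?nnegrE.
have -> : expR (- ((\sum_(l <- s) \sum_i a l i ^+ 2) / 2)) =
    \prod_(l <- s) expR (- (v l / 2)).
  by rewrite -expR_sum sumrN mulr_suml.
have step l : `|mean P (fun w => cos (dotc (a l) (Z l w))) - expR (- (v l / 2))| +
    `|mean P (fun w => sin (dotc (a l) (Z l w)))| <=
    rho ^+ 2 * (2 * lind rho + p%:R ^+ 2 * rho ^+ 2).
  have [i2 e2] := dotc_sqr (a l) l.
  have := @cf_taylor _ _ _ P (fun w => dotc (a l) (Z l w))
    (fun w => rho ^+ 2 * lind_fun rho (l1norm (Z l w))) (measurable_dotcZ _ _) i2 (dotc_mean _ _).
  rewrite e2 meanZ ?lindE//; last exact: intg_lind_fun.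
  move=> h; apply: (le_trans (h _ _)).
  - by apply: intgZ; exact: intg_lind_fun.
  - move=> w; have dl : `|dotc (a l) (Z l w)| <= rho * l1norm (Z l w).
      rewrite /dotc /l1norm mulr_sumr; apply: (le_trans (ler_norm_sum _ _ _)).
      by apply: ler_sum => i _; rewrite normrM ler_wpM2r.
    rewrite /trunc_sqr /lind_fun mulrA -exprMn (ger0_norm (l1norm_ge0 _)).
    rewrite -[dotc _ _ ^+ 2]real_normK ?num_real//; apply: ler_pM.
    + by rewrite exprn_ge0.
    + by rewrite le_min ler01 normr_ge0.
    + by rewrite lerXn2r ?nnegrE ?mulr_ge0 ?l1norm_ge0.
    + by rewrite le_min !ge_min lexx/= dl orbT.
  - have h2 : (v l) ^+ 2 <= p%:R ^+ 2 * rho ^+ 2 * rho ^+ 2.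
      have -> : p%:R ^+ 2 * rho ^+ 2 * rho ^+ 2 = (p%:R * rho ^+ 2) ^+ 2 by ring.
      by rewrite lerXn2r ?nnegrE// mulr_ge0 ?exprn_ge0.
    rewrite -/(v l); have -> : rho ^+ 2 * (2 * lind rho + p%:R ^+ 2 * rho ^+ 2) =
      2 * (rho ^+ 2 * lind rho) + p%:R ^+ 2 * rho ^+ 2 * rho ^+ 2 by ring.
    by rewrite lerD2l.
have := @cf_sum _ _ _ P _ (fun l => vec_sigma (Z l)) (fun l w => dotc (a l) (Z l w))
  (fun l => expR (- (v l / 2))) (s) (iid_mutually_independent iidZ).
move=> h; apply: (le_trans (h _ _ _ _ _ _)) => {h}.
- by move=> l; apply: vec_sigma_measurable; exact: (iid_random_vector iidZ).
- by move=> l; exact: vec_sigma_setI.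
- by move=> l; exact: vec_sigmaT.
- exact: us.
- by move=> l; exact: (measurable_vec_sigma (measurable_dotc (a l))).
- by move=> l; rewrite expR_ge0 expR_le1 oppr_le0 divr_ge0.
- rewrite -mulrA ler_wpM2l//.
  apply: (@le_trans _ _ (\sum_(l <- s) rho ^+ 2 * (2 * lind rho + p%:R ^+ 2 * rho ^+ 2))).
    exact: ler_sum.
  by rewrite big_const_seq count_predT iter_addr_0 -[leLHS]mulr_natl mulrA.
Qed.

Lemma lindeberg_cf_cvg (a : nat -> nat -> 'I_p -> R) (rho : nat -> R) (s : nat -> seq nat) (K V : R) :
  (forall m, uniq (s m)) ->
  (forall m, 0 <= rho m) -> (forall m l i, `|a m l i| <= rho m) ->
  (forall m, (size (s m))%:R * rho m ^+ 2 <= K) -> rho m @[m --> \oo] --> 0 ->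
  \sum_(l <- s m) \sum_i a m l i ^+ 2 @[m --> \oo] --> V ->
  mean P (fun w => cos (\sum_(l <- s m) dotc (a m l) (Z l w))) @[m --> \oo]
    --> expR (- (V / 2)) /\
  mean P (fun w => sin (\sum_(l <- s m) dotc (a m l) (Z l w))) @[m --> \oo]
    --> 0.
Proof.
move=> us r0 ar NK cr cV.
pose e m := 2 * K * (2 * lind (rho m) + p%:R ^+ 2 * rho m ^+ 2).
have ce : e m @[m --> \oo] --> 0.
  rewrite -(mulr0 (2 * K)); apply: cvgM; first exact: cvg_cst.
  rewrite -(addr0 0); apply: cvgD.
    by rewrite -(mulr0 2); apply: cvgM; [exact: cvg_cst|exact: lind_cvg0].
  rewrite -(mulr0 (p%:R ^+ 2)); apply: cvgM; first exact: cvg_cst.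
  by rewrite -(mulr0 0); apply: cvgM.
have he m := lindeberg_cf (us m) (r0 m) (ar m).
have hle m : 2 * ((size (s m))%:R * rho m ^+ 2) * (2 * lind (rho m) + p%:R ^+ 2 * rho m ^+ 2) <= e m.
  apply: ler_wpM2r; last by rewrite ler_wpM2l.
  by rewrite addr_ge0// mulr_ge0 ?lind_ge0 ?exprn_ge0.
split; last first.
  apply: cvg_of_dist_le ce => m; rewrite subr0.
  by apply: le_trans (hle m); apply: le_trans (he m); rewrite lerDr.
set E := fun m => expR (- ((\sum_(l <- s m) \sum_i a m l i ^+ 2) / 2)).
have cE : E m @[m --> \oo] --> expR (- (V / 2)).
  apply: (cvg_comp _ expR); last exact: continuous_expR.
  by apply: cvgN; apply: cvgM => //; exact: cvg_cst.
have cD : mean P (fun w => cos (\sum_(l <- s m) dotc (a m l) (Z l w))) - E m @[m --> \oo] --> 0.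
  apply: cvg_of_dist_le ce => m; rewrite subr0.
  by apply: le_trans (hle m); apply: le_trans (he m); rewrite lerDl.
rewrite -[X in _ --> X]add0r.
rewrite (_ : (fun m => _) = (fun m => (mean P (fun w =>
   cos (\sum_(l <- s m) dotc (a m l) (Z l w))) - E m) + E m)).
  exact: cvgD.
by apply/funext => m; rewrite subrK.
Qed.

End lindeberg.

(** * Brownian motion *)


Section brownian_characteristic_function.
Context d (T : measurableType d) (R : realType) (P : probability T R).
Variable B : R -> T -> R.
Hypothesis bmB : standard_brownian_motion P B.

Lemma bm_measurable t : 0 <= t -> measurable_fun setT (B t).
Proof. by case: bmB => + _ _ _ _; exact. Qed.

Let mincr s t : 0 <= s -> s <= t -> measurable_fun setT (fun w => B t w - B s w).
Proof.
move=> s0 st; apply: measurable_funB; apply: bm_measurable => //.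
exact: le_trans st.
Qed.

Let law s t : 0 <= s -> s < t -> forall A : set R, measurable A ->
  P ((fun w => B t w - B s w) @^-1` A) = normal_prob 0 (Num.sqrt (t - s)) A.
Proof. by case: bmB => _ _ _ + _ s0 st A mA; exact. Qed.

Lemma bm_increment_sqr s t : 0 <= s -> s < t ->
  intg P (fun w => (B t w - B s w) ^+ 2) /\
  mean P (fun w => (B t w - B s w) ^+ 2) = t - s.
Proof.
move=> s0 st; have sd : 0 < Num.sqrt (t - s) by rewrite sqrtr_gt0 subr_gt0.
have [i e] := gaussian_sqr (mincr s0 (ltW st)) sd (law s0 st).
by rewrite e sqr_sqrtr// subr_ge0 ltW.
Qed.

Lemma bm_increment_tail s t (c : R) : 0 <= s -> s < t -> 0 < c ->
  pr P [set w | c <= `|B t w - B s w|] <= 512 * expR 2 * (t - s) ^+ 2 / c ^+ 4.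
Proof.
move=> s0 st c0; have sd : 0 < Num.sqrt (t - s) by rewrite sqrtr_gt0 subr_gt0.
have := gaussian_tail (mincr s0 (ltW st)) sd (law s0 st) c0.
have -> : Num.sqrt (t - s) ^+ 4 = (t - s) ^+ 2; last by [].
by rewrite (exprM _ 2 2) sqr_sqrtr// subr_ge0 ltW.
Qed.

(** [cf_taylor] with the cubic bound on [trunc_sqr]; 108 is twice the 54 of [gaussian_cube]. *)
Let cf_step v s t : 0 <= s -> s < t ->
  `|mean P (fun w => cos (v * (B t w - B s w))) - expR (- (v ^+ 2 * (t - s) / 2))| +
  `|mean P (fun w => sin (v * (B t w - B s w)))| <=
  108 * expR 2 * (`|v| * Num.sqrt (t - s)) ^+ 3 + (v * Num.sqrt (t - s)) ^+ 4.
Proof.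
move=> s0 st; have sd : 0 < Num.sqrt (t - s) by rewrite sqrtr_gt0 subr_gt0.
have mX := mincr s0 (ltW st).
have [i2 e2] := gaussian_sqr mX sd (law s0 st).
have [i3 e3] := gaussian_cube mX sd (law s0 st).
have i2' : intg P (fun w => (v * (B t w - B s w)) ^+ 2).
  by under eq_fun do rewrite exprMn; exact: intgZ.
have e2' : mean P (fun w => (v * (B t w - B s w)) ^+ 2) = v ^+ 2 * (t - s).
  under eq_fun do rewrite exprMn.
  by rewrite meanZ// e2 sqr_sqrtr// subr_ge0 ltW.
have := @cf_taylor _ _ _ P (fun w => v * (B t w - B s w))
  (fun w => `|v| ^+ 3 * `|B t w - B s w| ^+ 3) _ i2' _ _ _.
rewrite e2' (meanZ (`|v| ^+ 3) i3) => h; apply: (le_trans (h _ _ _ _)).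
- exact: measurable_funM.
- by rewrite meanZ ?(gaussian_mean mX sd (law s0 st)) ?mulr0//; exact: gaussian_intg sd (law s0 st).
- exact: intgZ.
- by move=> w; rewrite -exprMn -normrM; exact: trunc_sqr_le_cube.
- apply: lerD.
    rewrite exprMn; have -> : 108 * expR 2 * (`|v| ^+ 3 * Num.sqrt (t - s) ^+ 3) =
      2 * (`|v| ^+ 3 * (54 * expR 2 * Num.sqrt (t - s) ^+ 3)) by ring.
    by rewrite ler_wpM2l// ler_wpM2l// exprn_ge0.
  have -> : v ^+ 2 * (t - s) = (v * Num.sqrt (t - s)) ^+ 2.
    by rewrite exprMn sqr_sqrtr// subr_ge0 ltW.
  by rewrite -exprM.
Qed.

Definition incr_sigma (r : nat -> R) (k : nat) :=
  preimage_set_system setT (B (r k.+1) \- B (r k)) measurable.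

Lemma incr_sigmaP (r : nat -> R) : 0 <= r 0%N -> nondecreasing_seq r ->
  [/\ mutually_independent P (incr_sigma r),
      forall k, incr_sigma r k `<=` @measurable d T,
      forall k, setI_closed (incr_sigma r k),
      forall k, incr_sigma r k setT &
      forall k v, measurable_fun setT
        ((fun w => v * (B (r k.+1) w - B (r k) w)) : g_sigma_algebraType (incr_sigma r k) -> R)].
Proof.
move=> r0 ndr.
have rk0 k : 0 <= r k by apply: (le_trans r0); exact: ndr.
have sG k : sigma_algebra setT (incr_sigma r k).
  by apply: sigma_algebra_preimage; exact: sigma_algebra_measurable.
split.
- by case: bmB => _ _ + _ _; exact.
- move=> k _ [A mA <-]; apply: (mincr (rk0 k) _) => //; exact: ndr.
- by move=> k; exact: sigma_algebra_setI.
- by move=> k; exact: sigma_algebra_setT.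
- move=> k v; apply: measurable_funM => //.
  exact: preimage_set_system_measurable_fun.
Qed.

(* Splitting the increment into [n] independent ones with [n] large makes the cubic error terms of their cf negligible. *)
Lemma bm_increment_cf v s t : 0 <= s -> s <= t ->
  mean P (fun w => cos (v * (B t w - B s w))) = expR (- (v ^+ 2 * (t - s) / 2)) /\
  mean P (fun w => sin (v * (B t w - B s w))) = 0.
Proof.
move=> s0; rewrite le_eqVlt => /predU1P[<-|st].
  have -> : (fun w => cos (v * (B s w - B s w))) = cst 1.
    by apply/funext => w; rewrite subrr mulr0 cos0.
  have -> : (fun w => sin (v * (B s w - B s w))) = cst 0.
    by apply/funext => w; rewrite subrr mulr0 sin0.
  by rewrite !mean_cst subrr mulr0 mul0r oppr0 expR0.
pose sd := Num.sqrt (t - s).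
have sd0 : 0 <= sd by exact: sqrtr_ge0.
pose c := 2 * (108 * expR 2 * (`|v| * sd) ^+ 3 + (v * sd) ^+ 4).
have key j : `|mean P (fun w => cos (v * (B t w - B s w))) - expR (- (v ^+ 2 * (t - s) / 2))| +
    `|mean P (fun w => sin (v * (B t w - B s w)))| <= c / j.+1%:R.
  pose q : R := j.+1%:R; have q0 : 0 < q by rewrite ltr0n.
  (* With q^2 pieces each error is of order q^-3, so the total is of order 1 / q, the rate asked for
     by [eq_of_norm_le_inv]. *)
  pose n := (j.+1 ^ 2)%N; have nq : n%:R = q ^+ 2 by rewrite natrX.
  have n0 : 0 < n%:R :> R by rewrite nq exprn_gt0.
  pose h := (t - s) / n%:R.
  have h0 : 0 < h by rewrite divr_gt0// subr_gt0.
  (* The minimum stops the partition at t, which makes it a nondecreasing sequence on all of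
     [nat]. *)
  pose r k := s + (minn k n)%:R * h.
  have ndr : nondecreasing_seq r.
    move=> k l kl; rewrite lerD2l ler_wpM2r ?(ltW h0)// ler_nat leq_min geq_minr andbT.
    exact: leq_trans (geq_minl _ _) kl.
  have r0 : 0 <= r 0%N by rewrite /r min0n mul0r addr0.
  have rk0 k : 0 <= r k by apply: (le_trans r0); exact: ndr.
  have [ind Fm FI FT mX] := incr_sigmaP r0 ndr.
  have tel w : \sum_(k <- iota 0 n) v * (B (r k.+1) w - B (r k) w) = v * (B t w - B s w).
    rewrite -mulr_sumr; congr (_ * _).
    have -> : iota 0 n = index_iota 0 n by rewrite /index_iota subn0.
    rewrite (telescope_sumr (fun k => B (r k) w))//.
    by rewrite /r minnn min0n mul0r addr0 /h mulrC divfK ?gt_eqF// subrKC.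
  have b01 (k : nat) : 0 <= expR (- (v ^+ 2 * h / 2)) <= 1.
    rewrite expR_ge0 expR_le1 oppr_le0 divr_ge0// mulr_ge0 ?sqr_ge0//; exact: ltW.
  have := cf_sum ind Fm FI FT (iota_uniq 0 n) (fun k => mX k v) b01.
  under eq_fun do rewrite tel; under [X in _ + `|mean _ X|]eq_fun do rewrite tel.
  have -> : \prod_(k <- iota 0 n) expR (- (v ^+ 2 * h / 2)) = expR (- (v ^+ 2 * (t - s) / 2)).
    rewrite -expR_sum big_const_seq count_predT size_iota iter_addr_0 -[X in expR X = _]mulr_natl.
    by congr expR; rewrite /h; field; rewrite gt_eqF.
  move=> hs; apply: (le_trans hs).
  have step k : (k < n)%N ->
     `|mean P (fun w => cos (v * (B (r k.+1) w - B (r k) w))) - expR (- (v ^+ 2 * h / 2))| +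
     `|mean P (fun w => sin (v * (B (r k.+1) w - B (r k) w)))| <= (c / 2) / q ^+ 3.
    move=> kn; have rr : r k.+1 - r k = h.
      by rewrite /r (minn_idPl kn) (minn_idPl (ltnW kn)) -natr1; ring.
    have := @cf_step v (r k) (r k.+1) (rk0 k); rewrite rr => hk.
    apply: (le_trans (hk _)); first by rewrite -subr_gt0 rr.
    have -> : Num.sqrt h = sd / q.
      rewrite /h nq sqrtrM ?subr_ge0 ?(ltW st)// sqrtrV ?exprn_ge0 ?(ltW q0)//.
      by rewrite sqrtr_sqr gtr0_norm.
    have -> : 108 * expR 2 * (`|v| * (sd / q)) ^+ 3 =
      108 * expR 2 * (`|v| * sd) ^+ 3 / q ^+ 3 by field; rewrite gt_eqF.
    have -> : (v * (sd / q)) ^+ 4 = (v * sd) ^+ 4 * q^-1 ^+ 4 by ring.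
    rewrite /c.
    have -> : 2 * (108 * expR 2 * (`|v| * sd) ^+ 3 + (v * sd) ^+ 4) / 2 / q ^+ 3 =
       108 * expR 2 * (`|v| * sd) ^+ 3 / q ^+ 3 + (v * sd) ^+ 4 / q ^+ 3 by field; rewrite gt_eqF.
    rewrite lerD2l -(exprVn q 3) ler_wpM2l ?exprn_even_ge0//.
    by rewrite ler_wiXn2l// ?invr_ge0 ?(ltW q0)// invf_le1// ler1n.
  apply: (@le_trans _ _ (2 * \sum_(k <- iota 0 n) (c / 2) / q ^+ 3)).
    rewrite ler_wpM2l// big_seq [leRHS]big_seq; apply: ler_sum => k.
    by rewrite mem_iota add0n => kn; exact: step.
  rewrite big_const_seq count_predT size_iota iter_addr_0 -[X in 2 * X]mulr_natl nq -/q.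
  by rewrite le_eqVlt; apply/orP; left; apply/eqP; field; rewrite gt_eqF.
split.
  apply: eq_of_norm_le_inv => j; apply: le_trans (key j).
  by rewrite lerDl.
by apply: eq_of_norm_le_inv => j; rewrite subr0; apply: le_trans (key j); rewrite lerDr.
Qed.

(** With the exact characteristic functions of the increments as comparison values, the error bound
    of [cf_sum] is 0. *)
Lemma bm_lincomb_cf (r c : nat -> R) K : 0 <= r 0%N -> nondecreasing_seq r ->
  mean P (fun w => cos (\sum_(k <- iota 0 K) c k * (B (r k.+1) w - B (r k) w))) =
    expR (- ((\sum_(k <- iota 0 K) c k ^+ 2 * (r k.+1 - r k)) / 2)) /\
  mean P (fun w => sin (\sum_(k <- iota 0 K) c k * (B (r k.+1) w - B (r k) w))) = 0.
Proof.
move=> r0 ndr; have rk0 k : 0 <= r k by apply: (le_trans r0); exact: ndr.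
have [ind Fm FI FT mX] := incr_sigmaP r0 ndr.
have b01 k : 0 <= expR (- (c k ^+ 2 * (r k.+1 - r k) / 2)) <= 1.
  rewrite expR_ge0 expR_le1 oppr_le0 divr_ge0// mulr_ge0 ?sqr_ge0// subr_ge0.
  exact: ndr.
have := cf_sum ind Fm FI FT (iota_uniq 0 K) (fun k => mX k (c k)) b01.
rewrite [X in _ <= X](_ : _ = 0); last first.
  rewrite big1 ?mulr0// => k _.
  have [-> ->] := @bm_increment_cf (c k) (r k) (r k.+1) (rk0 k) (ndr _ _ (leqnSn k)).
  by rewrite subrr normr0 addr0.
rewrite -expR_sum sumrN -mulr_suml => h.
have h1 : `|mean P (fun w => cos (\sum_(k <- iota 0 K) c k * (B (r k.+1) w - B (r k) w))) -
    expR (- ((\sum_(k <- iota 0 K) c k ^+ 2 * (r k.+1 - r k)) / 2))| <= 0.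
  by apply: le_trans h; rewrite lerDl.
have h2 : `|mean P (fun w => sin (\sum_(k <- iota 0 K) c k * (B (r k.+1) w - B (r k) w)))| <= 0.
  by apply: le_trans h; rewrite lerDr.
by move: h1 h2; rewrite !normr_le0 subr_eq0 => /eqP -> /eqP ->.
Qed.

Definition path_gen := \bigcup_(t in [set t : R | 0 <= t]) preimage_set_system setT (B t) measurable.

Lemma measurable_path t : 0 <= t ->
  measurable_fun setT (B t : g_sigma_algebraType <<s path_gen >> -> R).
Proof.
move=> t0 mD A mA; apply: sub_sigma_algebra; apply: sub_sigma_algebra.
by exists t => //; exists A.
Qed.

Lemma path_gen_measurable : path_gen `<=` @measurable d T.
Proof. by move=> X [t /= t0 [A mA <-]]; exact: bm_measurable. Qed.

End brownian_characteristic_function.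


(** * Summation by parts *)

Section summation.
Context {R : realType}.

Lemma big_iota_ord (K : nat) (F : nat -> R) : \sum_(l <- iota 0 K) F l = \sum_(l < K) F l.
Proof. by rewrite -(big_mkord xpredT) /index_iota subn0. Qed.

Lemma telescope_le (x : nat -> R) m K : (m < K)%N ->
  \sum_(l < K) (l <= m)%:R * (x l.+1 - x l) = x m.+1 - x 0%N.
Proof.
move=> mK; rewrite -(big_mkord xpredT (fun l => (l <= m)%:R * (x l.+1 - x l))).
rewrite (big_cat_nat (n := m.+1))//= [X in _ + X]big_nat_cond [X in _ + X]big1 ?addr0; last first.
  by move=> l /andP[/andP[ml _] _]; rewrite leqNgt ml mul0r.
rewrite -(telescope_sumr x (leq0n m.+1)) big_nat_cond [RHS]big_nat_cond.
by apply: eq_bigr => l /andP[/andP[_ lm] _]; rewrite -ltnS lm mul1r.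
Qed.

(** The weight of the l-th increment in a combination of values: the increment is contained in every
    value of index k >= l. *)
Definition tail_coef (K : nat) (u : 'I_K -> R) (l : nat) : R :=
  \sum_(k < K) (l <= k)%:R * u k.

Lemma abel_sum (K : nat) (u : 'I_K -> R) (x : nat -> R) : x 0%N = 0 ->
  \sum_(k < K) u k * x k.+1 = \sum_(l < K) tail_coef u l * (x l.+1 - x l).
Proof.
move=> x0; under [RHS]eq_bigr do rewrite mulr_suml.
rewrite exchange_big/=; apply: eq_bigr => k _.
have -> : x k.+1 = \sum_(l < K) (l <= k)%:R * (x l.+1 - x l).
  by rewrite (telescope_le x (ltn_ord k)) x0 subr0.
rewrite mulr_sumr; by apply: eq_bigr => l _; ring.
Qed.

(** For times x this is the variance of a combination of Brownian values, on the left through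
    independent increments and on the right through the covariance min(s, t). *)
Lemma abel_sum_sqr (K : nat) (u : 'I_K -> R) (x : nat -> R) : x 0%N = 0 ->
  \sum_(l < K) tail_coef u l ^+ 2 * (x l.+1 - x l) =
  \sum_(k < K) \sum_(k' < K) u k * u k' * x (minn k k').+1.
Proof.
move=> x0.
transitivity (\sum_(l < K) \sum_(k < K) \sum_(k' < K)
    u k * u k' * ((l <= minn k k')%:R * (x l.+1 - x l))).
  apply: eq_bigr => l _; rewrite expr2 mulr_suml mulr_suml; apply: eq_bigr => k _.
  rewrite mulr_sumr mulr_suml; apply: eq_bigr => k' _.
  by rewrite leq_min -mulnb natrM; ring.
rewrite exchange_big/=; apply: eq_bigr => k _.
rewrite exchange_big/=; apply: eq_bigr => k' _.
rewrite -mulr_sumr telescope_le ?x0 ?subr0//.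
exact: leq_ltn_trans (geq_minl _ _) _.
Qed.

End summation.

Section brownian_vector_characteristic_function.
Context d (T : measurableType d) (R : realType) (P : probability T R) (p : nat).
Variable W : R -> T -> 'cV[R]_p.
Hypothesis bvW : brownian_vector P W.

Let Wc (j : 'I_p) t w : R := W t w j ord0.

Let bmW j : standard_brownian_motion P (Wc j).
Proof. by case: bvW => + _; exact. Qed.

Lemma bv_measurable t j : 0 <= t -> measurable_fun setT (fun w => W t w j ord0).
Proof. exact: (bm_measurable (bmW j)). Qed.

Lemma mean_ae_eq (f g : T -> R) : measurable_fun setT f -> measurable_fun setT g ->
  (\forall w \ae P, f w = g w) -> mean P f = mean P g.
Proof.
move=> mf mg fg; congr fine; apply: ae_eq_integral => //.
- exact/measurable_EFinP.
- exact/measurable_EFinP.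
- by apply: filterS fg => w fgw _; rewrite fgw.
Qed.

Lemma bv0 : \forall w \ae P, forall j, W 0 w j ord0 = 0.
Proof. by apply: filter_forall => j; case: (bmW j). Qed.

Lemma bv_incr_cf (r : nat -> R) K (c : nat -> 'I_p -> R) : 0 <= r 0%N -> nondecreasing_seq r ->
  mean P (fun w => cos (\sum_(j <- index_enum 'I_p)
      \sum_(k <- iota 0 K) c k j * (Wc j (r k.+1) w - Wc j (r k) w))) =
    expR (- ((\sum_(j <- index_enum 'I_p) \sum_(k <- iota 0 K) c k j ^+ 2 * (r k.+1 - r k)) / 2)) /\
  mean P (fun w => sin (\sum_(j <- index_enum 'I_p)
      \sum_(k <- iota 0 K) c k j * (Wc j (r k.+1) w - Wc j (r k) w))) = 0.
Proof.
move=> r0 ndr; pose Y w := \sum_(j <- index_enum 'I_p)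
  \sum_(k <- iota 0 K) c k j * (Wc j (r k.+1) w - Wc j (r k) w).
have rk0 k : 0 <= r k by apply: (le_trans r0); exact: ndr.
have [_ ind] := bvW.
pose Yj j w := \sum_(k <- iota 0 K) c k j * (Wc j (r k.+1) w - Wc j (r k) w).
pose b j := expR (- ((\sum_(k <- iota 0 K) c k j ^+ 2 * (r k.+1 - r k)) / 2)).
have b01 j : 0 <= b j <= 1.
  rewrite expR_ge0 expR_le1 oppr_le0 divr_ge0// sumr_ge0// => k _.
  by rewrite mulr_ge0 ?sqr_ge0// subr_ge0; exact: ndr.
have := @cf_sum _ _ _ P _ (fun j => <<s path_gen (Wc j) >>) Yj b (index_enum 'I_p) ind.
have -> : \prod_(j <- index_enum 'I_p) b j = expR (- ((\sum_(j <- index_enum 'I_p)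
    \sum_(k <- iota 0 K) c k j ^+ 2 * (r k.+1 - r k)) / 2)).
  by rewrite /b -expR_sum sumrN -mulr_suml.
rewrite [X in _ <= X](_ : _ = 0); last first.
  rewrite big1 ?mulr0// => j _.
  have [-> ->] := @bm_lincomb_cf _ _ _ _ _ (bmW j) r (c ^~ j) K r0 ndr.
  by rewrite subrr normr0 addr0.
move=> h.
have {}h : `|mean P (fun w => cos (Y w)) - expR (- ((\sum_(j <- index_enum 'I_p)
    \sum_(k <- iota 0 K) c k j ^+ 2 * (r k.+1 - r k)) / 2))| +
    `|mean P (fun w => sin (Y w))| <= 0.
  apply: h => //.
  - move=> j; apply: g_sigma_measurable; exact: (path_gen_measurable (bmW j)).
  - by move=> j; apply: sigma_algebra_setI; exact: smallest_sigma_algebra.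
  - by move=> j; apply: sigma_algebra_setT; exact: smallest_sigma_algebra.
  - exact: index_enum_uniq.
  - move=> j; apply: measurable_sum => k; apply: measurable_funM => //.
    by apply: measurable_funB; exact: measurable_path.
have h1 : `|mean P (fun w => cos (Y w)) - expR (- ((\sum_(j <- index_enum 'I_p)
    \sum_(k <- iota 0 K) c k j ^+ 2 * (r k.+1 - r k)) / 2))| <= 0.
  by apply: le_trans h; rewrite lerDl.
have h2 : `|mean P (fun w => sin (Y w))| <= 0.
  by apply: le_trans h; rewrite lerDr.
by move: h1 h2; rewrite !normr_le0 subr_eq0 => /eqP -> /eqP ->.
Qed.

Lemma bv_cf (r : nat -> R) K (u : 'I_K * 'I_p -> R) : r 0%N = 0 -> nondecreasing_seq r ->
  mean P (fun w => cos (\sum_i u i * W (r i.1.+1) w i.2 ord0)) =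
    expR (- ((\sum_j \sum_(k < K) \sum_(k' < K)
      u (k, j) * u (k', j) * r (minn k k').+1) / 2)) /\
  mean P (fun w => sin (\sum_i u i * W (r i.1.+1) w i.2 ord0)) = 0.
Proof.
move=> r0 ndr; have rk0 k : 0 <= r k by rewrite -r0; exact: ndr.
pose c l j := tail_coef (fun k => u (k, j)) l.
have r00 : 0 <= r 0%N by rewrite r0.
pose Y w := \sum_(j <- index_enum 'I_p) \sum_(k <- iota 0 K) c k j * (Wc j (r k.+1) w - Wc j (r k) w).
have [eC eS] := @bv_incr_cf r K c r00 ndr.
(* Summation by parts needs the value 0 at time 0, which holds only almost surely. *)
have aeY : \forall w \ae P, \sum_i u i * W (r i.1.+1) w i.2 ord0 = Y w.
  apply: filterS bv0 => w W0.
  transitivity (\sum_k \sum_j u (k, j) * W (r (nat_of_ord k).+1) w j ord0).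
    by rewrite pair_bigA; apply: eq_bigr => -[k j].
  rewrite /Y exchange_big/=.
  apply: eq_bigr => j _; rewrite big_iota_ord.
  rewrite (@abel_sum _ K (fun k => u (k, j)) (fun k => W (r k) w j ord0))//.
  by rewrite r0.
have mX : measurable_fun setT (fun w => \sum_i u i * W (r i.1.+1) w i.2 ord0).
  by apply: measurable_sum => i; apply: measurable_funM => //; exact: bv_measurable.
have mY : measurable_fun setT Y.
  apply: measurable_sum => j; apply: measurable_sum => k; apply: measurable_funM => //.
  by apply: measurable_funB; exact: bv_measurable.
rewrite (@mean_ae_eq (fun w => cos (\sum_i u i * W (r i.1.+1) w i.2 ord0)) (fun w => cos (Y w))); last 3 first.
- exact: measurable_cosR.
- exact: measurable_cosR.
- by apply: filterS aeY => w ->.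
rewrite (@mean_ae_eq (fun w => sin (\sum_i u i * W (r i.1.+1) w i.2 ord0)) (fun w => sin (Y w))); last 3 first.
- exact: measurable_sinR.
- exact: measurable_sinR.
- by apply: filterS aeY => w ->.
rewrite eC eS; split => //; congr (expR (- (_ / 2))).
apply: eq_bigr => j _; rewrite big_iota_ord.
exact: (@abel_sum_sqr _ K (fun k => u (k, j)) r).
Qed.

Lemma bv_sqr t j : 0 <= t -> intg P (fun w => W t w j ord0 ^+ 2) /\
  mean P (fun w => W t w j ord0 ^+ 2) = t.
Proof.
move=> t0; have aeW : \forall w \ae P, W t w j ord0 = W t w j ord0 - W 0 w j ord0.
  by apply: filterS bv0 => w ->; rewrite subr0.
have mW := bv_measurable j t0; have mW0 := bv_measurable j (lexx 0).
have mD : measurable_fun setT (fun w => W t w j ord0 - W 0 w j ord0) by exact: measurable_funB.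
have [iD eD] : intg P (fun w => (W t w j ord0 - W 0 w j ord0) ^+ 2) /\
    mean P (fun w => (W t w j ord0 - W 0 w j ord0) ^+ 2) = t.
  move: t0; rewrite le_eqVlt => /predU1P[<-|t0].
    have -> : (fun w => (W 0 w j ord0 - W 0 w j ord0) ^+ 2) = cst 0.
      by apply/funext => w; rewrite subrr expr0n.
    by split; [exact: intg_cst|rewrite mean_cst].
  by have [i e] := bm_increment_sqr (bmW j) (lexx 0) t0; split => //; rewrite e subr0.
split; last first.
  rewrite -[RHS]eD; apply: mean_ae_eq; [exact: measurable_funX|exact: measurable_funX|].
  by apply: filterS aeW => w h; rewrite -h.
apply/integrableP; split; first by apply/measurable_EFinP; exact: measurable_funX.
move/integrableP : iD => [_]; apply: le_lt_trans.
apply: ae_ge0_le_integral => //.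
- by apply: measurableT_comp => //; apply/measurable_EFinP; exact: measurable_funX.
- by apply: measurableT_comp => //; apply/measurable_EFinP; exact: measurable_funX.
- by apply: filterS aeW => w h _ /=; rewrite {1}h.
Qed.

Lemma bv_increment_tail s t j (c : R) : 0 <= s -> s < t -> 0 < c ->
  pr P [set w | c <= `|W t w j ord0 - W s w j ord0|] <= 512 * expR 2 * (t - s) ^+ 2 / c ^+ 4.
Proof. exact: (bm_increment_tail (bmW j)). Qed.

End brownian_vector_characteristic_function.

(** * Partial sums *)


Lemma big_iota_widen (R : realType) (n N : nat) (F : nat -> R) : (n <= N)%N ->
  \sum_(l <- iota 0 n) F l = \sum_(l <- iota 0 N) (l < n)%:R * F l.
Proof.
move=> nN; have iE k : iota 0 k = index_iota 0 k by rewrite /index_iota subn0.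
rewrite !iE (big_cat_nat (n := n) (p := N))//= [X in _ + X]big_nat_cond.
rewrite [X in _ + X]big1 ?addr0; last first.
  by move=> l /andP[/andP[nl _] _]; rewrite ltnNge nl mul0r.
rewrite big_nat_cond [RHS]big_nat_cond; apply: eq_bigr => l /andP[/andP[_ ln] _].
by rewrite ln mul1r.
Qed.

Lemma sum_iota_indicators (R : realType) (n n' N : nat) : (n <= N)%N -> (n' <= N)%N ->
  \sum_(l <- iota 0 N) (l < n)%:R * (l < n')%:R = (minn n n')%:R :> R.
Proof.
move=> nN n'N; have mN : (minn n n' <= N)%N by rewrite geq_min nN.
transitivity (\sum_(l <- iota 0 (minn n n')) (1 : R)).
  rewrite (big_iota_widen _ mN); apply: eq_bigr => l _.
  by rewrite mulr1 leq_min -mulnb natrM.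
by rewrite big_const_seq count_predT size_iota iter_addr_0.
Qed.

Lemma sqrt_inv_cvg (R : realType) : (Num.sqrt m%:R)^-1 @[m --> \oo] --> (0 : R).
Proof.
apply/cvgrPdist_le => e e0; exists (Num.bound (e ^- 2)).+1 => // m /= bm.
have m0 : (0 < m)%N by exact: leq_trans bm.
rewrite sub0r normrN ger0_norm ?invr_ge0 ?sqrtr_ge0//.
rewrite invf_ple ?posrE ?sqrtr_gt0 ?ltr0n// -(ger0_norm (ltW (_ : 0 < e^-1))) ?invr_gt0//.
rewrite -sqrtr_sqr ler_wsqrtr// exprVn.
apply: (le_trans (ltW (archi_boundP _))); first by rewrite invr_ge0 exprn_ge0// ltW.
by rewrite ler_nat ltnW.
Qed.

Section partial_sums.
Context d (T : measurableType d) (R : realType) (P : probability T R) (p : nat).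
Variable Z : nat -> T -> 'cV[R]_p.
Hypotheses (iidZ : iid_vectors P Z) (Z0 : forall i, mean_zero P (Z i)).
Hypothesis covZ : forall i, identity_covariance P (Z i).

(** Indexed by a list, so that the same lemmas serve the sums S_n and the blocks [iota n0 k]; real
    functions on coordinates fit the weak convergence lemmas. *)
Definition psum (s : seq nat) (w : T) (j : 'I_p) : R := \sum_(l <- s) Z l w j ord0.

Lemma measurable_psum s j : measurable_fun setT (fun w => psum s w j).
Proof. by apply: measurable_sum => l; exact: (iid_random_vector iidZ). Qed.

Lemma psum_sqr s j : uniq s -> intg P (fun w => psum s w j ^+ 2) /\
  mean P (fun w => psum s w j ^+ 2) = (size s)%:R.
Proof.
move=> us; have [] := @mean_sqr_sum _ _ _ P _ (fun l => vec_sigma (Z l))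
    (fun l w => Z l w j ord0) s (iid_mutually_independent iidZ) _ _ _ us _ _ _.
- by move=> l; apply: vec_sigma_measurable; exact: (iid_random_vector iidZ).
- by move=> l; exact: vec_sigma_setI.
- by move=> l; exact: vec_sigmaT.
- move=> l; exact: (measurable_vec_sigma (measurable_coord j)).
- by move=> l; exact: (coord_sqr_intg iidZ Z0 covZ).
- by move=> l; exact: (coord_mean Z0).
move=> i e; split => //; rewrite e -sum1_size natr_sum; apply: eq_bigr => l _.
under eq_fun do rewrite expr2.
by rewrite (coord_mean_prod Z0 covZ) eqxx.
Qed.

Section finite_dimensional_convergence.
Context d' (T' : measurableType d') (P' : probability T' R).
Variables (W : R -> T' -> 'cV[R]_p) (bvW : brownian_vector P' W).
Variables (K C : nat) (n : nat -> nat -> nat) (r : nat -> R).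
Hypotheses (r0 : r 0%N = 0) (ndr : nondecreasing_seq r) (r1 : forall k, r k <= 1).
Hypothesis n_dec : forall m k k', (k <= k' < K)%N -> (n m k' <= n m k)%N.
Hypothesis n_ge : forall m k, (k < K)%N -> (m <= n m k)%N.
(** Here [m.-1.+1] is max(m, 1), so that [n 0 0] may be positive. *)
Hypothesis n_le : forall m, (n m 0 <= C * m.-1.+1)%N.
Hypothesis n_lim : forall k, (k < K)%N -> m%:R / (n m k)%:R @[m --> \oo] --> r k.+1.

Definition scaled_sums (m : nat) (w : T) (i : 'I_K * 'I_p) : R :=
  Num.sqrt m%:R * (psum (iota 0 (n m i.1)) w i.2 / (n m i.1)%:R).

Definition brownian_values (w : T') (i : 'I_K * 'I_p) : R := W (r i.1.+1) w i.2 ord0.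

Lemma measurable_scaled_sums m i : measurable_fun setT (scaled_sums m ^~ i).
Proof.
apply: measurable_funM => //; apply: measurable_funM => //; exact: measurable_psum.
Qed.

Let rk0 k : 0 <= r k. Proof. by rewrite -r0; exact: ndr. Qed.

Lemma measurable_brownian_values i : measurable_fun setT (brownian_values ^~ i).
Proof. exact: (bv_measurable bvW). Qed.

Let n_le0 m k : (k < K)%N -> (n m k <= n m 0)%N.
Proof. by move=> kK; apply: n_dec. Qed.

Let al m (u : 'I_K * 'I_p -> R) (k : 'I_K) j := u (k, j) * (Num.sqrt m%:R / (n m k)%:R).
Let a m u l j := \sum_(k < K) al m u k j * (l < n m k)%:R.

Let lin m u w : \sum_i u i * scaled_sums m w i =
  \sum_(l <- iota 0 (n m 0)) dotc (a m u l) (Z l w).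
Proof.
transitivity (\sum_k \sum_j u (k, j) * scaled_sums m w (k, j)).
  by rewrite pair_bigA; apply: eq_bigr => -[k j].
rewrite /dotc [RHS]exchange_big/= exchange_big/=; apply: eq_bigr => j _.
under [RHS]eq_bigr do rewrite mulr_suml.
rewrite [RHS]exchange_big/=; apply: eq_bigr => k _.
rewrite /scaled_sums/= /psum (big_iota_widen _ (n_le0 m (ltn_ord k))).
rewrite mulr_suml mulr_sumr mulr_sumr; apply: eq_bigr => l _.
by rewrite /al; ring.
Qed.

(** The averages have covariance min(n, n') / (n n') = 1 / max(n, n'), and the larger index belongs
    to the smaller grid number because n is decreasing. *)
Let var m u : \sum_(l <- iota 0 (n m 0)) \sum_j a m u l j ^+ 2 =
  \sum_j \sum_(k < K) \sum_(k' < K) u (k, j) * u (k', j) * (m%:R / (n m (minn k k'))%:R).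
Proof.
rewrite exchange_big/=; apply: eq_bigr => j _.
transitivity (\sum_(l <- iota 0 (n m 0)) \sum_(k < K) \sum_(k' < K)
    al m u k j * al m u k' j * ((l < n m k)%:R * (l < n m k')%:R)).
  apply: eq_bigr => l _; rewrite expr2 mulr_suml; apply: eq_bigr => k _.
  by rewrite mulr_sumr; apply: eq_bigr => k' _; ring.
rewrite exchange_big/=; apply: eq_bigr => k _.
rewrite exchange_big/=; apply: eq_bigr => k' _.
rewrite -mulr_sumr sum_iota_indicators ?n_le0//.
have [->|m0] := eqVneq m 0%N; first by rewrite /al sqrtr0 !mul0r !mulr0 mul0r.
have nm0 (h : 'I_K) : (n m h)%:R != 0 :> R.
  by rewrite pnatr_eq0 -lt0n (leq_trans _ (n_ge m (ltn_ord h)))// lt0n.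
have sm : Num.sqrt m%:R * Num.sqrt m%:R = m%:R :> R by rewrite -expr2 sqr_sqrtr.
rewrite /al.
have -> : u (k, j) * (Num.sqrt m%:R / (n m k)%:R) *
   (u (k', j) * (Num.sqrt m%:R / (n m k')%:R)) * (minn (n m k) (n m k'))%:R =
   u (k, j) * u (k', j) * ((Num.sqrt m%:R * Num.sqrt m%:R) *
     ((minn (n m k) (n m k'))%:R / ((n m k)%:R * (n m k')%:R))).
  by field; rewrite !nm0.
rewrite sm; congr (_ * (_ * _)).
case/orP: (leq_total k k') => kk.
  rewrite (minn_idPl kk) (minn_idPr _) ?n_dec ?kk ?ltn_ord//.
  by field; rewrite !nm0.
rewrite (minn_idPr kk) (minn_idPl _) ?n_dec ?kk ?ltn_ord//.
by field; rewrite !nm0.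
Qed.

Let U (u : 'I_K * 'I_p -> R) : R := \sum_(i : 'I_K * 'I_p) `|u i|.
Let U0 u : 0 <= U u. Proof. by apply: sumr_ge0. Qed.

Let rho u (m : nat) : R := U u * (Num.sqrt m%:R)^-1.

Let rho0 u m : 0 <= rho u m.
Proof. by rewrite mulr_ge0// invr_ge0 sqrtr_ge0. Qed.

Let a_le m u l j : `|a m u l j| <= rho u m.
Proof.
apply: (@le_trans _ _ (\sum_(k < K) `|u (k, j)| * (Num.sqrt m%:R)^-1)).
  apply: (le_trans (ler_norm_sum _ _ _)); apply: ler_sum => k _.
  rewrite /al -mulrA normrM ler_wpM2l// normrM.
  rewrite ger0_norm ?divr_ge0 ?sqrtr_ge0//.
  apply: (@le_trans _ _ (Num.sqrt m%:R / (n m k)%:R)).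
    by rewrite ler_piMr ?divr_ge0 ?sqrtr_ge0// ger0_norm// lern1 leq_b1.
  have [->|m0] := eqVneq m 0%N; first by rewrite sqrtr0 mul0r invr0.
  have m1 : 0 < m%:R :> R by rewrite ltr0n lt0n.
  have n0 : 0 < (n m k)%:R :> R.
    by rewrite ltr0n (leq_trans _ (n_ge m (ltn_ord k)))// lt0n.
  have s0 : 0 < Num.sqrt m%:R :> R by rewrite sqrtr_gt0.
  have -> : Num.sqrt m%:R / (n m k)%:R =
      (Num.sqrt m%:R)^-1 * (Num.sqrt m%:R ^+ 2 / (n m k)%:R) :> R.
    by field; rewrite !gt_eqF.
  rewrite sqr_sqrtr// ler_piMr ?invr_ge0 ?(ltW s0)// ler_pdivrMr// mul1r.
  by rewrite ler_nat n_ge.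
rewrite -mulr_suml ler_wpM2r ?invr_ge0 ?sqrtr_ge0//.
have -> : U u = \sum_k \sum_i `|u (k, i)| by rewrite pair_bigA; apply: eq_bigr => -[].
apply: ler_sum => k _.
by rewrite (bigD1 j)//= lerDl sumr_ge0.
Qed.

Lemma scaled_sums_cvg : lipschitz_cvg P P' scaled_sums brownian_values.
Proof.
have cf u : mean P (fun w => cos (\sum_i u i * scaled_sums m w i)) @[m --> \oo] -->
     mean P' (fun w => cos (\sum_i u i * brownian_values w i)) /\
   mean P (fun w => sin (\sum_i u i * scaled_sums m w i)) @[m --> \oo] -->
     mean P' (fun w => sin (\sum_i u i * brownian_values w i)).
  have [-> ->] := bv_cf bvW u r0 ndr.
  have lf (f : R -> R) : (fun m => mean P (fun w => f (\sum_i u i * scaled_sums m w i))) =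
      fun m => mean P (fun w => f (\sum_(l <- iota 0 (n m 0)) dotc (a m u l) (Z l w))).
    by apply/funext => m; congr mean; apply/funext => w; rewrite lin.
  rewrite !lf.
  apply: (lindeberg_cf_cvg iidZ Z0 covZ (fun m => iota_uniq 0 (n m 0)) (rho0 u) (fun m l j => a_le m u l j)
    (K := C%:R * U u ^+ 2)).
  - move=> m; rewrite size_iota; have [->|m0] := eqVneq m 0%N.
      rewrite /rho sqrtr0 invr0 mulr0 expr0n mulr0.
      by rewrite mulr_ge0// sqr_ge0.
    rewrite /rho exprMn exprVn sqr_sqrtr// mulrCA mulrC ler_wpM2r ?sqr_ge0//.
    rewrite ler_pdivrMr ?ltr0n ?lt0n// -natrM ler_nat.
    by have := n_le m; rewrite prednK// lt0n.
  - rewrite -(mulr0 (U u)); apply: cvgM; [exact: cvg_cst|exact: sqrt_inv_cvg].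
  - under eq_fun do rewrite var.
    apply: cvg_sum_seq => j; apply: cvg_sum_seq => k; apply: cvg_sum_seq => k'.
    apply: cvgM; first exact: cvg_cst.
    by apply: n_lim; rewrite gtn_min ltn_ord.
move=> f L M L0 fL fM.
pose B : R := #|{: 'I_K * 'I_p}|%:R.
have sq m i : intg P (fun w => scaled_sums m w i ^+ 2) /\
    mean P (fun w => scaled_sums m w i ^+ 2) <= 1.
  have [j e] := psum_sqr i.2 (iota_uniq 0 (n m i.1)).
  have E : (fun w => scaled_sums m w i ^+ 2) = fun w =>
      (m%:R * ((n m i.1)%:R ^- 2)) * psum (iota 0 (n m i.1)) w i.2 ^+ 2.
    by apply/funext => w; rewrite /scaled_sums !exprMn sqr_sqrtr// exprVn; ring.
  rewrite E; split; first exact: intgZ.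
  rewrite meanZ// e size_iota.
  have [->|m0] := eqVneq m 0%N; first by rewrite !mul0r ler01.
  have n0 : 0 < (n m i.1)%:R :> R.
    by rewrite ltr0n (leq_trans _ (n_ge m (ltn_ord i.1)))// lt0n.
  rewrite -mulrA -exprVn expr2 -mulrA mulVf ?gt_eqF// mulr1.
  by rewrite ler_pdivrMr// mul1r ler_nat n_ge.
have sumB (v : 'I_K * 'I_p -> R) : (forall i, v i <= 1) -> \sum_i v i <= B.
  move=> v1; rewrite /B -sum1_card natr_sum; apply: ler_sum => i _.
  exact: v1.
apply: (@weak_cvg_of_cf _ _ _ _ _ _ _ _ _ _ B M L).
- exact: measurable_scaled_sums.
- exact: measurable_brownian_values.
- by move=> m i; have [] := sq m i.
- by move=> i; have [] := bv_sqr bvW i.2 (rk0 i.1.+1).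
- by move=> m; apply: sumB => i; have [] := sq m i.
- by apply: sumB => i; have [_ ->] := bv_sqr bvW i.2 (rk0 i.1.+1).
- by move=> u; have [] := cf u.
- by move=> u; have [] := cf u.
- exact: L0.
- exact: fL.
- exact: fM.
Qed.

End finite_dimensional_convergence.

End partial_sums.

(** * Maximal inequalities *)


Section seminorm.
Context (R : realType) (I : finType) (q : (I -> R) -> R) (kap : R).

(** A seminorm, since the distance after multiplication by a singular matrix vanishes on the kernel.
    The linear bound makes it Lipschitz, hence measurable and a valid test function. *)
Definition bounded_seminorm :=
  [/\ 0 <= kap, forall x y, q (fun i => x i + y i) <= q x + q y,
      forall a x, q (fun i => a * x i) = `|a| * q x
    & forall x, q x <= kap * \sum_i `|x i|].

Hypothesis sq : bounded_seminorm.

Lemma seminorm_kap : 0 <= kap. Proof. by case: sq. Qed.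
Lemma seminormD x y : q (fun i => x i + y i) <= q x + q y. Proof. by case: sq. Qed.
Lemma seminormZ a x : q (fun i => a * x i) = `|a| * q x. Proof. by case: sq. Qed.
Lemma seminorm_le x : q x <= kap * \sum_i `|x i|. Proof. by case: sq. Qed.

Lemma seminorm0 : q (fun=> 0) = 0.
Proof.
have e : q (fun i : I => 0 * 0) = 0.
  by have := seminormZ 0 (fun=> 0); rewrite normr0 => ->; rewrite mul0r.
by rewrite -[RHS]e; congr q; apply/funext => i; rewrite mulr0.
Qed.

Lemma seminormN x : q (fun i => - x i) = q x.
Proof.
rewrite (_ : (fun i => - x i) = fun i => -1 * x i) ?seminormZ ?normrN1 ?mul1r//.
by apply/funext => i; rewrite mulN1r.
Qed.

Lemma seminorm_ge0 x : 0 <= q x.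
Proof.
have := seminormD x (fun i => - x i).
rewrite seminormN (_ : (fun i => x i + - x i) = fun=> 0).
  by rewrite seminorm0; lra.
by apply/funext => i; rewrite subrr.
Qed.

Lemma seminorm_triangle x y : q x <= q y + q (fun i => x i - y i).
Proof.
by rewrite -{1}(_ : (fun i => y i + (x i - y i)) = x) ?seminormD//;
  apply/funext => i; rewrite subrKC.
Qed.

Lemma seminorm_lipschitz x y : `|q x - q y| <= kap * \sum_i `|x i - y i|.
Proof.
have h1 := seminorm_triangle x y; have h2 := seminorm_triangle y x.
have h3 := seminorm_le (fun i => x i - y i); have h4 := seminorm_le (fun i => y i - x i).
have e : \sum_i `|y i - x i| = \sum_i `|x i - y i|.
  by apply: eq_bigr => i _; exact: distrC.
by rewrite e in h4; rewrite ler_norml; apply/andP; split; lra.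
Qed.

Lemma measurable_seminorm d (T : measurableType d) (X : T -> I -> R) :
  (forall i, measurable_fun setT (X ^~ i)) -> measurable_fun setT (fun w => q (X w)).
Proof. exact: measurable_lipschitz seminorm_kap seminorm_lipschitz. Qed.

Lemma measurable_seminorm_event d (T : measurableType d) (X : T -> I -> R) c :
  (forall i, measurable_fun setT (X ^~ i)) -> measurable [set w | c <= q (X w)].
Proof. by move=> mX; apply: measurable_superlevel; exact: measurable_seminorm. Qed.

End seminorm.

Section maximal_inequality.
Context d (T : measurableType d) (R : realType) (P : probability T R) (p : nat).
Variable Z : nat -> T -> 'cV[R]_p.
Hypotheses (iidZ : iid_vectors P Z) (Z0 : forall i, mean_zero P (Z i)).
Hypothesis covZ : forall i, identity_covariance P (Z i).
Variables (q : ('I_p -> R) -> R) (kap : R).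
Hypothesis sq : bounded_seminorm q kap.

Lemma measurable_psum_event s c : measurable [set w | c <= q (psum Z s w)].
Proof.
by apply: (measurable_seminorm_event sq) => j; exact: (measurable_psum iidZ).
Qed.

(** One factor p comes from the Cauchy-Schwarz inequality on the l1 norm, the other from adding p
    coordinates of variance [size s] each. *)
Lemma psum_chebyshev s c : uniq s -> 0 < c ->
  pr P [set w | c <= q (psum Z s w)] <= kap ^+ 2 * p%:R ^+ 2 * (size s)%:R / c ^+ 2.
Proof.
move=> us c0; have k0 := seminorm_kap sq.
have sqi j : intg P (fun w => psum Z s w j ^+ 2) by have [] := psum_sqr iidZ Z0 covZ j us.
pose f w := kap ^+ 2 * (p%:R * \sum_j psum Z s w j ^+ 2).
have fi : intg P f by apply: intgZ; apply: intgZ; exact: intg_sum.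
have mf : mean P f = kap ^+ 2 * p%:R ^+ 2 * (size s)%:R.
  rewrite meanZ; last by apply: intgZ; exact: intg_sum.
  rewrite meanZ ?mean_sum//; last exact: intg_sum.
  under eq_bigr => j _ do rewrite (psum_sqr iidZ Z0 covZ j us).2.
  by rewrite sumr_const card_ord -mulr_natl; ring.
have f0 w : 0 <= f w by rewrite !mulr_ge0 ?sqr_ge0// sumr_ge0// => j _; exact: sqr_ge0.
rewrite -mf; apply: (le_trans _ (pr_markov fi f0 _)); last exact: exprn_gt0.
apply: pr_le; first exact: measurable_psum_event.
  by apply: measurable_superlevel; exact: intg_measurable fi.
move=> w /= cq; apply: (@le_trans _ _ (q (psum Z s w) ^+ 2)).
  by rewrite lerXn2r ?nnegrE ?(ltW c0)// (seminorm_ge0 sq).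
apply: (@le_trans _ _ ((kap * \sum_j `|psum Z s w j|) ^+ 2)).
  by rewrite lerXn2r ?nnegrE ?(seminorm_ge0 sq) ?mulr_ge0 ?sumr_ge0// (seminorm_le sq).
by rewrite exprMn ler_wpM2l ?sqr_ge0// sqr_sum_norm_le.
Qed.

Let tail_sigma (s : seq nat) := \bigcup_(l in [set` s]) vec_sigma (Z l).

Lemma measurable_psum_sigma s (c : R) :
  <<s tail_sigma s >> [set w | c <= q (psum Z s w)].
Proof.
apply: (@measurable_seminorm_event _ _ _ _ sq _ (g_sigma_algebraType (tail_sigma s))).
move=> j; rewrite /psum.
(* The test for membership makes every summand measurable for the sigma-algebra of [s], so that
   [measurable_sum] applies. *)
have -> : (fun w : T => \sum_(l <- s) Z l w j ord0) =
  (fun w => \sum_(l <- s) (if l \in s then Z l w j ord0 else 0)).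
  by apply/funext => w; rewrite big_seq [RHS]big_seq; apply: eq_bigr => l ->.
apply: measurable_sum => l; case: (boolP (l \in s)) => // ls.
apply: (@measurable_g_sigma_sub _ _ _ (vec_sigma (Z l))).
  by move=> A FA; apply: sub_sigma_algebra; exists l.
exact: (measurable_vec_sigma (measurable_coord j)).
Qed.

(* Ottaviani: decompose according to the first time [k] at which the running
   sum exceeds [2c]; the increment after [k] is independent of that event and
   is smaller than [c] with probability at least 1/2. *)
Lemma psum_ottaviani n0 N c : 0 < c ->
  (forall k, (k <= N)%N ->
     pr P [set w | c <= q (psum Z (iota (n0 + k) (N - k)) w)] <= 2^-1) ->
  pr P (\bigcup_(k in [set k | (k < N.+1)%N]) [set w | 2 * c <= q (psum Z (iota n0 k) w)]) <=
    2 * pr P [set w | c <= q (psum Z (iota n0 N) w)].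
Proof.
move=> c0 half.
pose E k := [set w | 2 * c <= q (psum Z (iota n0 k) w)].
pose A k := \bigcup_(i in [set i | (i < k)%N]) E i.
pose V := [set w | c <= q (psum Z (iota n0 N) w)].
have mE k : measurable (E k) by exact: measurable_psum_event.
have mV : measurable V by exact: measurable_psum_event.
have mA k : measurable (A k) by exact: bigcup_measurable.
have AS k : A k.+1 = A k `|` (E k `\` A k).
  apply/seteqP; split => [w [i /= ik Ei]|w [[i /= ik Ei]|[Ek _]]]; last 2 first.
  - by exists i => //=; exact: ltnW.
  - by exists k => /=.
  have [Aw|nAw] := pselect (A k w); [by left|right].
  move: ik; rewrite ltnS leq_eqVlt => /predU1P[ik|ik]; first by rewrite -ik in nAw *.
  by exfalso; apply: (nAw); exists i.
suff step k : (k <= N.+1)%N -> pr P (A k) <= 2 * pr P (V `&` A k).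
  apply: (le_trans (step N.+1 (leqnn _))); rewrite ler_wpM2l//.
  by apply: pr_le => //; exact: measurableI.
elim: k => [_|k ih kN].
  rewrite /A (_ : \bigcup_(_ in _) _ = set0) ?pr0 ?mulr_ge0 ?pr_ge0//.
  by apply/seteqP; split => // w [].
have mF : measurable (E k `\` A k) by exact: measurableD.
rewrite AS; apply: (le_trans (pr_setU _ _ _)) => //.
have -> : pr P (V `&` (A k `|` (E k `\` A k))) =
    pr P (V `&` A k) + pr P (V `&` (E k `\` A k)).
  have := @pr_setD _ _ _ P (V `&` (A k `|` (E k `\` A k))) (V `&` A k).
  have -> : V `&` (A k `|` (E k `\` A k)) `\` V `&` A k = V `&` (E k `\` A k).
    by apply/seteqP; split => w /=; tauto.
  move=> ->; first by rewrite subrKC.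
  - by apply: measurableI => //; exact: measurableU.
  - exact: measurableI.
  - by move=> w /=; tauto.
rewrite mulrDr lerD ?ih ?(ltnW kN)//.
pose B := [set w | c <= q (psum Z (iota (n0 + k) (N - k)) w)].
have mB : measurable B by exact: measurable_psum_event.
have sE : <<s tail_sigma (iota n0 k) >> (E k `\` A k).
  have m i : (i <= k)%N -> <<s tail_sigma (iota n0 k) >> (E i).
    move=> ik; have := @measurable_psum_sigma (iota n0 i) (2 * c).
    apply: sub_smallest2r => // X [l /= ls Xl]; exists l => //=.
    by move: ls; rewrite !mem_iota => /andP[-> /leq_trans]; apply; rewrite leq_add2l.
  apply: (@measurableD _ (g_sigma_algebraType (tail_sigma (iota n0 k)))); first exact: m.
  by apply: bigcup_measurable => i /= ik; apply: m; exact: ltnW.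
have ind := mutually_independent_grouping (s1 := iota n0 k) (s2 := iota (n0 + k) (N - k))
  (iid_mutually_independent iidZ)
  (fun l => vec_sigma_measurable (iid_random_vector iidZ l))
  (fun l => @vec_sigma_setI _ _ _ _ (Z l)) (fun l => @vec_sigmaT _ _ _ _ (Z l)).
have {}ind : pr P ((E k `\` A k) `&` ~` B) = pr P (E k `\` A k) * pr P (~` B).
  apply: ind; rewrite -?iotaD ?iota_uniq//.
  apply: (@measurableC _ (g_sigma_algebraType (tail_sigma (iota (n0 + k) (N - k))))).
  exact: measurable_psum_sigma.
have hB := half _ kN; rewrite -/B in hB.
have : pr P (E k `\` A k) * 2^-1 <= pr P (V `&` (E k `\` A k)).
  apply: (@le_trans _ _ (pr P ((E k `\` A k) `&` ~` B))).
    rewrite ind ler_wpM2l ?pr_ge0// pr_setC//; lra.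
  apply: pr_le; [by apply: measurableI => //; exact: measurableC|exact: measurableI|].
  move=> w [[Ek nA] /= nB]; split => //; rewrite /V/=.
  have := seminorm_triangle sq (psum Z (iota n0 k) w) (psum Z (iota n0 N) w).
  have -> : (fun i => psum Z (iota n0 k) w i - psum Z (iota n0 N) w i) =
      fun i => - psum Z (iota (n0 + k) (N - k)) w i.
    apply/funext => i; rewrite -(subnKC (n := N) (m := k)) // /psum iotaD big_cat/=.
    by rewrite subnKC //; ring.
  rewrite (seminormN sq).
  move/negP: nB; rewrite -ltNge; move: Ek; rewrite /E/=; lra.
lra.
Qed.

Lemma psum_maximal n0 N c : 0 < c -> 2 * (kap ^+ 2 * p%:R ^+ 2 * N%:R) <= c ^+ 2 ->
  pr P (\bigcup_(k in [set k | (k < N.+1)%N]) [set w | 2 * c <= q (psum Z (iota n0 k) w)]) <=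
    2 * pr P [set w | c <= q (psum Z (iota n0 N) w)].
Proof.
move=> c0 Nc; apply: psum_ottaviani => // k kN.
apply: (le_trans (psum_chebyshev (iota_uniq _ _) c0)).
rewrite size_iota ler_pdivrMr ?exprn_gt0// ler_pdivlMl//.
apply: le_trans Nc; rewrite ler_wpM2l// ler_wpM2l ?ler_nat ?leq_subr//.
by rewrite mulr_ge0 ?sqr_ge0.
Qed.

(** When the condition of [psum_maximal] fails, the right-hand side exceeds 1 and the bound is
    trivial. *)
Lemma psum_maximal_chebyshev n0 N c : 0 < c ->
  pr P (\bigcup_(k in [set k | (k < N.+1)%N]) [set w | 2 * c <= q (psum Z (iota n0 k) w)]) <=
    2 * (kap ^+ 2 * p%:R ^+ 2 * N%:R / c ^+ 2).
Proof.
move=> c0.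
have [Nc|cN] := leP (2 * (kap ^+ 2 * p%:R ^+ 2 * N%:R)) (c ^+ 2).
  apply: (le_trans (psum_maximal _ c0 Nc)); rewrite ler_wpM2l//.
  by apply: (le_trans (psum_chebyshev (iota_uniq _ _) c0)); rewrite size_iota.
apply: (@le_trans _ _ 1).
  by apply: pr_le1; apply: bigcup_measurable => k _; exact: measurable_psum_event.
by rewrite mulrA ler_pdivlMr ?exprn_gt0// mul1r ltW.
Qed.

Lemma measurable_average_event m n (a : R) :
  measurable [set w | a <= Num.sqrt m%:R * (q (psum Z (iota 0 n) w) / n%:R)].
Proof.
apply: measurable_superlevel; apply: measurable_funM => //; apply: measurable_funM => //.
by apply: (measurable_seminorm sq) => j; exact: (measurable_psum iidZ).
Qed.

(* Union bound over the dyadic blocks [2^i A m <= n < 2^(i+1) A m]. *)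
Lemma psum_tail m A a : (0 < m)%N -> (0 < A)%N -> 0 < a ->
  pr P (\bigcup_(n in [set n | (A * m <= n)%N])
    [set w | a <= Num.sqrt m%:R * (q (psum Z (iota 0 n) w) / n%:R)]) <=
  32 * (kap ^+ 2 * p%:R ^+ 2) / (a ^+ 2 * A%:R).
Proof.
move=> m0 A0 a0; set C := kap ^+ 2 * p%:R ^+ 2.
have C0 : 0 <= C by rewrite mulr_ge0 ?sqr_ge0.
have AR : 0 < A%:R :> R by rewrite ltr0n.
have mR : 0 < m%:R :> R by rewrite ltr0n.
have sm : 0 < Num.sqrt m%:R :> R by rewrite sqrtr_gt0.
have smE : Num.sqrt m%:R ^+ 2 = m%:R :> R by rewrite sqr_sqrtr// ltW.
(* [N i] is the right end of block i. Twice [c i] equals a (2^i A m) / sqrt m, the least value of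
   q(S_n) for which an index of that block can cross the level a. The resulting bounds are geometric
   with ratio 1/2. *)
pose N i := (2 ^ i.+1 * (A * m))%N.
pose c i := a * 2 ^+ i * A%:R * Num.sqrt m%:R / 2.
have c0 i : 0 < c i by rewrite /c !mulr_gt0// ?invr_gt0// exprn_gt0.
pose B i := \bigcup_(k in [set k | (k < (N i).+1)%N])
  [set w | 2 * c i <= q (psum Z (iota 0 k) w)].
have mB i : measurable (B i).
  by apply: bigcup_measurable => k _; exact: measurable_psum_event.
have prB i : pr P (B i) <= 16 * C / (a ^+ 2 * A%:R) * 2^-1 ^+ i.
  apply: (le_trans (psum_maximal_chebyshev _ _ (c0 i))).
  rewrite le_eqVlt; apply/orP; left; apply/eqP; rewrite -/C /N /c !natrM natrX.
  have e2 : (2 : R) ^+ i != 0 by rewrite expf_neq0.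
  rewrite exprS exprVn; move: sm smE; set r := Num.sqrt _ => sm <-.
  by field; rewrite e2 !gt_eqF.
apply: (@le_trans _ _ (pr P (\bigcup_i B i))).
  apply: pr_le; [|exact: bigcupT_measurable|].
    by apply: bigcup_measurable => n _; exact: measurable_average_event.
  move=> w [n /= An aw].
  have Am0 : (0 < A * m)%N by rewrite muln_gt0 A0.
  have n0 : (0 < n)%N by exact: leq_trans An.
  have nR : 0 < n%:R :> R by rewrite ltr0n.
  pose t := (n %/ (A * m))%N; have t0 : (0 < t)%N by rewrite divn_gt0.
  exists (trunc_log 2 t) => //; exists n => /=.
    rewrite ltnS /N; apply: ltnW; rewrite -ltn_divLR//.
    exact: trunc_log_ltn.
  have h : ((2 ^ trunc_log 2 t) * (A * m) <= n)%N.
    by rewrite -leq_divRL// trunc_logP.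
  have hR : 2 ^+ trunc_log 2 t * (A%:R * Num.sqrt m%:R ^+ 2) <= n%:R :> R.
    by rewrite smE -natrX -!natrM ler_nat.
  move: aw; rewrite mulrA ler_pdivlMr// => aw.
  rewrite -(ler_pM2l sm); apply: le_trans aw.
  apply: le_trans (ler_wpM2l (ltW a0) hR).
  by rewrite le_eqVlt; apply/orP; left; apply/eqP; rewrite /c; field.
apply: pr_bigcup_le => // n; apply: (le_trans (pr_bigcup_lt _ _ mB)).
apply: (@le_trans _ _ (\sum_(i < n) 16 * C / (a ^+ 2 * A%:R) * 2^-1 ^+ i)).
  by apply: ler_sum => i _; exact: prB.
rewrite -mulr_sumr.
have geo k : \sum_(i < k) (2^-1 : R) ^+ i = 2 - 2 * 2^-1 ^+ k.
  elim: k => [|k ih]; first by rewrite big_ord0 expr0; lra.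
  by rewrite big_ord_recr/= ih exprS; lra.
rewrite geo.
have -> : 32 * C / (a ^+ 2 * A%:R) = 16 * C / (a ^+ 2 * A%:R) * 2 by ring.
rewrite ler_wpM2l//.
  by apply: divr_ge0; [exact: mulr_ge0|rewrite ltW// mulr_gt0// exprn_gt0].
have : (0 : R) <= 2^-1 ^+ n by rewrite exprn_ge0.
lra.
Qed.

End maximal_inequality.


(* [512 e^2 h^2 / c^4] bounds a Brownian increment of length [h] coordinatewise,
   at the level [c = a / (4 (kap+1) (p+1))]; the outer factors come from the
   maximal inequality and the sum over the coordinates.  What matters is that
   the bound is [o(h)]: there are about [A / h] blocks of length [h m]. *)
Definition oscillation_cst (R : realType) (p : nat) (kap : R) : R :=
  2 * (p%:R * (512 * expR 2 * (4 * (kap + 1) * (p%:R + 1)) ^+ 4)).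

Lemma oscillation_cst_ge0 (R : realType) (p : nat) (kap : R) : 0 <= oscillation_cst p kap.
Proof.
apply: mulr_ge0; first exact: ler0n.
apply: mulr_ge0; first exact: ler0n.
apply: mulr_ge0; last exact: exprn_even_ge0.
by apply: mulr_ge0; [exact: ler0n|exact: expR_ge0].
Qed.

Section block_oscillation.
Context d (T : measurableType d) (R : realType) (P : probability T R) (p : nat).
Variable Z : nat -> T -> 'cV[R]_p.
Hypotheses (iidZ : iid_vectors P Z) (Z0 : forall i, mean_zero P (Z i)).
Hypothesis covZ : forall i, identity_covariance P (Z i).
Context d' (T' : measurableType d') (P' : probability T' R).
Variables (W : R -> T' -> 'cV[R]_p) (bvW : brownian_vector P' W).
Variables (q : ('I_p -> R) -> R) (kap : R).
Hypothesis sq : bounded_seminorm q kap.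
Variables (s b : nat -> nat) (h : R).
Hypotheses (h0 : 0 < h) (bh : (b m)%:R / m%:R @[m --> \oo] --> h).

Let bmW j : standard_brownian_motion P' (fun t w => W t w j ord0).
Proof. by case: bvW => + _; exact. Qed.

Let X m w j := (Num.sqrt m%:R)^-1 * psum Z (iota (s m) (b m)) w j.
Let Y w (j : 'I_p) := W h w j ord0 - W 0 w j ord0.

Let mX m j : measurable_fun setT (X m ^~ j).
Proof. by apply: measurable_funM => //; exact: (measurable_psum iidZ). Qed.

Let mY j : measurable_fun setT (Y ^~ j).
Proof.
by apply: measurable_funB; apply: (bv_measurable bvW) => //; exact: ltW.
Qed.

Let sqrtV m : (Num.sqrt m%:R)^-1 ^+ 2 = m%:R^-1 :> R.
Proof. by rewrite exprVn sqr_sqrtr. Qed.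

Let bounded : exists2 C : R, 0 <= C & forall m, (b m)%:R / m%:R <= C.
Proof.
have /cvg_seq_bounded/pinfty_ex_gt0[M M0 hM] : cvgn (fun m => (b m)%:R / m%:R : R).
  by apply/cvg_ex; exists h.
exists M; first exact: ltW.
by move=> m; exact: le_trans (ler_norm _) (hM m I).
Qed.

(** The central limit theorem for one block. The starting index [s m] is arbitrary, because only the
    number of summands enters the variance. *)
Let block_lipschitz_cvg : lipschitz_cvg P P' X Y.
Proof.
have [C C0 bC] := bounded.
have sX m j : intg P (fun w => X m w j ^+ 2) /\
    mean P (fun w => X m w j ^+ 2) = (b m)%:R / m%:R.
  have [i e] := psum_sqr iidZ Z0 covZ j (iota_uniq (s m) (b m)).
  have E : (fun w => X m w j ^+ 2) = fun w => m%:R^-1 * psum Z (iota (s m) (b m)) w j ^+ 2.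
    by apply/funext => w; rewrite /X exprMn sqrtV.
  by rewrite E; split; [exact: intgZ|rewrite meanZ// e size_iota mulrC].
have sY j : intg P' (fun w => Y w j ^+ 2) /\ mean P' (fun w => Y w j ^+ 2) = h.
  by have := bm_increment_sqr (bmW j) (lexx 0) h0; rewrite subr0.
pose r (k : nat) : R := if k is 0 then 0 else h.
have ndr : nondecreasing_seq r by move=> [|k] [|l] //= _; exact: ltW.
have cf u : mean P (fun w => cos (\sum_i u i * X m w i)) @[m --> \oo] -->
     mean P' (fun w => cos (\sum_i u i * Y w i)) /\
   mean P (fun w => sin (\sum_i u i * X m w i)) @[m --> \oo] -->
     mean P' (fun w => sin (\sum_i u i * Y w i)).
  have := bv_incr_cf bvW 1 (fun _ j => u j) (lexx 0 : 0 <= r 0%N) ndr.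
  have E w : \sum_j \sum_(k <- iota 0 1) u j * (W (r k.+1) w j ord0 - W (r k) w j ord0) =
      \sum_j u j * Y w j.
    by apply: eq_bigr => j _; rewrite big_seq1.
  under [X in mean _ X = _ /\ _]eq_fun do rewrite E.
  under [X in _ /\ mean _ X = _]eq_fun do rewrite E.
  move=> [-> ->].
  pose a (m l : nat) j := u j * (Num.sqrt m%:R)^-1.
  have XE m w : \sum_i u i * X m w i = \sum_(l <- iota (s m) (b m)) dotc (a m l) (Z l w).
    rewrite /dotc exchange_big/=; apply: eq_bigr => j _.
    by rewrite /X /psum mulrA mulr_sumr.
  have lf (f : R -> R) : (fun m => mean P (fun w => f (\sum_i u i * X m w i))) =
      fun m => mean P (fun w => f (\sum_(l <- iota (s m) (b m)) dotc (a m l) (Z l w))).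
    by apply/funext => m; congr mean; apply/funext => w; rewrite XE.
  rewrite !lf; pose U := \sum_j `|u j|.
  have U0 : 0 <= U by apply: sumr_ge0.
  apply: (lindeberg_cf_cvg iidZ Z0 covZ (fun m => iota_uniq (s m) (b m))
    (rho := fun m => U * (Num.sqrt m%:R)^-1) (K := U ^+ 2 * C)).
  - by move=> m; rewrite mulr_ge0 ?invr_ge0 ?sqrtr_ge0.
  - move=> m l j; rewrite /a normrM (ger0_norm (_ : 0 <= _^-1)) ?invr_ge0 ?sqrtr_ge0//.
    by rewrite ler_wpM2r ?invr_ge0 ?sqrtr_ge0// /U (bigD1 j)//= lerDl sumr_ge0.
  - move=> m; rewrite size_iota exprMn sqrtV mulrCA ler_wpM2l ?sqr_ge0//.
  - by rewrite -(mulr0 U); apply: cvgM; [exact: cvg_cst|exact: sqrt_inv_cvg].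
  - have -> : (fun m => \sum_(l <- iota (s m) (b m)) \sum_i a m l i ^+ 2) =
        fun m => (\sum_j u j ^+ 2) * ((b m)%:R / m%:R).
      apply/funext => m; rewrite /a big_const_seq count_predT iter_addr_0 size_iota.
      rewrite -[LHS]mulr_natl mulr_suml mulr_sumr; apply: eq_bigr => j _.
      by rewrite exprMn sqrtV mulrCA.
    have -> : \sum_j \sum_(k <- iota 0 1) u j ^+ 2 * (r k.+1 - r k) = (\sum_j u j ^+ 2) * h.
      by rewrite mulr_suml; apply: eq_bigr => j _; rewrite big_seq1/= subr0.
    by apply: cvgM; [exact: cvg_cst|exact: bh].
move=> f L M L0 fL fM.
apply: (@weak_cvg_of_cf _ _ _ _ _ _ _ _ _ _ (p%:R * C + p%:R * h) M L) => //.
- by move=> m j; have [] := sX m j.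
- by move=> j; have [] := sY j.
- move=> m; apply: (@le_trans _ _ (\sum_(j < p) C)).
    by apply: ler_sum => j _; have [_ ->] := sX m j.
  by rewrite sumr_const card_ord mulr_natl lerDl mulr_ge0// ltW.
- rewrite (eq_bigr (fun=> h)); last by move=> j _; have [_ ->] := sY j.
  by rewrite sumr_const card_ord -[X in X <= _]mulr_natl lerDr mulr_ge0.
- by move=> u; have [] := cf u.
- by move=> u; have [] := cf u.
Qed.

(** The level falls from a to a / 2 by Ottaviani and to a / 4 by the gap of the weak limit. Since
    [b m] <= 2 h m eventually, the bound 16 C h <= a^2 with C = kap^2 p^2 is the condition of
    [psum_maximal] at a / 2. *)
Lemma block_oscillation a eta : 0 < a -> 0 < eta ->
  16 * (kap ^+ 2 * p%:R ^+ 2) * h <= a ^+ 2 ->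
  \forall m \near \oo,
    pr P (\bigcup_(k in [set k | (k < (b m).+1)%N])
      [set w | a * Num.sqrt m%:R <= q (psum Z (iota (s m) k) w)]) <=
    oscillation_cst p kap * h ^+ 2 / a ^+ 4 + eta.
Proof.
move=> a0 eta0 ha; have k0 := seminorm_kap sq.
have C0 : 0 <= kap ^+ 2 * p%:R ^+ 2 :> R by rewrite mulr_ge0 ?sqr_ge0.
(* If all coordinates are below a / D, then q is below a / 4; the two added units keep D positive
   and this inequality strict when kap or p is 0. *)
pose D := 4 * (kap + 1) * (p%:R + 1).
have p0 : 0 <= p%:R :> R by [].
have D0 : 0 < D by rewrite !mulr_gt0//; lra.
have tailY : pr P' [set w | a / 4 <= q (Y w)] <=
    p%:R * (512 * expR 2 * h ^+ 2 / (a / D) ^+ 4).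
  have mE j : measurable [set w | a / D <= `|Y w j|].
    by apply: measurable_superlevel; exact: measurableT_comp.
  (* Extension by the empty set from ['I_p] to [nat], the index type of [pr_bigcup_lt]. *)
  pose E (i : nat) := if insub i is Some j then [set w | a / D <= `|Y w j|] else set0.
  have mEi i : measurable (E i) by rewrite /E; case: insubP.
  apply: (@le_trans _ _ (pr P' (\bigcup_(i in [set i | (i < p)%N]) E i))).
    apply: pr_le => [||w /= aq].
    - exact: (measurable_seminorm_event sq).
    - by apply: bigcup_measurable => i _; exact: mEi.
    have [j jw|nj] := pickP (fun j => a / D <= `|Y w j|).
      by exists j => //=; rewrite /E valK.
    exfalso; have := seminorm_le sq (Y w).
    have : \sum_j `|Y w j| <= p%:R * (a / D).
      rewrite -[X in X%:R * _]card_ord mulr_natl -sumr_const; apply: ler_sum => j _.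
      by have /negbT := nj j; rewrite -ltNge => /ltW.
    move=> /(ler_wpM2l k0) h1 h2.
    have : kap * (p%:R * (a / D)) < a / 4.
      have -> : a / 4 = (kap + 1) * ((p%:R + 1) * (a / D)).
        by rewrite /D; field; rewrite !gt_eqF//; lra.
      have aD : 0 < a / D by rewrite divr_gt0.
      nra.
    by move: h1 h2 aq; lra.
  apply: (le_trans (pr_bigcup_lt _ _ mEi)).
  rewrite -[X in X%:R * _]card_ord mulr_natl -sumr_const; apply: ler_sum => j _.
  rewrite /E valK.
  have := bv_increment_tail bvW j (lexx 0) h0 (divr_gt0 a0 D0).
  by rewrite subr0.
have e2 : 0 < eta / 2 by rewrite divr_gt0.
have a42 : a / 4 < a / 2 by rewrite ltr_pM2l// ltf_pV2 ?posrE// ltr_nat.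
have hb : \forall m \near \oo, (b m)%:R / m%:R <= 2 * h.
  have hh : h < 2 * h by rewrite ltr_pMl// ltr1n.
  by apply: (cvgr_le _ bh).
near=> m.
have m0 : (0 < m)%N by near: m; exact: nbhs_infty_gt.
have sm : 0 < Num.sqrt m%:R :> R by rewrite sqrtr_gt0 ltr0n.
have mR : 0 < m%:R :> R by rewrite ltr0n.
have smE : Num.sqrt m%:R ^+ 2 = m%:R :> R by rewrite sqr_sqrtr// ltW.
have c0 : 0 < a / 2 * Num.sqrt m%:R by rewrite mulr_gt0// divr_gt0.
have := @psum_maximal _ _ _ P _ _ iidZ Z0 covZ _ _ sq (s m) (b m) _ c0.
have -> : 2 * (a / 2 * Num.sqrt m%:R) = a * Num.sqrt m%:R by field.
move=> /(_ _)/le_trans; apply.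
  rewrite exprMn smE.
  have bm : (b m)%:R / m%:R <= 2 * h by near: m.
  rewrite ler_pdivrMr// in bm.
  have h1 := ler_wpM2l C0 bm.
  have h2 := ler_wpM2r (ltW mR) ha.
  have -> : (a / 2) ^+ 2 * m%:R = a ^+ 2 * m%:R / 4 by field.
  lra.
have -> : [set w | a / 2 * Num.sqrt m%:R <= q (psum Z (iota (s m) (b m)) w)] =
    [set w | a / 2 <= q (X m w)].
  have Xq w : q (X m w) = (Num.sqrt m%:R)^-1 * q (psum Z (iota (s m) (b m)) w).
    by rewrite (seminormZ sq) ger0_norm ?invr_ge0 ?sqrtr_ge0.
  by apply/seteqP; split => w /=; rewrite Xq ler_pdivlMl// mulrC.
have [h1 _] : pr P [set w | a / 2 <= q (X m w)] <= pr P' [set w | a / 4 <= q (Y w)] + eta / 2 /\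
    pr P' [set w | a / 2 <= q (Y w)] <= pr P [set w | a / 4 <= q (X m w)] + eta / 2.
  near: m; exact: (lipschitz_cvg_events mX mY block_lipschitz_cvg
    (seminorm_kap sq) (seminorm_lipschitz sq) a42 e2).
have -> : oscillation_cst p kap * h ^+ 2 / a ^+ 4 =
    2 * (p%:R * (512 * expR 2 * h ^+ 2 / (a / D) ^+ 4)).
  rewrite /oscillation_cst -/D; field.
  by rewrite !gt_eqF.
lra.
Unshelve. all: by end_near. Qed.

End block_oscillation.

(** * The Brownian maximum *)


Lemma archi_nat (R : realType) (x : R) : exists2 n : nat, (0 < n)%N & x <= n%:R.
Proof.
exists (Num.bound `|x|).+1 => //.
apply: (le_trans (ler_norm _)); apply: (le_trans (ltW (archi_boundP _))) => //.
by rewrite ler_nat.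
Qed.

Section brownian_maximum.
Context d (T : measurableType d) (R : realType) (P : probability T R) (p : nat).
Variables (W : R -> T -> 'cV[R]_p) (bvW : brownian_vector P W).
Variables (q : ('I_p -> R) -> R) (kap : R).
Hypothesis sq : bounded_seminorm q kap.

Definition bval (t : R) (w : T) (j : 'I_p) : R := W t w j ord0.

(** The strict inequality is an open condition along continuous paths, so the event is a countable
    union over the times [frac a b]; its complement is the event that the supremum is at most c. *)
Definition exceeds (c : R) := [set w | exists2 t, 0 <= t <= 1 & c < q (bval t w)].

Lemma seminorm_path_lt t w c : 0 <= t -> c < q (bval t w) ->
  exists2 e, 0 < e & forall u, 0 <= u -> `|u - t| < e -> c < q (bval u w).
Proof.
move=> t0 ct.
have k0 := seminorm_kap sq.
pose e := (q (bval t w) - c) / (2 * (kap + 1) * (p%:R + 1)).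
have D0 : 0 < 2 * (kap + 1) * (p%:R + 1) :> R.
  by rewrite !mulr_gt0// ltr_wpDl.
have e0 : 0 < e by rewrite divr_gt0// subr_gt0.
have : \forall u \near within `[0, +oo[ (nbhs t), forall j, `|bval t w j - bval u w j| <= e.
  apply: filter_forall => j; have [bmW _] := bvW; have [_ _ _ _ /(_ w)] := bmW j.
  move=> /subspace_continuousP/(_ t); rewrite /= in_itv/= t0 => /(_ isT).
  by move=> /cvgrPdist_le/(_ e e0).
rewrite /within/= => /nbhs_ballP[r /= r0 rB]; exists r => // u u0 ut.
have hu j : `|bval t w j - bval u w j| <= e.
  by apply: rB; rewrite /= ?in_itv/= ?u0// /ball/= distrC.
have := seminorm_lipschitz sq (bval t w) (bval u w).
have : \sum_j `|bval t w j - bval u w j| <= p%:R * e.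
  rewrite -[X in X%:R * _]card_ord mulr_natl -sumr_const; exact: ler_sum.
move=> /(ler_wpM2l k0) h1 h2.
have : kap * (p%:R * e) < q (bval t w) - c.
  have -> : q (bval t w) - c = e * (2 * (kap + 1) * (p%:R + 1)).
    by rewrite /e divfK// gt_eqF.
  have p0 : 0 <= p%:R :> R by [].
  nra.
by move: h1 h2; rewrite ler_norml => h1 /andP[_ h2]; lra.
Qed.

(* Every rational of ]0, 1] is of this form; with [H] a multiple of [a + 1] it
   is also of the form [H / (H + i)], hence a point of the grid below. *)
Definition frac (a b : nat) : R := a.+1%:R / (a + b).+1%:R.

Lemma frac_gt0 a b : 0 < frac a b.
Proof. by rewrite divr_gt0// ltr0n. Qed.

Lemma frac_le1 a b : frac a b <= 1.
Proof. by rewrite ler_pdivrMr ?ltr0n// mul1r ler_nat ltnS leq_addr. Qed.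

Lemma frac_dense t e : 0 <= t <= 1 -> 0 < e -> exists a b, `|frac a b - t| < e.
Proof.
move=> /andP[t0 t1] e0; have [N N0 eN] := archi_nat (e^-1).
(* The difference between a + 1 and t (N + 1) is then at most 1 in absolute value. *)
pose a := Num.truncn (t * N%:R).
have NR : 0 <= t * N%:R by rewrite mulr_ge0.
have /andP[a1 a2] := truncn_itv NR; rewrite -/a in a1 a2.
have aN : (a <= N)%N.
  by rewrite -(ler_nat R) (le_trans a1)// ler_piMl.
exists a, (N - a)%N; rewrite /frac subnKC//.
have N1 : 0 < N.+1%:R :> R by rewrite ltr0n.
have h : N.+1%:R^-1 < e.
  rewrite invf_plt ?posrE// (le_lt_trans eN)//.
  by rewrite ltr_nat.
have -> : a.+1%:R / N.+1%:R - t = (a.+1%:R - t * N.+1%:R) / N.+1%:R.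
  by field; rewrite gt_eqF.
rewrite normrM (gtr0_norm (_ : 0 < _^-1)) ?invr_gt0//.
apply: le_lt_trans h; rewrite ler_piMl ?invr_ge0 ?(ltW N1)//.
rewrite -!natr1 in a2 *.
by rewrite ler_norml; apply/andP; split; lra.
Qed.

Definition frac_exceeds c l := \bigcup_(a in [set a | (a < l)%N])
  \bigcup_(b in [set b | (b < l)%N]) [set w | c < q (bval (frac a b) w)].

Let measurable_lt t c : 0 <= t -> measurable [set w | c < q (bval t w)].
Proof.
move=> t0; have -> : [set w | c < q (bval t w)] = ~` [set w | q (bval t w) <= c].
  by apply/seteqP; split => w /=; rewrite ltNge => /negP.
apply: measurableC.
have -> : [set w | q (bval t w) <= c] = [set w | - c <= - q (bval t w)].
  by apply/seteqP; split => w /=; rewrite lerN2.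
apply: measurable_superlevel; apply: measurableT_comp => //.
by apply: (measurable_seminorm sq) => j; exact: (bv_measurable bvW).
Qed.

Lemma measurable_frac_exceeds c l : measurable (frac_exceeds c l).
Proof.
apply: bigcup_measurable => a _; apply: bigcup_measurable => b _.
by apply: measurable_lt; rewrite ltW// frac_gt0.
Qed.

Lemma exceeds_bigcup c : exceeds c = \bigcup_l frac_exceeds c l.
Proof.
apply/seteqP; split => [w [t t01 ct]|w [l _ [a _ [b _ ct]]]]; last first.
  by exists (frac a b) => //; rewrite frac_le1 ltW// frac_gt0.
have /andP[t0 _] := t01.
have [e e0 ce] := seminorm_path_lt t0 ct; have [a [b ab]] := frac_dense t01 e0.
exists (maxn a b).+1 => //; exists a => /=; first by rewrite ltnS leq_maxl.
exists b => /=; first by rewrite ltnS leq_maxr.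
by apply: ce => //; rewrite ltW// frac_gt0.
Qed.

Lemma measurable_exceeds c : measurable (exceeds c).
Proof.
by rewrite exceeds_bigcup; apply: bigcupT_measurable => l; exact: measurable_frac_exceeds.
Qed.

Lemma frac_exceeds_approx c eta : 0 < eta ->
  exists2 l, (0 < l)%N & pr P (exceeds c) <= pr P (frac_exceeds c l) + eta.
Proof.
move=> eta0; have nd : nondecreasing_seq (frac_exceeds c).
  move=> l l' ll; apply/subsetPset => w [a /= al [b /= bl cw]].
  by exists a => /=; [exact: leq_trans ll|exists b => //=; exact: leq_trans ll].
have := pr_bigcup_cvg (P := P) (measurable_frac_exceeds c) nd; rewrite -exceeds_bigcup.
move=> /cvgrPdist_le/(_ eta eta0)[l _ hl]; exists l.+1 => //.
by have := hl l.+1 (leqnSn _); rewrite ler_norml => /andP[_]; rewrite lerBlDl.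
Qed.

End brownian_maximum.

(** * Crossings after a late time *)


Section grid.
Context d (T : measurableType d) (R : realType) (P : probability T R) (p : nat).
Variable Z : nat -> T -> 'cV[R]_p.
Hypotheses (iidZ : iid_vectors P Z) (Z0 : forall i, mean_zero P (Z i)).
Hypothesis covZ : forall i, identity_covariance P (Z i).
Context d' (T' : measurableType d') (P' : probability T' R).
Variables (W : R -> T' -> 'cV[R]_p) (bvW : brownian_vector P' W).
Variables (q : ('I_p -> R) -> R) (kap : R).
Hypothesis sq : bounded_seminorm q kap.
Variables (H J : nat) (H0 : (0 < H)%N).

(** The successor keeps the mesh positive and makes H meshes at least as long as m. *)
Definition mesh m := (m %/ H).+1.

Lemma mesh_cvg : (mesh m)%:R / m%:R @[m --> \oo] --> (H%:R^-1 : R).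
Proof.
apply: (@cvg_of_dist_le _ _ (fun m => 2 * m.+1%:R^-1)); last first.
  by rewrite -(mulr0 2); apply: cvgM; [exact: cvg_cst|exact: cvg_harmonic].
have HR : 0 < H%:R :> R by rewrite ltr0n.
have H1 : H%:R^-1 <= 1 :> R by rewrite invf_le1// ler1n.
move=> [|m].
  by rewrite invr0 mulr0 sub0r normrN ger0_norm ?invr_ge0// invr1; lra.
have m0 : 0 < m.+1%:R :> R by rewrite ltr0n.
set b := mesh _.
have b1 : m.+1%:R <= b%:R * H%:R :> R.
  by rewrite -natrM ler_nat ltnW// -ltn_divLR.
have b2 : (b%:R - 1) * H%:R <= m.+1%:R :> R.
  by rewrite /b /mesh -natr1 addrK -natrM ler_nat leq_divM.
have -> : b%:R / m.+1%:R - H%:R^-1 = (b%:R * H%:R - m.+1%:R) / H%:R / m.+1%:R :> R.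
  by field; rewrite !gt_eqF.
rewrite ger0_norm; last by rewrite !divr_ge0// subr_ge0.
apply: (@le_trans _ _ (1 / m.+1%:R)).
  by rewrite ler_wpM2r ?invr_ge0// ler_pdivrMr//; lra.
rewrite ler_pdivrMr// mulrAC ler_pdivlMr ?ltr0n// mul1r -!natr1.
have : 0 <= m%:R :> R by [].
lra.
Qed.

(* Indices decrease and times increase with [k].  The limiting covariance
   [m / max(n, n')] of the scaled averages is [min(s, s')] in the inverted time
   [s = m / n]; this is how sums after [m] turn into [W] on [0, 1]. *)
Definition grid_index m k := (m + (J - k) * mesh m)%N.

Definition grid_time (k : nat) : R :=
  if k is k'.+1 then H%:R / (H + (J - k'))%:R else 0.

Let HR : 0 < H%:R :> R. Proof. by rewrite ltr0n. Qed.

Let HJ k : 0 < (H + (J - k))%:R :> R. Proof. by rewrite ltr0n addn_gt0 H0. Qed.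

Let grid_time_nd : nondecreasing_seq grid_time.
Proof.
move=> k l; rewrite /grid_time; case: k l => [|k] [|l].
- by [].
- by rewrite divr_ge0.
- by rewrite ltn0.
- by rewrite ltnS => kl; rewrite ler_wpM2l// lef_pV2 ?posrE// ler_nat leq_add2l leq_sub2l.
Qed.

Lemma grid_time_ge0 k : 0 <= grid_time k.
Proof. exact: (grid_time_nd (leq0n k)). Qed.

Lemma grid_time_le1 k : grid_time k <= 1.
Proof. by case: k => [|k] //=; rewrite ler_pdivrMr// mul1r ler_nat leq_addr. Qed.

Let grid_time_cvg k : m%:R / (grid_index m k)%:R @[m --> \oo] --> grid_time k.+1.
Proof.
have -> : grid_time k.+1 = (1 + (J - k)%:R * H%:R^-1)^-1.
  by rewrite /= natrD; field; rewrite -natrD !gt_eqF.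
have c : (1 + (J - k)%:R * ((mesh m)%:R / m%:R))^-1 @[m --> \oo] -->
    (1 + (J - k)%:R * H%:R^-1 : R)^-1.
  apply: cvgV; first by rewrite gt_eqF// ltr_wpDr// divr_ge0.
  apply: cvgD; first exact: cvg_cst.
  by apply: cvgM; [exact: cvg_cst|exact: mesh_cvg].
apply: cvg_trans c; apply: near_eq_cvg; near=> m.
have m0 : (0 < m)%N by near: m; exact: nbhs_infty_gt.
have mR : 0 < m%:R :> R by rewrite ltr0n.
have gR : 0 < (grid_index m k)%:R :> R by rewrite ltr0n addn_gt0 m0.
rewrite /grid_index natrD natrM in gR *; field.
by rewrite !gt_eqF.
Unshelve. all: by end_near. Qed.

Lemma grid_lipschitz_cvg :
  lipschitz_cvg P P' (@scaled_sums _ _ R p Z J.+1 grid_index)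
    (@brownian_values R p _ _ W J.+1 grid_time).
Proof.
apply: (scaled_sums_cvg iidZ Z0 covZ bvW (C := (1 + 2 * J)%N)) => //.
- exact: grid_time_le1.
- by move=> m k k' /andP[kk _]; rewrite leq_add2l leq_mul2r leq_sub2l ?orbT.
- by move=> m k _; rewrite leq_addr.
- move=> m; rewrite /grid_index subn0 mulnDl mul1n leq_add ?leqSpred//.
  rewrite -mulnA mulnCA leq_mul2l.
  apply/orP; right; apply: (@leq_trans m.+1); first by rewrite ltnS leq_div.
  by rewrite mul2n -addnn; case: m => [|m] //; rewrite addSn addnS !ltnS leq_addr.
Qed.

(** One Lipschitz function of all grid values, so that a crossing anywhere on the grid is a single
    level event; the default 0 lies below the positive levels to which it is applied. *)
Definition grid_max (x : 'I_J.+1 * 'I_p -> R) : R :=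
  \big[Num.max/0]_(k < J.+1) q (fun j => x (k, j)).

Lemma grid_max_lipschitz x y : `|grid_max x - grid_max y| <= kap * \sum_i `|x i - y i|.
Proof.
have k0 := seminorm_kap sq.
have step (u v : 'I_J.+1 * 'I_p -> R) : grid_max u <= grid_max v + kap * \sum_i `|u i - v i|.
  apply/bigmax_leP; split.
    rewrite addr_ge0 ?mulr_ge0 ?sumr_ge0//.
    exact: bigmax_ge_id.
  move=> k _.
  have := seminorm_lipschitz sq (fun j => u (k, j)) (fun j => v (k, j)).
  rewrite ler_norml => /andP[_ h].
  have h2 : q (fun j => v (k, j)) <= grid_max v.
    by apply: (le_bigmax _ (fun k => q (fun j => v (k, j)))).
  have h3 : \sum_j `|u (k, j) - v (k, j)| <= \sum_i `|u i - v i|.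
    have -> : \sum_i `|u i - v i| = \sum_k \sum_j `|u (k, j) - v (k, j)|.
      by rewrite pair_bigA; apply: eq_bigr => -[].
    by rewrite [leRHS](bigD1 k)//= lerDl sumr_ge0// => k' _; exact: sumr_ge0.
  have := ler_wpM2l k0 h3; lra.
have h1 := step x y; have h2 := step y x.
have e : \sum_i `|y i - x i| = \sum_i `|x i - y i|.
  by apply: eq_bigr => i _; exact: distrC.
by rewrite e in h2; rewrite ler_norml; apply/andP; split; lra.
Qed.

Lemma grid_max_geP c x : 0 < c ->
  (c <= grid_max x) <-> (exists2 k, (k <= J)%N &
     forall k' : 'I_J.+1, k' = k :> nat -> c <= q (fun j => x (k', j))).
Proof.
move=> c0; split => [cx|[k kJ cx]]; last first.
  apply: (le_trans (cx (Ordinal (kJ : (k < J.+1)%N)) erefl)).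
  exact: (le_bigmax _ (fun k => q (fun j => x (k, j)))).
have [k kx|nk] := pickP (fun k : 'I_J.+1 => c <= q (fun j => x (k, j))).
  exists k; first by rewrite -ltnS.
  by move=> k' /val_inj ->.
exfalso; suff : grid_max x < c by rewrite ltNge cx.
apply/bigmax_ltP; split => // k _.
by have /negbT := nk k; rewrite -ltNge.
Qed.

Let scaledE m w (k : 'I_J.+1) :
  q (fun j => @scaled_sums _ _ R p Z J.+1 grid_index m w (k, j)) =
  Num.sqrt m%:R * (q (psum Z (iota 0 (grid_index m k)) w) / (grid_index m k)%:R).
Proof.
have -> : (fun j => @scaled_sums _ _ R p Z J.+1 grid_index m w (k, j)) =
    fun j => (Num.sqrt m%:R / (grid_index m k)%:R) * psum Z (iota 0 (grid_index m k)) w j.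
  by apply/funext => j; rewrite /scaled_sums/=; ring.
by rewrite (seminormZ sq) ger0_norm ?divr_ge0 ?sqrtr_ge0//; ring.
Qed.

Lemma grid_events a b eta : 0 < a -> a < b -> 0 < eta ->
  \forall m \near \oo,
    pr P (\bigcup_(k in [set k | (k < J.+1)%N]) [set w | b <= Num.sqrt m%:R *
       (q (psum Z (iota 0 (grid_index m k)) w) / (grid_index m k)%:R)]) <=
    pr P' (\bigcup_(k in [set k | (k < J.+1)%N])
       [set w | a <= q (bval W (grid_time k.+1) w)]) + eta /\
    pr P' (\bigcup_(k in [set k | (k < J.+1)%N])
       [set w | b <= q (bval W (grid_time k.+1) w)]) <=
    pr P (\bigcup_(k in [set k | (k < J.+1)%N]) [set w | a <= Num.sqrt m%:R *
       (q (psum Z (iota 0 (grid_index m k)) w) / (grid_index m k)%:R)]) + eta.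
Proof.
move=> a0 ab eta0; have b0 := lt_trans a0 ab.
have EX m c : 0 < c -> \bigcup_(k in [set k | (k < J.+1)%N]) [set w | c <= Num.sqrt m%:R *
       (q (psum Z (iota 0 (grid_index m k)) w) / (grid_index m k)%:R)] =
    [set w | c <= grid_max (@scaled_sums _ _ R p Z J.+1 grid_index m w)].
  move=> c0; apply/seteqP; split => [w [k /= kJ cw]|w /= /(grid_max_geP _ c0)[k kJ cw]].
    apply/(grid_max_geP _ c0); by exists k => // k' e; rewrite scaledE e.
  by exists k => //; have := cw (Ordinal (kJ : (k < J.+1)%N)) erefl; rewrite scaledE.
have EY c : 0 < c -> \bigcup_(k in [set k | (k < J.+1)%N])
      [set w | c <= q (bval W (grid_time k.+1) w)] =
    [set w | c <= grid_max (@brownian_values R p _ _ W J.+1 grid_time w)].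
  move=> c0; apply/seteqP; split => [w [k /= kJ cw]|w /= /(grid_max_geP _ c0)[k kJ cw]].
    by apply/(grid_max_geP _ c0); exists k => // k' e;
    rewrite (_ : k' = Ordinal (kJ : (k < J.+1)%N))//; exact: val_inj.
  by exists k => //; have := cw (Ordinal (kJ : (k < J.+1)%N)) erefl.
rewrite (EY _ a0) (EY _ b0).
under eq_near => m do rewrite (EX m _ a0) (EX m _ b0).
apply: (lipschitz_cvg_events _ _ grid_lipschitz_cvg (seminorm_kap sq) grid_max_lipschitz ab eta0).
- by move=> m i; exact: (measurable_scaled_sums iidZ).
- by move=> i; apply: (bv_measurable bvW); exact: grid_time_ge0.
Qed.

End grid.


Section crossing_probabilities.
Context d (T : measurableType d) (R : realType) (P : probability T R) (p : nat).
Variable Z : nat -> T -> 'cV[R]_p.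
Hypotheses (iidZ : iid_vectors P Z) (Z0 : forall i, mean_zero P (Z i)).
Hypothesis covZ : forall i, identity_covariance P (Z i).
Context d' (T' : measurableType d') (P' : probability T' R).
Variables (W : R -> T' -> 'cV[R]_p) (bvW : brownian_vector P' W).
Variables (q : ('I_p -> R) -> R) (kap : R).
Hypothesis sq : bounded_seminorm q kap.

Definition late_crossing (m : nat) (a : R) := \bigcup_(n in [set n | (m <= n)%N])
  [set w | a <= Num.sqrt m%:R * (q (psum Z (iota 0 n) w) / n%:R)].

Lemma measurable_late_crossing m a : measurable (late_crossing m a).
Proof.
by apply: bigcup_measurable => n _; exact: (measurable_average_event iidZ sq).
Qed.

Lemma late_crossing_lower a del eta : 0 < a -> 0 < del -> 0 < eta ->
  \forall m \near \oo,
    pr P' (exceeds W q (a + del)) <= pr P (late_crossing m a) + eta.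
Proof.
move=> a0 del0 eta0; have e2 : 0 < eta / 2 by rewrite divr_gt0.
have [l l0 hl] := frac_exceeds_approx bvW sq (a + del) e2.
(* The factorial is a multiple of every a + 1 with a < l, so each [frac a b] in [frac_exceeds] is H
   / (H + i) with i = (H / (a + 1)) b, and [J] is large enough to contain these i. *)
pose H := l`!; pose J := (H * l)%N.
have H0 : (0 < H)%N by exact: fact_gt0.
have aa : a < a + del by rewrite ltrDl.
near=> m.
have [_ h] : pr P (\bigcup_(k in [set k | (k < J.+1)%N]) [set w | a + del <= Num.sqrt m%:R *
       (q (psum Z (iota 0 (grid_index H J m k)) w) / (grid_index H J m k)%:R)]) <=
    pr P' (\bigcup_(k in [set k | (k < J.+1)%N])
       [set w | a <= q (bval W (grid_time R H J k.+1) w)]) + eta / 2 /\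
    pr P' (\bigcup_(k in [set k | (k < J.+1)%N])
       [set w | a + del <= q (bval W (grid_time R H J k.+1) w)]) <=
    pr P (\bigcup_(k in [set k | (k < J.+1)%N]) [set w | a <= Num.sqrt m%:R *
       (q (psum Z (iota 0 (grid_index H J m k)) w) / (grid_index H J m k)%:R)]) + eta / 2.
  by near: m; exact: (grid_events iidZ Z0 covZ bvW sq _ H0 a0 aa e2).
have h1 : pr P (\bigcup_(k in [set k | (k < J.+1)%N]) [set w | a <= Num.sqrt m%:R *
       (q (psum Z (iota 0 (grid_index H J m k)) w) / (grid_index H J m k)%:R)]) <=
    pr P (late_crossing m a).
  apply: pr_le; [|exact: measurable_late_crossing|].
    by apply: bigcup_measurable => k _; exact: (measurable_average_event iidZ sq).
  move=> w [k /= _ kw]; exists (grid_index H J m k) => //=.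
  by rewrite leq_addr.
have h2 : pr P' (frac_exceeds W q (a + del) l) <=
   pr P' (\bigcup_(k in [set k | (k < J.+1)%N])
       [set w | a + del <= q (bval W (grid_time R H J k.+1) w)]).
  apply: pr_le; [exact: (measurable_frac_exceeds bvW sq)| |].
    apply: bigcup_measurable => k _; apply: (measurable_seminorm_event sq) => j.
    by apply: (bv_measurable bvW); exact: grid_time_ge0.
  move=> w [x /= xl [b /= bl cw]].
  have xH : (x.+1 %| H)%N by rewrite dvdn_fact.
  pose i := (H %/ x.+1 * b)%N.
  have iJ : (i <= J)%N.
    by rewrite leq_mul ?leq_div// ltnW.
  exists (J - i)%N => /=; first by rewrite ltnS leq_subr.
  rewrite subKn//; have -> : H%:R / (H + i)%:R = frac R x b.
    have e : (x.+1 * i = H * b)%N by rewrite mulnA (mulnC x.+1) divnK.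
    have HR : 0 < H%:R :> R by rewrite ltr0n.
    have e' : x.+1%:R * i%:R = H%:R * b%:R :> R by rewrite -!natrM e.
    rewrite /frac -addSn !natrD; apply/eqP.
    have n1 : H%:R + i%:R != 0 :> R by rewrite -natrD pnatr_eq0 addn_eq0 negb_and -lt0n H0.
    have n2 : x.+1%:R + b%:R != 0 :> R by rewrite -natrD pnatr_eq0.
    by rewrite eqr_div//; apply/eqP; rewrite !mulrDr e'; ring.
  exact: ltW.
lra.
Unshelve. all: by end_near. Qed.

(* Between grid indices the averages move little by [block_oscillation]; beyond
   [A m] they are small by [psum_tail]. *)
Lemma late_crossing_upper a del eta : 0 < del -> del < a -> 0 < eta ->
  \forall m \near \oo,
    pr P (late_crossing m a) <= pr P' (exceeds W q (a - del)) + eta.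
Proof.
move=> del0 dela eta0; have a0 := lt_trans del0 dela.
set C := kap ^+ 2 * p%:R ^+ 2.
have C0 : 0 <= C by rewrite mulr_ge0// sqr_ge0.
have e4 : 0 < eta / 4 by rewrite divr_gt0.
pose K := oscillation_cst p kap.
have K0 : 0 <= K := oscillation_cst_ge0 p kap.
(* This makes the bound of [psum_tail] for the indices beyond A m at most eta / 4. *)
have [A A0 hA] := archi_nat (32 * C / (a ^+ 2 * (eta / 4))).
have AR : 0 < A%:R :> R by rewrite ltr0n.
pose dl := del / 2; have dl0 : 0 < dl by rewrite divr_gt0.
(* [H1] secures the condition of [block_oscillation] for h = 1 / H. [H2] makes the main terms of the
   A H blocks, A H * K / (H^2 dl^4) together, at most eta / 4. *)
have [H1 H10 hH1] := archi_nat (16 * C / dl ^+ 2).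
have [H2 H20 hH2] := archi_nat (A%:R * K / (dl ^+ 4 * (eta / 4))).
pose H := (H1 + H2)%N; have H0 : (0 < H)%N by rewrite addn_gt0 H10.
have HR : 0 < H%:R :> R by rewrite ltr0n.
pose J := (A * H)%N; have J0 : (0 < J)%N by rewrite muln_gt0 A0.
have JR : 0 < J%:R :> R by rewrite ltr0n.
have hh : 0 < H%:R^-1 :> R by rewrite invr_gt0.
have eJ : 0 < eta / 4 / J%:R by rewrite divr_gt0.
have osc : 16 * C * H%:R^-1 <= dl ^+ 2.
  rewrite ler_pdivrMr// [leRHS]mulrC -ler_pdivrMr ?exprn_gt0//.
  by apply: le_trans hH1 _; rewrite ler_nat leq_addr.
(* Of the allowed loss del = 2 dl, one dl goes to the oscillation inside a block, dl / 2 to the gap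
   of [grid_events], and dl / 2 to the strict inequality in [exceeds]. *)
have ab : a - 3 / 2 * dl < a - dl by rewrite ltrD2l ltrN2; lra.
have a32 : 0 < a - 3 / 2 * dl by rewrite /dl; lra.
pose B m j := \bigcup_(k in [set k | (k < (mesh H m).+1)%N])
  [set w | dl * Num.sqrt m%:R <= q (psum Z (iota (m + j * mesh H m) k) w)].
have mB m j : measurable (B m j).
  by apply: bigcup_measurable => k _; exact: (measurable_psum_event iidZ sq).
have hB : \forall m \near \oo, forall j : 'I_J, pr P (B m j) <=
    K * H%:R^-1 ^+ 2 / dl ^+ 4 + eta / 4 / J%:R.
  apply: filter_forall => j.
  have := block_oscillation iidZ Z0 covZ bvW sq (fun m => m + j * mesh H m)%N hh
    (mesh_cvg H0) dl0 eJ osc.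
  by apply: filterS => m.
pose G m c := \bigcup_(k in [set k | (k < J.+1)%N]) [set w | c <= Num.sqrt m%:R *
       (q (psum Z (iota 0 (grid_index H J m k)) w) / (grid_index H J m k)%:R)].
pose G' c := \bigcup_(k in [set k | (k < J.+1)%N])
       [set w | c <= q (bval W (grid_time R H J k.+1) w)].
have evG : \forall m \near \oo,
    pr P (G m (a - dl)) <= pr P' (G' (a - 3 / 2 * dl)) + eta / 4 /\
    pr P' (G' (a - dl)) <= pr P (G m (a - 3 / 2 * dl)) + eta / 4.
  by have := grid_events iidZ Z0 covZ bvW sq J H0 a32 ab e4; apply: filterS => m.
near=> m.
have m0 : (0 < m)%N by near: m; exact: nbhs_infty_gt.
have mR : 0 < m%:R :> R by rewrite ltr0n.
have sm : 0 < Num.sqrt m%:R :> R by rewrite sqrtr_gt0.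
have smE : Num.sqrt m%:R ^+ 2 = m%:R :> R by rewrite sqr_sqrtr// ltW.
have mG c : measurable (G m c).
  by apply: bigcup_measurable => k _; exact: (measurable_average_event iidZ sq).
have [hG _] : pr P (G m (a - dl)) <= pr P' (G' (a - 3 / 2 * dl)) + eta / 4 /\
    pr P' (G' (a - dl)) <= pr P (G m (a - 3 / 2 * dl)) + eta / 4 by near: m.
have hG' : pr P' (G' (a - 3 / 2 * dl)) <= pr P' (exceeds W q (a - del)).
  apply: pr_le; [|exact: (measurable_exceeds bvW sq)|].
    apply: bigcup_measurable => k _; apply: (measurable_seminorm_event sq) => j.
    by apply: (bv_measurable bvW); exact: grid_time_ge0.
  move=> w [k /= _ kw]; exists (grid_time R H J k.+1).
    by apply/andP; split; [exact: grid_time_ge0|exact: grid_time_le1].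
  by apply: lt_le_trans kw; rewrite ltrD2l ltrN2 /dl; lra.
pose Tl := \bigcup_(n in [set n | (A * m <= n)%N])
    [set w | a <= Num.sqrt m%:R * (q (psum Z (iota 0 n) w) / n%:R)].
have mTl : measurable Tl.
  by apply: bigcup_measurable => k _; exact: (measurable_average_event iidZ sq).
have hT : pr P Tl <= eta / 4.
  apply: (le_trans (psum_tail iidZ Z0 covZ sq m0 A0 a0)); rewrite -/C.
  move: hA; rewrite ler_pdivrMr; last by rewrite mulr_gt0// exprn_gt0.
  move=> hA; rewrite ler_pdivrMr; last by rewrite mulr_gt0// exprn_gt0.
  by apply: le_trans hA _; rewrite le_eqVlt; apply/orP; left; apply/eqP; ring.
pose O := \bigcup_(j in [set j | (j < J)%N]) B m j.
have mO : measurable O by apply: bigcup_measurable => j _; exact: mB.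
have hO : pr P O <= eta / 2.
  have hBm : forall j : 'I_J, pr P (B m j) <= K * H%:R^-1 ^+ 2 / dl ^+ 4 + eta / 4 / J%:R.
    by near: m.
  apply: (le_trans (pr_bigcup_lt _ _ (mB m))).
  apply: (@le_trans _ _ (\sum_(j < J) (K * H%:R^-1 ^+ 2 / dl ^+ 4 + eta / 4 / J%:R))).
    by apply: ler_sum => j _; exact: hBm.
  rewrite sumr_const card_ord -[leLHS]mulr_natl mulrDr.
  have -> : J%:R * (eta / 4 / J%:R) = eta / 4 by field; rewrite gt_eqF.
  have -> : J%:R * (K * H%:R^-1 ^+ 2 / dl ^+ 4) = A%:R * K / (H%:R * dl ^+ 4).
    by rewrite /J natrM; field; rewrite !gt_eqF.
  have : A%:R * K / (H%:R * dl ^+ 4) <= eta / 4.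
    have d4 : 0 < dl ^+ 4 by rewrite exprn_gt0.
    rewrite ler_pdivrMr; last by rewrite mulr_gt0.
    move: hH2; rewrite ler_pdivrMr; last by rewrite mulr_gt0.
    have H2H : H2%:R <= H%:R :> R by rewrite ler_nat leq_addl.
    have d5 : 0 <= dl ^+ 4 * (eta / 4) by rewrite ltW// mulr_gt0.
    have := ler_wpM2r d5 H2H.
    set x := dl ^+ 4; lra.
  lra.
have sub : late_crossing m a `<=` (Tl `|` O) `|` G m (a - dl).
  move=> w [n /= mn aw].
  have [An|nA] := leqP (A * m) n; first by left; left; exists n.
  have n0 : (0 < n)%N by exact: leq_trans mn.
  have nR : 0 < n%:R :> R by rewrite ltr0n.
  pose b := mesh H m.
  have b0 : (0 < b)%N by [].
  (* The block containing n and its left end, which is grid index number J - j because grid indices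
     decrease. *)
  pose j := ((n - m) %/ b)%N; pose g := (m + j * b)%N.
  have jn : (j * b <= n - m)%N by exact: leq_divM.
  have gn : (g <= n)%N by rewrite /g -leq_subRL.
  have ng : (n - g < b)%N.
    by rewrite subnDA ltn_subLR// addnC -mulSn -ltn_divLR.
  have jJ : (j < J)%N.
    rewrite ltn_divLR// (leq_ltn_trans (leq_subr _ _))// (leq_trans nA)//.
    rewrite -mulnA leq_mul2l; apply/orP; right.
    by rewrite mulnC ltnW// -ltn_divLR.
  have gk : g = grid_index H J m (J - j) by rewrite /grid_index subKn// ltnW.
  have [big|small] := leP (dl * Num.sqrt m%:R) (q (psum Z (iota g (n - g)) w)).
    by left; right; exists j => //=; exists (n - g)%N => //=; rewrite ltnS ltnW.
  right; exists (J - j)%N => /=; first by rewrite ltnS leq_subr.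
  rewrite -gk.
  have g0 : (0 < g)%N by rewrite addn_gt0 m0.
  have gR : 0 < g%:R :> R by rewrite ltr0n.
  have qS : q (psum Z (iota 0 n) w) <= q (psum Z (iota 0 g) w) + q (psum Z (iota g (n - g)) w).
    apply: le_trans (seminormD sq _ _); rewrite le_eqVlt; apply/orP; left; apply/eqP.
    congr q; apply/funext => i; rewrite /psum -[in LHS](subnKC gn) iotaD big_cat/=.
    by rewrite add0n.
  rewrite mulrA ler_pdivlMr//.
  rewrite mulrA ler_pdivlMr// in aw.
  (* From m <= g <= n: a g <= a n <= sqrt m q(S_g) + dl m, and dl m <= dl g, so the average at g
     reaches a - dl. *)
  have gnR : g%:R <= n%:R :> R by rewrite ler_nat.
  have mgR : m%:R <= g%:R :> R by rewrite ler_nat leq_addr.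
  have h1 := ler_wpM2l (ltW sm) qS.
  have h2 : Num.sqrt m%:R * q (psum Z (iota g (n - g)) w) <= dl * m%:R.
    by have := ler_wpM2l (ltW sm) (ltW small); rewrite [leRHS]mulrCA -expr2 smE.
  have h3 : dl * m%:R <= dl * g%:R by rewrite ler_pM2l.
  have h4 : a * g%:R <= a * n%:R by rewrite ler_pM2l.
  rewrite mulrBl; move: aw h1 h2 h3 h4; rewrite mulrDr.
  set x := Num.sqrt _ * q (psum Z (iota 0 n) w).
  set y := Num.sqrt _ * q (psum Z (iota g (n - g)) w).
  set z := Num.sqrt _ * q (psum Z (iota 0 g) w).
  lra.
have mTO : measurable (Tl `|` O) by exact: measurableU.
have := @pr_le _ _ _ P _ _ (measurable_late_crossing m a) (measurableU _ _ mTO (mG (a - dl))) sub.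
have h1 := pr_setU P mTO (mG (a - dl)).
have h2 := pr_setU P mTl mO.
lra.
Unshelve. all: by end_near. Qed.

End crossing_probabilities.

(** * The last exit index *)


Section ereal_suprema.
Context {R : realType} {I : Type}.
Implicit Types (A : set I) (f : I -> R).

Lemma ereal_sup_EFin_leP A f (c : R) :
  (ereal_sup [set (f s)%:E | s in A] <= c%:E)%E <-> (forall s, A s -> f s <= c).
Proof.
split=> [h s As|h].
  by rewrite -lee_fin; apply: le_trans h; apply: ereal_sup_ubound; exists s.
by apply: ge_ereal_sup => _ [s As <-]; rewrite lee_fin; exact: h.
Qed.

Lemma ereal_sup_EFin_ge0 A f s : A s -> 0 <= f s ->
  (0 <= ereal_sup [set (f s)%:E | s in A])%E.
Proof.
by move=> As fs; apply: (@le_trans _ _ (f s)%:E) => //; apply: ereal_sup_ubound; exists s.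
Qed.

Lemma sqre_leP (x : \bar R) (c : R) : (0 <= x)%E -> 0 <= c ->
  (x ^+ 2 <= c%:E)%E = (x <= (Num.sqrt c)%:E)%E.
Proof.
case: x => [r| |] r0 c0; [|by rewrite expe2 mulyy !leye_eq|by []].
rewrite -EFin_expe !lee_fin; rewrite lee_fin in r0.
by rewrite -[in RHS](ger0_norm r0) -sqrtr_sqr ler_sqrt.
Qed.

Lemma sqr_ereal_sup A f s0 : A s0 -> (forall s, 0 <= f s) ->
  (ereal_sup [set (f s)%:E | s in A] ^+ 2 = ereal_sup [set (f s ^+ 2)%:E | s in A])%E.
Proof.
move=> As0 f0; have S0 := ereal_sup_EFin_ge0 As0 (f0 s0).
apply/eqP; rewrite eq_le; apply/andP; split; last first.
  apply: ge_ereal_sup => _ [s As <-].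
  have : ((f s)%:E <= ereal_sup [set (f s)%:E | s in A])%E.
    by apply: ereal_sup_ubound; exists s.
  case: (ereal_sup _) S0 => [r| |] // r0 fr; last by rewrite expe2 mulyy leey.
  rewrite -EFin_expe lee_fin lerXn2r ?nnegrE//.
have : (0 <= ereal_sup [set (f s ^+ 2)%:E | s in A])%E.
  by apply: (ereal_sup_EFin_ge0 As0); exact: sqr_ge0.
case E : (ereal_sup [set (f s ^+ 2)%:E | s in A]) => [r| |] // r0; last by rewrite leey.
rewrite sqre_leP//; apply/ereal_sup_EFin_leP => s As.
rewrite -(ger0_norm (f0 s)) -sqrtr_sqr ler_wsqrtr// -lee_fin -E.
by apply: ereal_sup_ubound; exists s.
Qed.

End ereal_suprema.

Lemma col_coordE (R : realType) (p : nat) (x : 'cV[R]_p) : \col_i x i ord0 = x.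
Proof. by apply/matrixP => i j; rewrite mxE (ord1 j). Qed.

(** * The distance function as a seminorm on coordinates *)

Section distance_functions.
Context (R : realType) (p : nat) (nrm : 'cV[R]_p -> R).
Hypothesis dn : distance_function nrm.

Lemma distance_seminorm (M : 'M[R]_p) :
  exists kap, bounded_seminorm (fun x => nrm (M *m \col_i x i)) kap.
Proof.
have [nD _ _ nZ [c nc]] := dn.
(* The sign of [c] is not given, hence the absolute value. *)
exists (`|c| * \sum_i \sum_j `|M i j|); split.
- by rewrite mulr_ge0// sumr_ge0// => i _; exact: sumr_ge0.
- move=> x y; rewrite (_ : \col_i (x i + y i) = \col_i x i + \col_i y i) ?mulmxDr//.
  by apply/matrixP => i j; rewrite !mxE.
- move=> a x; rewrite (_ : \col_i (a * x i) = a *: \col_i x i) -?scalemxAr ?nZ//.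
  by apply/matrixP => i j; rewrite !mxE.
- move=> x; apply: (le_trans (nc _)).
  apply: (@le_trans _ _ (`|c| * \sum_i `|(M *m \col_i x i) i ord0|)).
    by rewrite ler_wpM2r ?ler_norm// sumr_ge0.
  rewrite -mulrA ler_wpM2l// mulr_suml; apply: ler_sum => i _.
  rewrite mxE (le_trans (ler_norm_sum _ _ _))// mulr_suml; apply: ler_sum => j _.
  by rewrite mxE normrM ler_wpM2l// (bigD1 j)//= lerDl sumr_ge0.
Qed.

Lemma distance_coord : exists kap, bounded_seminorm (fun x => nrm (\col_i x i)) kap.
Proof.
have [kap h] := distance_seminorm 1%:M; exists kap.
by rewrite (_ : (fun x => _) = fun x => nrm (1%:M *m \col_i x i))//;
  apply/funext => x; rewrite mul1mx.
Qed.

Lemma distance_ge0 x : 0 <= nrm x.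
Proof. by have [kap /seminorm_ge0/(_ (fun i => x i ord0))] := distance_coord; rewrite col_coordE. Qed.

Lemma distance_triangle x y : nrm x <= nrm y + nrm (x - y).
Proof. by have [nD _ _ _ _] := dn; rewrite -[X in nrm X <= _](subrKC y). Qed.

Lemma distanceN x : nrm (- x) = nrm x.
Proof. by have [_ _ _ nZ _] := dn; rewrite -scaleN1r nZ normrN1 mul1r. Qed.

Lemma measurable_distance d (T : measurableType d) (V : T -> 'cV[R]_p) :
  random_vector V -> measurable_fun setT (fun w => nrm (V w)).
Proof.
move=> mV; have [kap sq] := distance_coord.
rewrite (_ : (fun w => _) = fun w => nrm (\col_i V w i ord0)).
  exact: (measurable_seminorm sq).
by apply/funext => w; rewrite col_coordE.
Qed.

End distance_functions.

Lemma late_index_cvg (R : realType) (x : R) : 0 < x ->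
  (Num.truncn (x / eps ^+ 2)).+1 @[eps --> 0^'+] --> \oo.
Proof.
move=> x0; apply/cvgnyPge => A; near=> eps.
have e0 : 0 < eps by near: eps; exact: nbhs_right_gt.
have A0 : 0 < A.+1%:R :> R by rewrite ltr0n.
have e1 : eps < 1 by near: eps; exact: nbhs_right_lt.
have eA : eps < x / A.+1%:R by near: eps; apply: nbhs_right_lt; rewrite divr_gt0.
have e2 : 0 < eps ^+ 2 by rewrite exprn_gt0.
apply: ltnW; rewrite -(ltr_nat R); apply: (@le_lt_trans _ _ (x / eps ^+ 2)).
  rewrite ltr_pdivlMr// in eA; rewrite ler_pdivlMr//.
  apply: (@le_trans _ _ (eps * A.+1%:R)); last exact: ltW.
  rewrite mulrC -natr1 expr2; have := ler_piMr (ltW e0) (ltW e1).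
  have A1 : 0 <= A%:R :> R by []. nra.
exact: truncnS_gt.
Unshelve. all: by end_near. Qed.

(** Square roots of x <= m eps^2 <= x + eps^2 <= (sqrt x + eps)^2, where m is the least integer
    above x / eps^2. *)
Lemma late_index_bounds (R : realType) (x eps : R) : 0 <= x -> 0 < eps ->
  Num.sqrt x <= Num.sqrt (Num.truncn (x / eps ^+ 2)).+1%:R * eps <= Num.sqrt x + eps.
Proof.
move=> x0 e0; have e2 : 0 < eps ^+ 2 by rewrite exprn_gt0.
have xe : 0 <= x / eps ^+ 2 by rewrite divr_ge0// ltW.
have /andP[t1 t2] := truncn_itv xe.
set m := (Num.truncn _).+1 in t2 *.
have sx := sqrtr_ge0 x.
have -> : Num.sqrt m%:R * eps = Num.sqrt (m%:R * eps ^+ 2).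
  by rewrite sqrtrM// sqrtr_sqr gtr0_norm.
apply/andP; split; first by rewrite ler_wsqrtr// -ler_pdivrMr// ltW.
rewrite -[leRHS]ger0_norm; last by rewrite addr_ge0// ltW.
rewrite -sqrtr_sqr ler_wsqrtr// sqrrD sqr_sqrtr//.
rewrite /m -natr1 mulrDl mul1r; move: t1; rewrite ler_pdivlMr// => t1.
have : 0 <= Num.sqrt x * eps *+ 2 by rewrite mulrn_wge0// mulr_ge0// ltW.
lra.
Qed.

(** * From the last exit index to crossings of the averages *)

Section last_exit.
Context d (T : measurableType d) (R : realType) (P : probability T R) (p : nat).
Variables (nrm : 'cV[R]_p -> R) (theta0 : 'cV[R]_p) (theta Rn Z : nat -> T -> 'cV[R]_p).
Variable M : 'M[R]_p.
Hypothesis dn : distance_function nrm.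
Hypothesis mtheta : forall n : nat, (1 <= n)%N -> random_vector (theta n).
Hypothesis mRn : forall n : nat, (1 <= n)%N -> random_vector (Rn n).
Hypothesis iidZ : iid_vectors P Z.
Hypothesis theta_eq : forall (n : nat) (w : T), (1 <= n)%N ->
  theta n w - theta0 = M *m (n%:R^-1 *: \sum_(i < n) Z i w) + Rn n w.

Let dist n w := nrm (theta n w - theta0).

Definition exit_event (m : nat) (eps : R) :=
  \bigcup_(n in [set n | (m <= n)%N]) [set w | eps <= dist n w].

Lemma measurable_exit_event m eps : (0 < m)%N -> measurable (exit_event m eps).
Proof.
move=> m0; apply: bigcup_measurable => n /= mn; have n0 := leq_trans m0 mn.
apply: measurable_superlevel; apply: (measurable_distance dn) => i.
under eq_fun do rewrite !mxE.
by apply: measurable_funB => //; exact: mtheta.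
Qed.

(** For integers n, n eps^2 > x means n >= m, so the translation is exact; x >= 0 takes care of the
    element 0 added to the supremum. *)
Lemma last_exit_le (x eps : R) : 0 <= x -> 0 < eps ->
  [set w | ((eps ^+ 2)%:E * last_exit nrm theta theta0 eps w <= x%:E)%E] =
  ~` exit_event (Num.truncn (x / eps ^+ 2)).+1 eps.
Proof.
move=> x0 e0; have e2 : 0 < eps ^+ 2 by rewrite exprn_gt0.
have xe : 0 <= x / eps ^+ 2 by rewrite divr_ge0// ltW.
have /andP[t1 t2] := truncn_itv xe.
apply/seteqP; split => [w /= h [n /= mn en]|w /= h].
  have : (n%:R%:E <= last_exit nrm theta theta0 eps w)%E.
    apply: ereal_sup_ubound; right; exists n => //=; split => //.
    exact: leq_trans mn.
  move=> h2; have : ((eps ^+ 2)%:E * n%:R%:E <= x%:E)%E.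
    by apply: le_trans h; rewrite lee_pmul2l// lte_fin.
  rewrite -EFinM lee_fin mulrC -ler_pdivlMr// => h3.
  have : (n%:R : R) < (Num.truncn (x / eps ^+ 2)).+1%:R by exact: le_lt_trans t2.
  by rewrite ltr_nat ltnNge mn.
rewrite -lee_pdivlMl// -EFinM mulrC.
apply: ge_ereal_sup => _ [->|[n [n0 en] <-]]; rewrite lee_fin//.
apply: le_trans t1; rewrite ler_nat leqNgt; apply/negP => tn.
by apply: h; exists n.
Qed.

Let q x := nrm (M *m \col_i x i).

Lemma averageE n w : (0 < n)%N ->
  nrm (M *m (n%:R^-1 *: \sum_(i < n) Z i w)) = q (psum Z (iota 0 n) w) / n%:R.
Proof.
move=> n0; have [_ _ _ nZ _] := dn.
rewrite -scalemxAr nZ ger0_norm ?invr_ge0// mulrC; congr (nrm (M *m _) * _).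
apply/matrixP => i j; rewrite mxE summxE (ord1 j) /psum.
by rewrite big_iota_ord.
Qed.

Definition tail_event (m : nat) (del : R) :=
  [set w | (del%:E <= `|tail_sup nrm Rn m w|)%E].

Lemma measurable_tail_event m del : (0 < m)%N -> measurable (tail_event m del).
Proof.
move=> m0; rewrite /tail_event -[X in measurable X]setTI.
apply: emeasurable_fun_c_infty => //; apply: measurableT_comp => //.
rewrite /tail_sup; apply: measurable_funeM.
(* Measurability of [Rn 0] is not among the hypotheses; index 0 is replaced by 0, which changes
   nothing above m > 0. *)
pose f (n : nat) w : \bar R := if n is 0 then 0%E else (nrm (Rn n w))%:E.
have mf n : measurable_fun setT (f n).
  case: n => [|n]; first exact: measurable_cst.
  by apply/measurable_EFinP; apply: (measurable_distance dn); exact: mRn.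
rewrite (_ : (fun w => _) = fun w => esups (f ^~ w) m).
  exact: measurable_fun_esups.
apply/funext => w; rewrite /esups/= /sdrop; congr ereal_sup.
apply/seteqP; split => _ [n /= mn <-]; exists n => //=;
  by case: n mn => // mn; move: (leq_trans m0 mn).
Qed.

Lemma tail_event_lt m n del w : (0 < m <= n)%N -> ~ tail_event m del w ->
  Num.sqrt m%:R * nrm (Rn n w) < del.
Proof.
move=> /andP[m0 mn] /negP; rewrite -ltNge /tail_sup => h.
rewrite -lte_fin; apply: le_lt_trans h; apply: (le_trans _ (lee_abs _)).
rewrite EFinM lee_pmul2l// ?lte_fin ?sqrtr_gt0 ?ltr0n//.
by apply: ereal_sup_ubound; exists n.
Qed.

Lemma exit_event_sub m eps del s : (0 < m)%N ->
  s <= Num.sqrt m%:R * eps ->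
  exit_event m eps `<=` late_crossing Z q m (s - del) `|` tail_event m del.
Proof.
move=> m0 sm w [n /= mn en].
have [tw|ntw] := pselect (tail_event m del w); [by right|left].
have n0 := leq_trans m0 mn.
exists n => //=; rewrite -averageE//.
have mnn : (0 < m <= n)%N by rewrite m0.
have h1 := tail_event_lt mnn ntw.
have h2 : eps <= nrm (M *m (n%:R^-1 *: \sum_(i < n) Z i w)) + nrm (Rn n w).
  by apply: (le_trans en); rewrite /dist theta_eq//; have [nD _ _ _ _] := dn.
have sq0 : 0 <= Num.sqrt m%:R :> R by [].
have := ler_wpM2l sq0 h2; rewrite mulrDr.
lra.
Qed.

Lemma late_crossing_sub m eps del s : (0 < m)%N ->
  Num.sqrt m%:R * eps <= s ->
  late_crossing Z q m (s + del) `<=` exit_event m eps `|` tail_event m del.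
Proof.
move=> m0 sm w [n /= mn en].
have [tw|ntw] := pselect (tail_event m del w); [by right|left].
have n0 := leq_trans m0 mn.
exists n => //=; move: en; rewrite -averageE// => en.
have mnn : (0 < m <= n)%N by rewrite m0.
have h1 := tail_event_lt mnn ntw.
have sq0 : 0 < Num.sqrt m%:R :> R by rewrite sqrtr_gt0 ltr0n.
rewrite -(ler_pM2l sq0).
have h2 : nrm (M *m (n%:R^-1 *: \sum_(i < n) Z i w)) <= dist n w + nrm (Rn n w).
  have := distance_triangle dn (M *m (n%:R^-1 *: \sum_(i < n) Z i w)) (theta n w - theta0).
  by rewrite {2}theta_eq// opprD addNKr distanceN.
have := ler_wpM2l (ltW sq0) h2; rewrite mulrDr.
lra.
Qed.

End last_exit.


Theorem mainTheorem1 (R : realType) (p : nat)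
    (nrm : 'cV[R]_p -> R)
    (d : measure_display) (T : measurableType d) (P : probability T R)
    (theta0 : 'cV[R]_p) (theta Rn Z : nat -> T -> 'cV[R]_p)
    (Sigma0 Sigma0_half : 'M[R]_p)
    (d' : measure_display) (T' : measurableType d') (P' : probability T' R)
    (W : R -> T' -> 'cV[R]_p) :
  distance_function nrm ->
  (forall n : nat, (1 <= n)%N -> random_vector (theta n)) ->
  (forall n : nat, (1 <= n)%N -> random_vector (Rn n)) ->
  iid_vectors P Z ->
  (forall i : nat, mean_zero P (Z i)) ->
  (forall i : nat, identity_covariance P (Z i)) ->
  sym_psd Sigma0 ->
  sym_psd_sqrt Sigma0 Sigma0_half ->
  (* Z i is the (i+1)-st variable of the i.i.d. sequence *)
  (forall (n : nat) (w : T), (1 <= n)%N ->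
     theta n w - theta0
       = Sigma0_half *m (n%:R^-1 *: \sum_(i < n) Z i w) + Rn n w) ->
  cvg_in_probability0 P (tail_sup nrm Rn) ->
  brownian_vector P' W ->
  let G (s : R) (w : T') : 'cV[R]_p := Sigma0_half *m W s w in
  let Gmax (w : T') : \bar R := ereal_sup [set (nrm (G s w))%:E | s in `[0, 1]] in
  cvg_in_distribution 0^'+
    P (fun (eps : R) (w : T) =>
         ((eps ^+ 2)%:E * last_exit nrm theta theta0 eps w)%E)
    P' (fun w : T' => (Gmax w ^+ 2)%E)
  /\ (forall w : T', (Gmax w ^+ 2)%E =
        ereal_sup [set ((nrm (Sigma0_half *m W s w)) ^+ 2)%:E | s in `[0, 1]]).
Proof.
move=> dn mtheta mRn iidZ Z0 covZ _ _ theta_eq cvD bvW G Gmax.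
have [kap sq] := distance_seminorm dn Sigma0_half.
pose q (x : 'I_p -> R) := nrm (Sigma0_half *m \col_i x i).
have qE s w : q (bval W s w) = nrm (G s w) by rewrite /q /bval col_coordE.
have in01 : `[0, 1]%classic (0 : R) by rewrite /= in_itv/= lexx ler01.
have G0 w : (0 <= Gmax w)%E.
  by apply: (ereal_sup_EFin_ge0 in01); exact: (distance_ge0 dn).
split; last by move=> w; apply: (sqr_ereal_sup in01) => s; exact: (distance_ge0 dn).
pose B y := [set w | (Gmax w ^+ 2 <= y%:E)%E].
pose F y := pr P' (B y).
have B_exceeds y : 0 <= y -> B y = ~` exceeds W q (Num.sqrt y).
  move=> y0; apply/seteqP; split => w; rewrite /B/= sqre_leP// => h.
    move: h => /ereal_sup_EFin_leP h [s s01]; rewrite qE ltNge h//.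
  apply/ereal_sup_EFin_leP => s s01; rewrite leNgt; apply/negP => hs.
  by apply: h; exists s; rewrite ?qE//; move: s01; rewrite /= in_itv.
have B_lt0 y : y < 0 -> B y = set0.
  move=> y0; apply/seteqP; split => // w; rewrite /B/= => h.
  by have := le_trans (expe_ge0 2 (G0 w)) h; rewrite lee_fin leNgt y0.
have mB y : measurable (B y).
  have [y0|/B_lt0->//] := leP 0 y.
  by rewrite B_exceeds//; apply: measurableC; exact: (measurable_exceeds bvW sq).
have FE y : 0 <= y -> F y = 1 - pr P' (exceeds W q (Num.sqrt y)).
  by move=> y0; rewrite /F B_exceeds// pr_setC//; exact: (measurable_exceeds bvW sq).
pose E eps y := [set w | ((eps ^+ 2)%:E * last_exit nrm theta theta0 eps w <= y%:E)%E].
have E_lt0 eps y : 0 < eps -> y < 0 -> E eps y = set0.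
  move=> e0 y0; apply/seteqP; split => // w; rewrite /E/= => h.
  have : (0 <= (eps ^+ 2)%:E * last_exit nrm theta theta0 eps w)%E.
    rewrite mule_ge0// ?lee_fin ?sqr_ge0//; apply: ereal_sup_ubound; by left.
  by move=> /le_trans/(_ h); rewrite lee_fin leNgt y0.
have mE eps y : 0 < eps -> measurable (E eps y).
  move=> e0; have [y0|y0] := leP 0 y; last by rewrite E_lt0.
  rewrite /E last_exit_le//; apply: measurableC.
  exact: (measurable_exit_event theta0 dn mtheta).
have tail del eta : 0 < del -> 0 < eta ->
    \forall m \near \oo, pr P (tail_event nrm Rn m del) <= eta.
  move=> del0 eta0; have /fine_cvgP[_ /cvgrPdist_le/(_ eta eta0)] := cvD del del0.
  by apply: filterS => m; rewrite sub0r normrN; apply: le_trans; exact: ler_norm.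
have upper x y eta : 0 < x -> x < y -> 0 < eta ->
    \forall eps \near 0^'+, pr P (E eps x) <= F y + eta.
  move=> x0 xy eta0; have y0 := lt_trans x0 xy.
  have sx0 : 0 < Num.sqrt x by rewrite sqrtr_gt0.
  have sxy : Num.sqrt x < Num.sqrt y by rewrite ltr_sqrt.
  (* One third each for the rounding in m, once eps < del, for the remainder [Rn], and for the gap
     of [late_crossing_lower]. *)
  pose del := (Num.sqrt y - Num.sqrt x) / 3.
  have del0 : 0 < del by rewrite divr_gt0// subr_gt0.
  have e2 : 0 < eta / 2 by rewrite divr_gt0.
  have a0 : 0 < Num.sqrt x + del + del by lra.
  pose m (eps : R) := (Num.truncn (x / eps ^+ 2)).+1.
  have ev1 : \forall eps \near 0^'+, pr P (tail_event nrm Rn (m eps) del) <= eta / 2.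
    exact: (late_index_cvg x0 (tail _ _ del0 e2)).
  have ev2 : \forall eps \near 0^'+, pr P' (exceeds W q (Num.sqrt x + del + del + del)) <=
      pr P (late_crossing Z q (m eps) (Num.sqrt x + del + del)) + eta / 2.
    exact: (late_index_cvg x0 (late_crossing_lower iidZ Z0 covZ bvW sq a0 del0 e2)).
  near=> eps.
  have e0 : 0 < eps by near: eps; exact: nbhs_right_gt.
  have edel : eps < del by near: eps; exact: nbhs_right_lt.
  have h1 : pr P (tail_event nrm Rn (m eps) del) <= eta / 2 by near: eps.
  have h2 : pr P' (exceeds W q (Num.sqrt x + del + del + del)) <=
      pr P (late_crossing Z q (m eps) (Num.sqrt x + del + del)) + eta / 2 by near: eps.
  have m0 : (0 < m eps)%N by [].
  have mx : measurable (exit_event nrm theta0 theta (m eps) eps).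
    exact: (measurable_exit_event theta0 dn mtheta).
  have mt : measurable (tail_event nrm Rn (m eps) del).
    exact: (measurable_tail_event dn mRn).
  have /andP[_ mb] := late_index_bounds (ltW x0) e0.
  have mb' : Num.sqrt (m eps)%:R * eps <= Num.sqrt x + del by apply: (le_trans mb); lra.
  have mc := measurable_late_crossing iidZ sq (m eps) (Num.sqrt x + del + del).
  have := @pr_le _ _ _ P _ _ mc (measurableU _ _ mx mt)
    (late_crossing_sub dn theta_eq m0 mb').
  have := pr_setU P mx mt.
  rewrite FE ?(ltW y0)// /E last_exit_le ?(ltW x0)// pr_setC//.
  have e : Num.sqrt x + del + del + del = Num.sqrt y by rewrite /del; field.
  move: h2; rewrite e -/(m eps); lra.
have lower x y eta : 0 < y -> y < x -> 0 < eta ->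
    \forall eps \near 0^'+, F y <= pr P (E eps x) + eta.
  move=> y0 yx eta0; have x0 := lt_trans y0 yx.
  have sy0 : 0 < Num.sqrt y by rewrite sqrtr_gt0.
  have sxy : Num.sqrt y < Num.sqrt x by rewrite ltr_sqrt.
  (* Two losses only, the remainder and the gap of [late_crossing_upper]: rounding up puts sqrt m *
     eps above sqrt x, the favourable side here. *)
  pose del := (Num.sqrt x - Num.sqrt y) / 2.
  have del0 : 0 < del by rewrite divr_gt0// subr_gt0.
  have e2 : 0 < eta / 2 by rewrite divr_gt0.
  have a0 : del < Num.sqrt x - del by rewrite /del; lra.
  pose m (eps : R) := (Num.truncn (x / eps ^+ 2)).+1.
  have ev1 : \forall eps \near 0^'+, pr P (tail_event nrm Rn (m eps) del) <= eta / 2.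
    exact: (late_index_cvg x0 (tail _ _ del0 e2)).
  have ev2 : \forall eps \near 0^'+, pr P (late_crossing Z q (m eps) (Num.sqrt x - del)) <=
      pr P' (exceeds W q (Num.sqrt x - del - del)) + eta / 2.
    exact: (late_index_cvg x0 (late_crossing_upper iidZ Z0 covZ bvW sq del0 a0 e2)).
  near=> eps.
  have e0 : 0 < eps by near: eps; exact: nbhs_right_gt.
  have h1 : pr P (tail_event nrm Rn (m eps) del) <= eta / 2 by near: eps.
  have h2 : pr P (late_crossing Z q (m eps) (Num.sqrt x - del)) <=
      pr P' (exceeds W q (Num.sqrt x - del - del)) + eta / 2 by near: eps.
  have m0 : (0 < m eps)%N by [].
  have mx : measurable (exit_event nrm theta0 theta (m eps) eps).
    exact: (measurable_exit_event theta0 dn mtheta).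
  have mt : measurable (tail_event nrm Rn (m eps) del).
    exact: (measurable_tail_event dn mRn).
  have mc := measurable_late_crossing iidZ sq (m eps) (Num.sqrt x - del).
  have /andP[mb _] := late_index_bounds (ltW x0) e0.
  have := @pr_le _ _ _ P _ _ mx (measurableU _ _ mc mt)
    (exit_event_sub dn theta_eq del m0 mb).
  have := pr_setU P mc mt.
  rewrite FE ?(ltW y0)// /E last_exit_le ?(ltW x0)// pr_setC//.
  have e : Num.sqrt x - del - del = Num.sqrt y by rewrite /del; field.
  move: h2; rewrite e -/(m eps); lra.
move=> x cx; have cF : F y @[y --> x] --> F x.
  have : P' (B y) @[y --> x] --> (F x)%:E by rewrite pr_fin//; exact: cx.
  by move=> /fine_cvgP[].
rewrite -/(B x) -(pr_fin P' (mB x)); apply/fine_cvgP; split.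
  near=> eps; rewrite fin_num_measure//; apply: mE.
  by near: eps; exact: nbhs_right_gt.
apply/cvgrPdist_le => eta eta0.
have e2 : 0 < eta / 2 by rewrite divr_gt0.
have /cvgrPdist_le/(_ _ e2)/nbhs_ballP[r /= r0 rF] := cF.
have {}rF y : `|x - y| < r -> `|F x - F y| <= eta / 2 by exact: rF.
have [x0|x0] := leP 0 x; last first.
  near=> eps; have e0 : 0 < eps by near: eps; exact: nbhs_right_gt.
  by rewrite /= -/(E eps x) E_lt0// /F B_lt0// measure0 pr0/= subrr normr0 ltW.
(* [upper] asks for a positive level and x may be 0; x + r / 4 is positive in either case, and
   monotonicity in the level leads back to x. *)
have hu : \forall eps \near 0^'+, pr P (E eps (x + r / 4)) <= F (x + r / 2) + eta / 2.
  by apply: upper => //; lra.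
have hl : \forall eps \near 0^'+, F x <= pr P (E eps x) + eta.
  (* At x = 0, continuity makes F 0 at most eta / 2, because F vanishes at negative arguments; the
     lower bound is then immediate. *)
  move: x0; rewrite le_eqVlt => /predU1P[x0|x0].
    have := rF (- (r / 2)); rewrite -x0 /F (B_lt0 (- (r / 2))); last by lra.
    rewrite pr0 subr0 sub0r opprK gtr0_norm; last by lra.
    move=> h; have {h} : pr P' (B 0) <= eta / 2.
      by apply: (le_trans (ler_norm _)); apply: h; lra.
    move=> h; apply: nearW => eps; have := pr_ge0 P (E eps 0); lra.
  (* A point below x that is positive, as [lower] requires, and within the radius of continuity. *)
  pose y := Num.max (x / 2) (x - r / 2).
  have y0 : 0 < y by rewrite lt_max; apply/orP; left; lra.
  have yx : y < x by rewrite gt_max; apply/andP; split; lra.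
  have xyr : `|x - y| < r.
    rewrite gtr0_norm ?subr_gt0//.
    have : x - r / 2 <= y by rewrite le_max lexx orbT.
    lra.
  have := rF _ xyr; rewrite ler_norml => /andP[_ h].
  have := lower x y (eta / 2) y0 yx e2; apply: filterS => eps; lra.
near=> eps; rewrite /= -/(E eps x) -/(pr P (E eps x)).
have e0 : 0 < eps by near: eps; exact: nbhs_right_gt.
have h1 : pr P (E eps (x + r / 4)) <= F (x + r / 2) + eta / 2 by near: eps.
have h2 : F x <= pr P (E eps x) + eta by near: eps.
have h3 : pr P (E eps x) <= pr P (E eps (x + r / 4)).
  apply: pr_le; [exact: mE|exact: mE|] => w; rewrite /E/= => /le_trans; apply.
  by rewrite lee_fin; lra.
have h4 : `|F x - F (x + r / 2)| <= eta / 2.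
  by apply: rF; rewrite opprD addNKr normrN gtr0_norm; lra.
rewrite -/(F x) ler_norml; move: h4; rewrite ler_norml => /andP[h4 _].
by apply/andP; split; lra.
Unshelve. all: by end_near. Qed.
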